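(* Let $(R,\mathfrak{m})$ be a Cohen–Macaulay local ring of dimension one having the canonical module $K_R$. Then the following conditions are equivalent. (1) $R$ is an almost Gorenstein ring. (2) $\operatorname{tr}_R(\mathfrak{m}K_R)\supseteq \mathfrak{m}$.
   Context: All rings are commutative; local rings $(R,\mathfrak m)$ here are Noetherian. Let $(R,\mathfrak{m})$ be a Cohen–Macaulay local ring of dimension one having the canonical module $K_R$. $R$ is called an almost Gorenstein ring if $R$ has an ideal $I$ such that $I\cong K_R$ as $R$-modules and $\mathrm{e}^1_I(R)\le \mathrm{r}(R)$. Here $\mathrm{r}(R)=\ell_R(\operatorname{Ext}^1_R(R/\mathfrak m,R))$ is the Cohen–Macaulay type of $R$, and $\mathrm{e}^1_I(R)$ is the first Hilbert coefficient of $I$, i.e. the integer such that $\ell_R(R/I^{n+1})=\mathrm{e}^0_I(R)(n+1)-\mathrm{e}^1_I(R)$ for all $n\gg 0$ (where $\ell_R$ denotes length). For an $R$-module $M$, the trace ideal of $M$ is $\operatorname{tr}_R(M)=\sum_{f\in\operatorname{Hom}_R(M,R)}\operatorname{Im} f\subseteq R$. *)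

(* Defs.v *)
From HB Require Import structures.
From mathcomp Require Import all_boot all_algebra.
From mathcomp Require Import boolp classical_sets functions.

Set Implicit Arguments.
Unset Strict Implicit.
Unset Printing Implicit Defensive.

Import GRing.Theory.

Local Open Scope classical_set_scope.
Local Open Scope ring_scope.

(* Submodules of [M : lmodType R] are the library's [submodClosed M]; these are
   boolean predicates, and [boolp] makes them as general as arbitrary subsets.
   Ideals are the submodules of the regular module. *)
Notation ideal R := (submodClosed R^o).

Section Submodules.
Variables (R : comNzRingType) (M : lmodType R).

Definition submod (A : submodClosed M) := {x : M | x \in A}.

HB.instance Definition _ (A : submodClosed M) := SubChoice.on (submod A).
HB.instance Definition _ (A : submodClosed M) :=
  [SubChoice_isSubLmodule of submod A by <:].

Definition sub_pred (A : submodClosed M) : {pred M} := A.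

HB.instance Definition _ (A : submodClosed M) :=
  GRing.isZmodClosed.Build M (sub_pred A)
    (GRing.submod_closedB (GRing.submodClosedP A)).

Definition quotmod (A : submodClosed M) := Quotient.quot (sub_pred A).

HB.instance Definition _ (A : submodClosed M) := GRing.Zmodule.on (quotmod A).

Section QuotientScaling.
Variable A : submodClosed M.
Local Notation Q := (quotmod A).

Definition quot_scale (a : R) (x : Q) : Q :=
  (\pi_(Quotient.quot (sub_pred A)) (a *: repr x))%qT.

Lemma quot_scaleE a (x : M) :
  quot_scale a (\pi_(Quotient.quot (sub_pred A)) x)%qT
  = (\pi_(Quotient.quot (sub_pred A)) (a *: x))%qT.
Proof.
apply/eqP; rewrite -Quotient.idealrBE -scalerBr; apply: rpredZ.
by rewrite -[_ \in _]/(_ \in sub_pred A) Quotient.idealrBE reprK.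
Qed.

Lemma quot_scaleA a b (x : Q) :
  quot_scale a (quot_scale b x) = quot_scale (a * b) x.
Proof. by rewrite quot_scaleE scalerA. Qed.

Lemma quot_scale1 : left_id 1 quot_scale.
Proof. by move=> x; rewrite /quot_scale scale1r reprK. Qed.

Lemma quot_scaleDr : right_distributive quot_scale +%R.
Proof.
move=> a x y; rewrite -[x]reprK -[y]reprK -[in LHS]raddfD !quot_scaleE.
by rewrite scalerDr raddfD.
Qed.

Lemma quot_scaleDl (x : Q) : {morph quot_scale^~ x : a b / a + b}.
Proof. by move=> a b; rewrite /quot_scale scalerDl raddfD. Qed.

HB.instance Definition _ := GRing.Zmodule_isLmodule.Build R Q
  quot_scaleA quot_scale1 quot_scaleDr quot_scaleDl.
End QuotientScaling.

Definition is_submod (A : set M) : Prop :=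
  A 0 /\ forall (a : R) x y, A x -> A y -> A (a *: x + y).

Definition gen_pred (S : set M) : {pred M} :=
  fun x => `[< smallest is_submod S x >].

Lemma gen_closed S : submod_closed (gen_pred S).
Proof.
split=> [|a x y /asboolP Sx /asboolP Sy].
  by apply/asboolP=> A [[A0 _] _].
by apply/asboolP=> A AP; case: (AP) => [[_ +] _]; apply; [exact: Sx|exact: Sy].
Qed.

HB.instance Definition _ S :=
  GRing.isSubmodClosed.Build R M (gen_pred S) (gen_closed S).

Definition gen (S : set M) : submodClosed M := gen_pred S.

Definition full : submodClosed M := gen setT.

Definition proper_sub (A B : submodClosed M) : Prop :=
  {subset A <= B} /\ ~ {subset B <= A}.

Definition fin_gen (A : submodClosed M) : Prop :=
  exists s : seq M, A =i gen [set` s].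

(* l_R(M) = n : the supremum of the lengths of chains of submodules is n. *)
Definition length_is (n : nat) : Prop :=
  (exists N : nat -> submodClosed M,
     forall i, (i < n)%N -> proper_sub (N i) (N i.+1)) /\
  (forall (k : nat) (N : nat -> submodClosed M),
     (forall i, (i < k)%N -> proper_sub (N i) (N i.+1)) -> (k <= n)%N).

(* The product I A. *)
Definition mulI (I : ideal R) (A : submodClosed M) : submodClosed M :=
  gen [set z | exists a x, [/\ a \in I, x \in A & z = a *: x]].

End Submodules.

(* In this and the similar uses below, the set under [gen] is already a
   submodule: [gen] only packages it as one. *)
Definition submod_restr (R : comNzRingType) (M : lmodType R)
    (A B : submodClosed M) : submodClosed (submod A) :=
  gen [set x : submod A | val x \in B].

(* The subquotient A / (A :&: B). *)
Definition subquot (R : comNzRingType) (M : lmodType R)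
    (A B : submodClosed M) : lmodType R := quotmod (submod_restr A B).

Section Homological.
Variable R : comNzRingType.

Definition projective_mod (P : lmodType R) : Prop :=
  forall (A B : lmodType R) (g : {linear A -> B}) (f : {linear P -> B}),
    range g = setT -> exists h : {linear P -> A}, g \o h =1 f.

Definition injective_mod (E : lmodType R) : Prop :=
  forall (A B : lmodType R) (g : {linear A -> B}) (f : {linear A -> E}),
    injective g -> exists h : {linear B -> E}, h \o g =1 f.

Definition exact_at (A B C : lmodType R) (f : {linear A -> B})
    (g : {linear B -> C}) : Prop := range f = [set x | g x = 0].

(* For P2 -d2-> P1 -d1-> P0, the cohomology at Hom(P1, N) of
   Hom(P0, N) -> Hom(P1, N) -> Hom(P2, N). *)
Definition cocycles (P1 P2 N : lmodType R) (d2 : {linear P2 -> P1}) :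
    submodClosed (P1 -> N) :=
  gen [set f : P1 -> N | linear f /\ forall x, f (d2 x) = 0].

Definition coboundaries (P0 P1 N : lmodType R) (d1 : {linear P1 -> P0}) :
    submodClosed (P1 -> N) :=
  gen [set f : P1 -> N | exists g : {linear P0 -> N}, f = g \o d1].

(* l_R(Ext^1_R(M, N)) = n, where Ext^1 is computed from the initial segment
   P2 -> P1 -> P0 -> M -> 0 of a projective resolution of M. *)
Definition ext1_length_is (M N : lmodType R) (n : nat) : Prop :=
  exists (P0 P1 P2 : lmodType R) (d2 : {linear P2 -> P1})
      (d1 : {linear P1 -> P0}) (d0 : {linear P0 -> M}),
    [/\ projective_mod P0, projective_mod P1 & projective_mod P2] /\
    [/\ range d0 = setT, exact_at d1 d0, exact_at d2 d1 &
        length_is (subquot (cocycles N d2) (coboundaries N d1)) n].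

Definition finite_injdim (M : lmodType R) : Prop :=
  exists (E : nat -> lmodType R) (d : forall i, {linear E i -> E i.+1})
      (e : {linear M -> E 0}) (n : nat),
    [/\ forall i, injective_mod (E i), injective e, exact_at e (d 0),
        forall i, exact_at (d i) (d i.+1) &
        forall i, (n < i)%N -> forall x : E i, x = 0].

(* The sum of the images of all linear maps M -> R. *)
Definition trace (M : lmodType R) : ideal R :=
  gen (\bigcup_(f in [set: {linear M -> R^o}]) range f).

Definition iso (M N : lmodType R) : Prop :=
  exists f : {linear M -> N}, bijective f.

End Homological.

Section LocalAlgebra.
Variable R : comNzRingType.

Definition noetherian : Prop := forall I : ideal R, fin_gen I.

Definition prime_ideal (p : ideal R) : Prop :=
  1 \notin p /\ prime_idealr_closed (p : {pred R}).

Definition maximal_ideal (m : ideal R) : Prop :=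
  1 \notin m /\
  forall I : ideal R, 1 \notin I -> {subset m <= I} -> {subset I <= m}.

Definition local_ring (m : ideal R) : Prop :=
  maximal_ideal m /\ forall n : ideal R, maximal_ideal n -> n =i m.

(* dim M = d : the longest chains of primes containing Ann(M) have length d;
   the Krull dimension of R is that of R^o, whose annihilator is zero. *)
Definition dim_chain (M : lmodType R) (k : nat) (p : nat -> ideal R) : Prop :=
  [/\ forall i, (i <= k)%N -> prime_ideal (p i),
      forall i, (i < k)%N -> proper_sub (p i) (p i.+1) &
      forall a : R, (forall x : M, a *: x = 0) -> a \in p 0].

Definition krull_dim (M : lmodType R) (d : nat) : Prop :=
  (exists p, dim_chain M d p) /\ forall k p, dim_chain M k p -> (k <= d)%N.

Variable m : ideal R.

Definition regular_seq (M : lmodType R) (s : seq R) : Prop :=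
  let sub i := mulI (@gen R R^o [set` take i s]) (full M) in
  [/\ forall a, a \in s -> a \in m,
      forall i, (i < size s)%N ->
        forall y : quotmod (sub i), s`_i *: y = 0 -> y = 0 &
      exists y : M, y \notin sub (size s)].

Definition depth (M : lmodType R) (d : nat) : Prop :=
  (exists2 s, regular_seq M s & size s = d) /\
  forall s, regular_seq M s -> (size s <= d)%N.

Definition cohen_macaulay (M : lmodType R) : Prop :=
  fin_gen (full M) /\ exists2 d, krull_dim M d & depth M d.

Definition residue_field : lmodType R := quotmod m.

(* r(M) = n; this is the type of M when depth M = 1. *)
Definition type_is (M : lmodType R) (n : nat) : Prop :=
  ext1_length_is residue_field M n.

(* Over a one-dimensional Cohen-Macaulay local ring: a maximal Cohen-Macaulay
   module of type 1 and of finite injective dimension. *)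
Definition canonical_module (K : lmodType R) : Prop :=
  [/\ cohen_macaulay K, krull_dim K 1, type_is K 1 & finite_injdim K].

Definition ideal_exp (I : ideal R) (n : nat) : ideal R :=
  iter n (mulI I) (full R^o).

Definition hilbert_e1_is (I : ideal R) (e1 : int) : Prop :=
  exists (e0 : int) (n0 : nat), forall n, (n0 <= n)%N ->
    exists2 l : nat, length_is (quotmod (ideal_exp I n.+1)) l &
      l%:Z = e0 * n.+1%:Z - e1.

Definition almost_gorenstein (K : lmodType R) : Prop :=
  exists (I : ideal R) (e1 : int) (r : nat),
    [/\ iso (submod I) K, hilbert_e1_is I e1, type_is R^o r &
        (e1 <= r%:Z)%R].

End LocalAlgebra.

(* Main.v *)
(** Work inside the total quotient ring [Q] of [R], which is [R[1/x]] for any regular [x]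
    in the maximal ideal [m].

    If [I] is isomorphic to [K] and [e_1(I) <= r(R)], some power [J = I^p] satisfies
    [J^2 = xi J] with [xi] in [J]; then [S = J / xi] is an overring of [R] with
    [l(S / R) = e_1(I)], and [I W = S] for [W = I^(p-1) / xi].  Since [I : I = R], colon
    into [I] gives [l(I / (I : S)) <= l(S / R) <= r(R) <= l(I / m I)].  Either [S = R], and
    [I] is principal, or [I : S] is contained in [m I], hence equal to it.  Both ways [W]
    multiplies [m I] onto an ideal of [R] that contains [m].

    Conversely, if [m] is principal then [K] is isomorphic to [R].  Otherwise let
    [B = m : m], a semilocal ring with [l(B / R) = r(R)].  The trace condition says that the
    images of all maps [K -> B] generate the unit ideal of [B], and by avoidance of the
    maximal ideals of [B] a single map [f] suffices.  It is injective because
    [l(K / x K) <= l(R / x R)], and [m f(K) = m].  So for [I = x f(K)] one has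
    [e_1(I) = l(f(K)^n / m) - 1 <= l(B / m) - 1 = r(R)] for large [n].  No infinite residue
    field is assumed, so [f(K)] need not contain a unit of [B]; it has colength at most one
    in [B], and without a unit its square is already [B]. *)

Require Import Defs.
From HB Require Import structures.
From mathcomp Require Import all_boot all_algebra.
From mathcomp Require Import ring zify.
From mathcomp Require Import boolp classical_sets functions.

Set Implicit Arguments.
Unset Strict Implicit.
Unset Printing Implicit Defensive.

Import GRing.Theory.

Local Open Scope classical_set_scope.
Local Open Scope ring_scope.

(** * Lengths of subquotients *)

(** Two facts stand in for canonical duality. Type one bounds the growth of duals ([dual_lenle]) and
    gives every length estimate into [K]. Finite injective dimension gives [I : I = R]
    ([canonical_faithful]), by following an injective resolution of arbitrary finite length down to
    the vanishing of [Ext^2]. The passage from [I] to a power comes from finite residue fields. The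
    fiber cone, the sum of the [I^n / m I^n], has a bounded Hilbert function, but a homogeneous
    parameter may exist only in high degree. One is found by maximizing the length of a chain above
    its torsion. The ring [B] arises because a map [m K -> R] extends to a map [K -> R : m], and
    [R : m] equals [m : m] unless [m] is principal; this is why principal [m] is treated apart. The
    first implication clears denominators by [xi] and computes inside [R]; the ring [Q] is
    constructed for the converse. *)

Section SetSubmodules.
Variables (R : comNzRingType) (M : lmodType R).
Implicit Types (A B C D S : set M) (a b c : R) (x y z : M).

Lemma submodD A x y : is_submod A -> A x -> A y -> A (x + y).
Proof. by move=> [_ sA] Ax Ay; rewrite -[x]scale1r; apply: sA. Qed.

Lemma submodZ A a x : is_submod A -> A x -> A (a *: x).
Proof. by move=> [A0 sA] Ax; rewrite -[_ *: _]addr0; apply: sA. Qed.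

Lemma submodN A x : is_submod A -> A x -> A (- x).
Proof. by move=> sA Ax; rewrite -scaleN1r; apply: submodZ. Qed.

Lemma submodB A x y : is_submod A -> A x -> A y -> A (x - y).
Proof. by move=> sA Ax Ay; apply: submodD => //; apply: submodN. Qed.

Lemma is_submodT : is_submod [set: M]. Proof. by []. Qed.

Lemma is_submod0 : is_submod [set (0 : M)].
Proof. by split=> // a x y -> ->; rewrite scaler0 addr0. Qed.

Lemma is_submodI A B : is_submod A -> is_submod B -> is_submod (A `&` B).
Proof.
move=> [A0 sA] [B0 sB]; split=> // a x y [Ax Bx] [Ay By].
by split; [apply: sA|apply: sB].
Qed.

Definition addm A B : set M := [set z | exists x y, [/\ A x, B y & z = x + y]].

Lemma is_submod_add A B : is_submod A -> is_submod B -> is_submod (addm A B).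
Proof.
move=> [A0 sA] [B0 sB]; split; first by exists 0, 0; rewrite addr0.
move=> a _ _ [x [y [Ax By ->]]] [x' [y' [Ax' By' ->]]].
exists (a *: x + x'), (a *: y + y'); split; [exact: sA|exact: sB|].
by rewrite scalerDr addrACA.
Qed.

Lemma addm_subl A B : is_submod B -> A `<=` addm A B.
Proof. by case=> B0 _ x Ax; exists x, 0; rewrite addr0. Qed.

Lemma addm_subr A B : is_submod A -> B `<=` addm A B.
Proof. by case=> A0 _ x Bx; exists 0, x; rewrite add0r. Qed.

Lemma addm_sub A B C : is_submod C -> A `<=` C -> B `<=` C -> addm A B `<=` C.
Proof. by move=> sC hAC BC _ [x [y [/hAC Cx /BC Cy ->]]]; apply: submodD. Qed.

Definition line x : set M := range (fun c => c *: x).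

Lemma is_submod_line x : is_submod (line x).
Proof.
split; first by exists 0; rewrite ?scale0r.
move=> a _ _ [c _ <-] [d _ <-]; exists (a * c + d) => //.
by rewrite scalerDl scalerA.
Qed.

Lemma line_id x : line x x. Proof. by exists 1; rewrite ?scale1r. Qed.

Lemma line_sub x A : is_submod A -> A x -> line x `<=` A.
Proof. by move=> sA Ax _ [c _ <-]; apply: submodZ. Qed.

Lemma is_submod_mem (A : submodClosed M) : is_submod [set x | x \in A].
Proof.
split=> [|a x y /= Ax Ay]; first exact: rpred0.
by apply: rpredD => //; apply: rpredZ.
Qed.

Lemma mem_genP S x : reflect (smallest (@is_submod R M) S x) (x \in gen S).
Proof. exact: asboolP. Qed.

Lemma mem_gen_submod S x : is_submod S -> (x \in gen S) <-> S x.
Proof.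
move=> sS; split=> [/mem_genP Sx|Sx]; first by apply: Sx; split.
by apply/mem_genP => A [_ SA]; apply: SA.
Qed.

Lemma gen_ind (P : M -> Prop) S : @is_submod R M P -> (forall x, S x -> P x) ->
  forall x, x \in gen S -> P x.
Proof. by move=> sP SP x /mem_genP; apply; split. Qed.

Lemma mem_gen S x : S x -> x \in gen S.
Proof. by move=> Sx; apply/mem_genP => A [_ SA]; apply: SA. Qed.

Lemma mem_full x : x \in full M.
Proof. exact: mem_gen. Qed.

Lemma gen_seqP (s : seq M) x :
  x \in gen [set` s] <-> exists c : nat -> R, x = \sum_(i < size s) c i *: s`_i.
Proof.
split=> [|[c ->]]; last first.
  apply: rpred_sum => i _; apply: rpredZ; apply: mem_gen => /=.
  exact: mem_nth.
move: x; apply: (gen_ind (P := fun x =>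
  exists c : nat -> R, x = \sum_(i < size s) c i *: s`_i)) => [|y /= ys].
  split; first by exists (fun=> 0); rewrite big1 // => i _; rewrite scale0r.
  move=> a _ _ [c ->] [d ->]; exists (fun i => a * c i + d i).
  rewrite scaler_sumr -big_split; apply: eq_bigr => i _ /=.
  by rewrite scalerDl scalerA.
have ys' := ys; rewrite -index_mem in ys'.
exists (fun i => (i == index y s)%:R).
rewrite (bigD1 (Ordinal ys')) //= eqxx scale1r nth_index // big1 ?addr0 //.
by move=> i /negPf; rewrite -val_eqE /= => ->; rewrite scale0r.
Qed.

Lemma gen_consP (v : M) s x :
  x \in gen [set` v :: s] <-> exists c y, y \in gen [set` s] /\ x = c *: v + y.
Proof.
split.
  move: x; apply: (gen_ind (P := fun x =>
    exists c y, y \in gen [set` s] /\ x = c *: v + y)) => [|y].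
    split; first by exists 0, 0; rewrite rpred0 scale0r addr0.
    move=> a _ _ [c [y [sy ->]]] [d [z [sz ->]]].
    exists (a * c + d), (a *: y + z); split; first by rewrite rpredD ?rpredZ.
    by rewrite scalerDr scalerDl scalerA addrACA.
  rewrite /= inE => /orP[/eqP->|ys]; first by exists 1, 0; rewrite rpred0 scale1r addr0.
  by exists 0, y; rewrite scale0r add0r; split=> //; apply: mem_gen.
move=> [c [y [sy ->]]]; apply: rpredD.
  by apply: rpredZ; apply: mem_gen; rewrite /= mem_head.
move: y sy; apply: (gen_ind (P := fun y => y \in gen [set` v :: s])); first exact: is_submod_mem.
by move=> y /= ys; apply: mem_gen; rewrite /= inE ys orbT.
Qed.

End SetSubmodules.

Section Length.
Variables (R : comNzRingType) (M : lmodType R).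
Implicit Types (A B C D : set M).

(** A chain may start at any submodule containing [A], so that [hc_widen], [hc_narrow] and [hc_cat]
    hold without matching endpoints. *)
Inductive hc A : nat -> set M -> Prop :=
| hc0 C : is_submod C -> A `<=` C -> hc A 0 C
| hcS k C D : hc A k C -> is_submod D -> C `<` D -> hc A k.+1 D.

(** Bounds are kept apart from exact lengths: most estimates only produce bounds, and infinite
    length needs no value. *)
Definition lenle A B n := forall k D, hc A k D -> D `<=` B -> (k <= n)%N.
Definition len A B n := lenle A B n /\ hc A n B.

Lemma hc_submod A k D : hc A k D -> is_submod D. Proof. by case. Qed.

Lemma hc_sub A k D : hc A k D -> A `<=` D.
Proof.
by elim=> // {}k C {}D _ hAC _ [CD _]; apply: subset_trans hAC CD.
Qed.

Lemma hc_widen A k D D' : is_submod D' -> D `<=` D' -> hc A k D -> hc A k D'.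
Proof.
move=> sD' DD' h; case: h DD' => [C sC hAC|{}k C {}D h sD [CD nDC]] DD'.
  by apply: hc0 => //; apply: subset_trans DD'.
apply: hcS h sD' _; split; first exact: subset_trans DD'.
by move=> D'C; apply: nDC; apply: subset_trans D'C.
Qed.

Lemma hc_narrow A A' k D : A' `<=` A -> hc A k D -> hc A' k D.
Proof.
move=> A'A; elim=> [C sC hAC|{}k C {}D _ IH sD CD]; last exact: hcS IH sD CD.
by apply: hc0 => //; apply: subset_trans hAC.
Qed.

Lemma hc_cat A B p q D : hc A p B -> hc B q D -> hc A (q + p) D.
Proof.
move=> hB; elim=> [C sC BC|k C {}D _ IH sD CD]; first exact: hc_widen hB.
by rewrite addSn; apply: hcS IH sD CD.
Qed.

Lemma lenle_leq A B n n' : (n <= n')%N -> lenle A B n -> lenle A B n'.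
Proof. by move=> nn' l k D h DB; apply: leq_trans nn'; apply: l h DB. Qed.

Lemma lenle_sub A A' B B' n :
  A' `<=` A -> B `<=` B' -> lenle A' B' n -> lenle A B n.
Proof.
move=> A'A BB' l k D h DB; apply: (l k D); first exact: hc_narrow h.
exact: subset_trans BB'.
Qed.

Lemma lenle0 A B : lenle A B 0 -> is_submod A -> is_submod B -> A `<=` B -> B `<=` A.
Proof.
move=> l sA sB AB; apply: contrapT => nBA.
by have := l 1%N B (hcS (hc0 sA (@subset_refl _ A)) sB (conj AB nBA)) (@subset_refl _ B).
Qed.

Lemma lenle_id A B : B `<=` A -> lenle A B 0.
Proof.
move=> BA k D; case=> // {}k C {}D h sD [CD nDC] DB; case: nDC.
by apply: subset_trans DB _; apply: subset_trans BA _; apply: hc_sub h.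
Qed.

Lemma lenle_lt A A' B n : is_submod A -> is_submod A' -> A `<` A' -> A' `<=` B ->
  lenle A B n -> exists2 n', (n = n'.+1)%N & lenle A' B n'.
Proof.
move=> sA sA' AA' A'B l.
have hA : hc A 1 A' by apply: (hcS (hc0 sA (@subset_refl _ A))).
case: n l => [|n] l; first by have := l _ _ hA A'B.
exists n => // k D h DB; rewrite -ltnS -addn1; apply: l DB; exact: hc_cat hA h.
Qed.


(* Modular law: a strict inclusion stays strict after intersecting with [B] or after
   adding [B]. *)
Lemma hc_split A B k D : is_submod B -> A `<=` B -> hc A k D ->
  exists k1 k2, [/\ (k <= k1 + k2)%N, hc A k1 (D `&` B) & hc B k2 (addm D B)].
Proof.
move=> sB AB; elim=> [C sC hAC|{}k C {}D h [k1 [k2 [le h1 h2]]] sD [CD nDC]].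
  exists 0%N, 0%N; split=> //; apply: hc0; first exact: is_submodI.
  - by move=> x Ax; split; [apply: hAC|apply: AB].
  - exact: is_submod_add.
  - exact: addm_subr.
have sC := hc_submod h.
have sub1 : C `&` B `<=` D `&` B by apply: setSI.
have sub2 : addm C B `<=` addm D B.
  by move=> _ [x [y [/CD Dx By ->]]]; exists x, y.
have sDB := is_submodI sD sB; have saDB := is_submod_add sD sB.
case: (pselect (D `&` B `<=` C `&` B)) => [e1|ne1]; last first.
  exists k1.+1, k2; split=> //; first exact: hcS h1 sDB _.
  exact: hc_widen h2.
exists k1, k2.+1; split; first by rewrite addnS.
  exact: hc_widen h1.
apply: hcS h2 saDB _; split=> // e2; apply: nDC => x Dx.
have [y [z [Cy Bz xE]]] := e2 x (addm_subl sB Dx).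
have Dz : D z.
  have -> : z = x - y by rewrite xE addrC addKr.
  by apply: submodB => //; apply: CD.
have [Cz _] := e1 z (conj Dz Bz).
by rewrite xE; apply: submodD.
Qed.

Lemma lenle_add A B C p q : is_submod B -> is_submod C -> A `<=` B -> B `<=` C ->
  lenle A B p -> lenle B C q -> lenle A C (p + q).
Proof.
move=> sB sC AB BC lp lq k D h DC.
have [k1 [k2 [le h1 h2]]] := hc_split sB AB h.
apply: leq_trans le _; apply: leq_add; first by apply: lp h1 _; apply: subIsetr.
by apply: lq h2 _; apply: addm_sub.
Qed.

Lemma len_add A B C p q : is_submod B -> is_submod C -> A `<=` B -> B `<=` C ->
  len A B p -> len B C q -> len A C (p + q).
Proof.
move=> sB sC AB BC [lp hp] [lq hq]; split; first exact: (lenle_add sB).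
by rewrite addnC; apply: hc_cat hp hq.
Qed.

Lemma len_uniq A B p q : len A B p -> len A B q -> p = q.
Proof.
move=> [lp hp] [lq hq]; apply/eqP; rewrite eqn_leq.
by rewrite (lq _ _ hp) // (lp _ _ hq).
Qed.

Lemma lenleP A B n : is_submod B -> A `<=` B -> lenle A B n ->
  exists2 p, (p <= n)%N & len A B p.
Proof.
move=> sB AB; elim: n => [|n IH] l; first by exists 0%N => //; split=> //; apply: hc0.
case: (pselect (hc A n.+1 B)) => [h|nh]; first by exists n.+1.
have [|p le lp] := IH; last by exists p => //; apply: leqW.
move=> k D h DB; have := l k D h DB; rewrite leq_eqVlt ltnS => /orP[/eqP ek|//].
by case: nh; rewrite -ek; apply: hc_widen h.
Qed.

Lemma len_le_lenle A B p n : len A B p -> lenle A B n -> (p <= n)%N.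
Proof. by move=> [_ h] l; apply: l h _. Qed.

Lemma len_split A B C n : is_submod B -> is_submod C -> A `<=` B -> B `<=` C ->
  len A C n -> exists p q, [/\ len A B p, len B C q & n = (p + q)%N].
Proof.
move=> sB sC AB BC l; have [l' _] := l.
have [|p _ lp] := @lenleP A B n sB AB; first exact: lenle_sub l'.
have [|q _ lq] := @lenleP B C n sC BC; first exact: lenle_sub l'.
by exists p, q; split=> //; apply: len_uniq l (len_add sB sC AB BC lp lq).
Qed.

Lemma len_id A : is_submod A -> len A A 0.
Proof. by move=> sA; split; [apply: lenle_id|apply: hc0]. Qed.

End Length.

Section Transfer.
Variables (R : comNzRingType) (M M' : lmodType R).

Lemma hc_map (F : set M -> set M') A B k D :
  (forall C, is_submod C -> A `<=` C -> C `<=` B -> is_submod (F C)) ->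
  (forall C C', is_submod C -> is_submod C' -> A `<=` C -> C' `<=` B -> C `<` C' ->
     F C `<` F C') ->
  is_submod A -> hc A k D -> D `<=` B -> hc (F A) k (F D).
Proof.
move=> sF mF sA h DB.
have mF' C C' : is_submod C -> is_submod C' -> A `<=` C -> C' `<=` B -> C `<=` C' ->
    F C `<=` F C'.
  move=> sC sC' hAC C'B CC'; case: (pselect (C' `<=` C)) => [C'C|nC'C].
    by have -> : C = C' by apply/seteqP.
  by have [] := mF _ _ sC sC' hAC C'B (conj CC' nC'C).
elim: h DB => [C sC hAC|{}k C {}D h IH sD CD] DB.
  by apply: hc0; [apply: sF|apply: mF'].
have sC := hc_submod h; have hAC := hc_sub h.
have CB : C `<=` B by apply: subset_trans DB; case: CD.
apply: hcS (IH CB) _ _; last exact: mF.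
by apply: sF => //; apply: subset_trans hAC _; case: CD.
Qed.

Lemma lenle_map (F : set M -> set M') A B A' B' n :
  (forall C, is_submod C -> A `<=` C -> C `<=` B -> is_submod (F C)) ->
  (forall C C', is_submod C -> is_submod C' -> A `<=` C -> C' `<=` B -> C `<` C' ->
     F C `<` F C') ->
  is_submod A -> A' `<=` F A -> (forall C, C `<=` B -> F C `<=` B') ->
  lenle A' B' n -> lenle A B n.
Proof.
move=> sF mF sA A'F FB l k D h DB.
apply: (l k (F D)); last exact: FB.
by apply: hc_narrow A'F _; apply: hc_map h DB.
Qed.

End Transfer.

Section Correspondence.
Variables (R : comNzRingType) (M M' : lmodType R).

(** The hypotheses say that [f] induces an isomorphism from [B / A] to [B' / A']. Since [f] is a
    bare function, evaluation of cocycles or division by [x] can be used unpackaged. *)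
Lemma len_corr (f : M -> M') (A B : set M) (A' B' : set M') n :
  is_submod A' -> is_submod B -> is_submod B' -> A' `<=` B' ->
  (forall a u v, B u -> B v -> f (a *: u + v) = a *: f u + f v) ->
  (forall b, B b -> B' (f b)) ->
  (forall b, A b <-> B b /\ A' (f b)) ->
  (forall b', B' b' -> exists2 b, B b & A' (b' - f b)) ->
  len A B n <-> len A' B' n.
Proof.
move=> sA' sB sB' A'B' fl fB fA fs.
have f0 : f 0 = 0.
  have [B0 _] := sB; have := fl (-1) 0 0 B0 B0.
  by rewrite scaler0 addr0 scaleN1r addNr.
have fBB u v : B u -> B v -> f (u - v) = f u - f v.
  by move=> Bu Bv; rewrite addrC -scaleN1r fl // scaleN1r addrC.
have sA : is_submod A.
  split; first by apply/fA; rewrite f0; split; [case: sB|case: sA'].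
  move=> a x y /fA[Bx Ax] /fA[By Ay]; apply/fA; split; first exact: (proj2 sB).
  by rewrite fl //; apply: (proj2 sA').
have AB : A `<=` B by move=> x /fA[].
pose F (C : set M) : set M' := [set b' | B' b' /\ exists2 c, C c & A' (b' - f c)].
pose G (D : set M') : set M := [set b | B b /\ D (f b)].
have sF C : is_submod C -> A `<=` C -> C `<=` B -> is_submod (F C).
  move=> sC hAC CB; split.
    split; first by case: sB'.
    by exists 0; [case: sC|rewrite f0 subr0; case: sA'].
  move=> a x y [Bx [c Cc Ac]] [By [d Cd Ad]]; split; first exact: (proj2 sB').
  exists (a *: c + d); first exact: (proj2 sC).
  rewrite fl; [|exact: CB|exact: CB].
  rewrite opprD addrACA -scalerBr; exact: (proj2 sA').
have mF C C' : is_submod C -> is_submod C' -> A `<=` C -> C' `<=` B -> C `<` C' ->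
    F C `<` F C'.
  move=> sC sC' hAC C'B [CC' nC'C]; split.
    by move=> x [Bx [c /CC' Cc Ac]]; split=> //; exists c.
  move=> FF; apply: nC'C => d Cd.
  have [|_ [c Cc]] := FF (f d).
    by split; [apply/fB/C'B|exists d => //; rewrite subrr; case: sA'].
  have [Bd Bc] := (C'B _ Cd, C'B _ (CC' _ Cc)).
  rewrite -fBB // => Adc.
  rewrite -[d](subrK c); apply: submodD => //; apply: hAC; apply/fA; split=> //.
  exact: submodB.
have sG D : is_submod D -> A' `<=` D -> D `<=` B' -> is_submod (G D).
  move=> sD A'D DB'; split; first by split; [case: sB|rewrite f0; case: sD].
  move=> a x y [Bx Dx] [By Dy]; split; first exact: (proj2 sB).
  by rewrite fl //; apply: (proj2 sD).
have mG D D' : is_submod D -> is_submod D' -> A' `<=` D -> D' `<=` B' -> D `<` D' ->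
    G D `<` G D'.
  move=> sD sD' A'D D'B' [DD' nD'D]; split; first by move=> x [Bx /DD' Dx].
  move=> GG; apply: nD'D => d' Dd'.
  have [b Bb Ab] := fs _ (D'B' _ Dd').
  have Dfb : D' (f b).
    have -> : f b = d' - (d' - f b) by rewrite opprB addrC subrK.
    apply: submodB => //.
    exact/DD'/A'D.
  have [_ Dfb'] := GG _ (conj Bb Dfb).
  by rewrite -[d'](subrK (f b)); apply: submodD => //; apply: A'D.
have le1 : lenle A' B' n -> lenle A B n.
  apply: (lenle_map sF mF) => //; last by move=> C _ x [].
  by move=> x Ax; split; [apply: A'B'|exists 0; [case: sA|rewrite f0 subr0]].
have le2 : lenle A B n -> lenle A' B' n.
  apply: (lenle_map sG mG) => //; first by move=> x /fA[].
  by move=> C _ x [].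
split=> [[l h]|[l h]]; split=> //; [exact: le2| |exact: le1|].
  apply: hc_narrow (_ : A' `<=` F A) _; last first.
    apply: hc_widen (hc_map sF mF sA h (@subset_refl _ _)) => //.
    by move=> x [].
  by move=> x Ax; split; [apply: A'B'|exists 0; [case: sA|rewrite f0 subr0]].
apply: hc_narrow (_ : A `<=` G A') _; first by move=> x /fA[].
by apply: hc_widen (hc_map sG mG sA' h (@subset_refl _ _)) => //; move=> x [].
Qed.

End Correspondence.

Section QuotientMap.
Variables (R : comNzRingType) (M : lmodType R) (A : submodClosed M).

Definition qproj (x : M) : quotmod A :=
  (\pi_(Quotient.quot (sub_pred A)) x)%qT.

Lemma qproj_linear : linear qproj.
Proof.
move=> a x y; rewrite /qproj raddfD; congr (_ + _).
exact/esym/quot_scaleE.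
Qed.

HB.instance Definition _ := GRing.isLinear.Build R M (quotmod A) *:%R qproj qproj_linear.

Lemma qproj_eq0 x : qproj x = 0 <-> x \in A.
Proof.
rewrite -[_ \in A]/(_ \in sub_pred A) -{2}[x]subr0 Quotient.idealrBE.
rewrite -[0 : quotmod A](raddf0 qproj).
by split=> [/eqP|/eqP].
Qed.

Lemma qproj_surj (y : quotmod A) : exists x, qproj x = y.
Proof. by exists (repr y); rewrite /qproj reprK. Qed.

End QuotientMap.

(** * Agreement with the lengths of the statement *)

Section LengthIs.
Variables (R : comNzRingType).

Lemma hc_seq (M : lmodType R) (A : set M) k D : hc A k D ->
  exists N : nat -> set M, [/\ forall i, is_submod (N i), A `<=` N 0%N, N k = D &
    forall i, (i < k)%N -> N i `<` N i.+1].
Proof.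
elim=> [C sC sAC|{}k C {}D h [N [sN AN NC ltN]] sD CD]; first by exists (fun=> C).
exists (fun i => if (i <= k)%N then N i else D); split=> [i| | |i].
- by case: ifP.
- by rewrite leq0n.
- by rewrite ltnn.
rewrite ltnS => ik; rewrite ik; case: ltnP => ki; first exact: ltN.
by have -> : i = k; [apply/eqP; rewrite eqn_leq ik ki|rewrite NC].
Qed.

Lemma seq_hc (M : lmodType R) (N : nat -> submodClosed M) k :
  (forall i, (i < k)%N -> Defs.proper_sub (N i) (N i.+1)) ->
  hc [set 0] k [set x | x \in N k].
Proof.
elim: k => [|k IH] ltN.
  by apply: hc0; [apply: is_submod_mem|move=> _ ->; apply: rpred0].
apply: hcS (IH _) _ _; first by move=> i ik; apply: ltN; apply: ltnW.
  exact: is_submod_mem.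
by have [s1 s2] := ltN k (ltnSn k); split=> // x; apply: s1.
Qed.

Lemma length_isP (M : lmodType R) n : length_is M n <-> len [set (0 : M)] setT n.
Proof.
split=> [[[N ltN] maxN]|[maxN h]].
  split; last exact: hc_widen (seq_hc ltN).
  move=> k D h _; have [N' [sN' _ _ ltN']] := hc_seq h.
  apply: (maxN k (fun i => gen (N' i))) => i ik.
  have [s1 s2] := ltN' i ik; split=> [x|s3].
    by move=> /(mem_gen_submod x (sN' i)) /s1 /(mem_gen_submod x (sN' i.+1)).
  apply: s2 => x Nx; apply/(mem_gen_submod x (sN' i)); apply: s3.
  exact/(mem_gen_submod x (sN' i.+1)).
split=> [|k N ltN]; last exact: maxN (seq_hc ltN) _.
have [N' [sN' _ _ ltN']] := hc_seq h.
exists (fun i => gen (N' i)) => i ik.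
have [s1 s2] := ltN' i ik; split=> [x|s3].
  by move=> /(mem_gen_submod x (sN' i)) /s1 /(mem_gen_submod x (sN' i.+1)).
apply: s2 => x Nx; apply/(mem_gen_submod x (sN' i)); apply: s3.
exact/(mem_gen_submod x (sN' i.+1)).
Qed.

Lemma length_quot (M : lmodType R) (A : submodClosed M) n :
  length_is (quotmod A) n <-> len [set x | x \in A] setT n.
Proof.
rewrite length_isP; symmetry; apply: (@len_corr _ _ _ (@qproj _ _ A)) => //.
- exact: is_submod0.
- by move=> a u v _ _; rewrite linearP.
- by move=> b; split=> [/qproj_eq0|[_ /qproj_eq0]].
- by move=> b _; have [x <-] := qproj_surj b; exists x; rewrite ?subrr.
Qed.

Lemma length_subquot (M : lmodType R) (A B : submodClosed M) n :
  {subset B <= A} ->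
  length_is (subquot A B) n <-> len [set x | x \in B] [set x | x \in A] n.
Proof.
move=> BA; rewrite length_quot.
have sv : is_submod [set x : submod A | val x \in B].
  split=> [|a x y xB yB]; first by rewrite /mkset raddf0 rpred0.
  by rewrite /mkset linearP; apply: rpredD => //; apply: rpredZ.
apply: (@len_corr _ _ _ (val : submod A -> M)) => //.
- exact: is_submod_mem.
- exact: is_submod_mem.
- by case=> b Ab _; exact: Ab.
- by move=> b; split=> [/(mem_gen_submod b sv)|[_ vB]] //; apply/(mem_gen_submod b sv).
- by move=> b Ab; exists (Sub b Ab) => //=; rewrite subrr rpred0.
Qed.

End LengthIs.

(** * Noetherian rings and free resolutions *)

Section DeterminantTrick.
Variables (S : comNzRingType) (V : lmodType S) (I : set S) (W : set V).
Hypotheses (I0 : I 0) (ID : forall a b, I a -> I b -> I (a + b))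
  (IN : forall a, I a -> I (- a)) (IM : forall a b, I a -> I b -> I (a * b)).
Hypothesis sW : is_submod W.

(** Membership in [I s + W], peeling off one generator at a time to suit the elimination below. *)
Fixpoint comb (s : seq V) (x : V) : Prop :=
  if s is v :: s' then exists2 c, I c & comb s' (x - c *: v) else W x.

Lemma combW s x : W x -> comb s x.
Proof.
elim: s x => //= v s IH x Wx; exists 0 => //; apply: IH.
by rewrite scale0r subr0.
Qed.

Lemma combD s x y : comb s x -> comb s y -> comb s (x + y).
Proof.
elim: s x y => [|v s IH] x y /=; first exact: submodD.
move=> [c Ic cx] [d Id dy]; exists (c + d); first exact: ID.
by rewrite scalerDl opprD addrACA; apply: IH.
Qed.

Lemma combZ a s x : (forall c, I c -> I (a * c)) -> comb s x -> comb s (a *: x).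
Proof.
move=> Ia; elim: s x => [|v s IH] x /=; first exact: submodZ.
move=> [c Ic cx]; exists (a * c); first exact: Ia.
by rewrite -scalerA -scalerBr; apply: IH.
Qed.

Lemma comb_mem a s v : I a -> v \in s -> comb s (a *: v).
Proof.
move=> Ia; elim: s => //= u s IH; rewrite inE => /orP[/eqP->|vs].
  by exists a => //; rewrite subrr; apply: combW; case: sW.
by exists 0 => //; rewrite scale0r subr0; apply: IH.
Qed.

Lemma comb_kill a s x : (forall v, v \in s -> W (a *: v)) -> comb s x -> W (a *: x).
Proof.
elim: s x => [|v s IH] x /= Wa; first exact: submodZ.
move=> [c Ic cx]; rewrite -[x](subrK (c *: v)) scalerDr; apply: submodD => //.
  by apply: IH => // u us; apply: Wa; rewrite inE us orbT.
by rewrite scalerA mulrC -scalerA; apply: submodZ => //; apply: Wa; rewrite mem_head.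
Qed.

(** Elimination replaces the determinant, with [1 - mu] collecting the pivots. [I] is only closed
    under the ring operations, because it will also be a maximal ideal of [endo_ring], inside the
    larger ring [Q]. *)
Lemma determinant_trick s : (forall v, v \in s -> comb s v) ->
  exists2 mu, I mu & forall v, v \in s -> W ((1 - mu) *: v).
Proof.
elim: s => [|v s IH] cs; first by exists 0.
have [mu Imu cv] := cs v (mem_head _ _).
have Iq a c : I a -> I c -> I ((1 - a) * c).
  by move=> Ia Ic; rewrite mulrBl mul1r; apply: ID => //; apply/IN/IM.
have cv1 : comb s ((1 - mu) *: v) by rewrite scalerBl scale1r.
have [|nu Inu Wnu] := IH.
  move=> u us; have us' : u \in v :: s by rewrite inE us orbT.
  have [nu Inu cu] := cs u us'.
  (* [(1 - mu) *: u] is [nu *: ((1 - mu) *: v)] plus [1 - mu] times a combination of [s]: a relation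
     for [u] free of [v]. *)
  rewrite -[u](subrK (mu *: u)); apply: combD; last exact: comb_mem.
  rewrite -[u - _](subrK (nu *: ((1 - mu) *: v))); apply: combD; last first.
    by apply: combZ => // c; apply: IM.
  rewrite -{1}[u]scale1r -scalerBl scalerA mulrC -scalerA -scalerBr.
  by apply: combZ => // c; apply: Iq.
exists (nu + (mu - nu * mu))%R; first by do !apply: ID => //; apply/IN/IM.
have -> : 1 - (nu + (mu - nu * mu)) = (1 - nu) * (1 - mu).
  by rewrite mulrBr mulr1 mulrBl mul1r opprD opprB addrA.
move=> u; rewrite inE => /orP[/eqP->|us].
  by rewrite -scalerA; apply: comb_kill cv1.
by rewrite mulrC -scalerA; apply: submodZ => //; apply: Wnu.
Qed.

End DeterminantTrick.

Section LinearMaps.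
Variables (R : comNzRingType).

Definition mklin (U V : lmodType R) (f : U -> V) (fl : linear f) : {linear U -> V} :=
  HB.pack f (GRing.isLinear.Build R U V *:%R f fl).

Lemma linear_fun0 (U V : lmodType R) (f : U -> V) : linear f -> f 0 = 0.
Proof. by move=> fl; apply: (linear0 (mklin fl)). Qed.

Lemma linear_funZ (U V : lmodType R) (f : U -> V) a u : linear f -> f (a *: u) = a *: f u.
Proof. by move=> fl; have := fl a u 0; rewrite (linear_fun0 fl) !addr0. Qed.

Lemma free_projective n : projective_mod 'rV[R]_n.
Proof.
move=> A B g f gT.
have /choice[c cE] : forall j, exists a, g a = f (delta_mx 0 j).
  by move=> j; have : [set: B] (f (delta_mx 0 j)) by []; rewrite -gT => -[a _ <-]; exists a.
have hl : linear (fun v : 'rV[R]_n => \sum_j v 0 j *: c j).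
  move=> a u v; rewrite scaler_sumr -big_split; apply: eq_bigr => j _ /=.
  by rewrite !mxE scalerDl scalerA.
exists (mklin hl) => v /=.
rewrite [in RHS](row_sum_delta v) !linear_sum; apply: eq_bigr => j _ /=.
by rewrite !linearZ /= cE.
Qed.

Lemma free_cover (M : lmodType R) (s : seq M) :
  exists d : {linear 'rV[R]_(size s) -> M}, range d = [set x | x \in gen [set` s]].
Proof.
have dl : linear (fun v : 'rV[R]_(size s) => \sum_j v 0 j *: s`_j).
  move=> a u v; rewrite scaler_sumr -big_split; apply: eq_bigr => j _ /=.
  by rewrite !mxE scalerDl scalerA.
exists (mklin dl); apply/seteqP; split=> [_ [v _ <-]|x /gen_seqP[c ->]] /=.
  by apply: rpred_sum => j _; apply: rpredZ; apply: mem_gen; apply: mem_nth.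
exists (\row_j c j) => //=.
by apply: eq_bigr => j _; rewrite mxE.
Qed.

End LinearMaps.

Section Noetherian.
Variables (R : comNzRingType).
Hypothesis noethR : noetherian R.

Lemma noeth_fg (A : set R^o) : is_submod A ->
  exists s : seq R^o, forall x, A x <-> x \in gen [set` s].
Proof.
move=> sA; have [s sE] := noethR (gen A); exists s => x.
by rewrite -sE; symmetry; apply: mem_gen_submod.
Qed.

Lemma noeth_max (F : set (set R^o)) : (forall I, F I -> is_submod I) ->
  (exists I, F I) -> exists2 I, F I & forall J, F J -> I `<=` J -> J `<=` I.
Proof.
move=> sF [I0 FI0]; apply: contrapT => nmax.
have /choice[g gE] : forall I, exists J, F I -> F J /\ I `<` J.
  move=> I; case: (pselect (F I)) => [FI|nFI]; last by exists I.
  apply: contrapT => nJ; apply: nmax; exists I => // J FJ IJ.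
  by apply: contrapT => nJI; apply: nJ; exists J.
pose N k := iter k g I0.
have FN k : F (N k) by elim: k => //= k /gE[].
have NS k : N k `<` N k.+1 by have [] := gE _ (FN k).
have Nle k l : (k <= l)%N -> N k `<=` N l.
  elim: l => [|l IH]; first by rewrite leqn0 => /eqP->.
  rewrite leq_eqVlt => /orP[/eqP->//|/IH sub]; apply: subset_trans sub _.
  by have [] := NS l.
pose U : set R^o := [set x | exists k, N k x].
have sU : is_submod U.
  split; first by exists 0%N; have [] := sF _ (FN 0%N).
  move=> a x y [k Nx] [l Ny]; exists (maxn k l).
  apply: (proj2 (sF _ (FN _))); first exact: Nle (leq_maxl _ _) _ Nx.
  exact: Nle (leq_maxr _ _) _ Ny.
have [s sE] := noeth_fg sU.
have [K sK] : exists K, forall x, x \in s -> N K x.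
  have : forall x, x \in s -> U x by move=> x xs; apply/sE; apply: mem_gen.
  elim: (s) => [|x t IH] tU; first by exists 0%N.
  have [|K tK] := IH; first by move=> y yt; apply: tU; rewrite inE yt orbT.
  have [k Nx] := tU x (mem_head _ _); exists (maxn K k) => y.
  rewrite inE => /orP[/eqP->|/tK Ny]; first exact: Nle (leq_maxr _ _) _ Nx.
  exact: Nle (leq_maxl _ _) _ Ny.
have [_] := NS K; apply=> x Nx.
have : x \in gen [set` s] by apply/sE; exists K.+1.
by apply: gen_ind; [exact: sF|exact: sK].
Qed.

(** The coefficients of [v] in elements of [N] form an ideal [Z]. Lifts of its generators, with
    generators of the part of [N] in the span of [s], generate [N]. *)
Lemma noeth_submod (M : lmodType R) (s : seq M) (N : set M) : is_submod N ->
  N `<=` [set x | x \in gen [set` s]] ->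
  exists t : seq M, forall x, N x <-> x \in gen [set` t].
Proof.
elim: s N => [|v s IH] N sN Ns.
  exists [::] => x; split=> [/Ns//|/gen_seqP[c ->]].
  by rewrite big_ord0; case: sN.
pose Z : set R^o := [set c | exists y, y \in gen [set` s] /\ N (c *: v + y)].
have sZ : is_submod Z.
  split; first by exists 0; rewrite rpred0 scale0r addr0; split=> //; case: sN.
  move=> a c d [y [sy Ny]] [z [sz Nz]]; exists (a *: y + z).
  split; first by rewrite rpredD ?rpredZ.
  rewrite scalerDl -scalerA addrACA -scalerDr; exact: (proj2 sN).
have [cs csE] := noeth_fg sZ.
have /choice[y yE] : forall c, exists y, Z c -> y \in gen [set` s] /\ N (c *: v + y).
  move=> c; case: (pselect (Z c)) => [[y ?]|nZ]; last by exists 0.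
  by exists y.
have [t tE] := IH (N `&` [set x | x \in gen [set` s]])
  (is_submodI sN (is_submod_mem _)) (@subIsetr _ _ _).
exists ([seq c *: v + y c | c <- cs] ++ t) => x.
have Zcs c : c \in cs -> Z c by move=> cs'; apply/csE; apply: mem_gen.
split; last first.
  apply: gen_ind => // z; rewrite /= mem_cat => /orP[/mapP[c /Zcs Zc ->]|zt].
    by have [] := yE c Zc.
  by have [] : (N `&` [set x | x \in gen [set` s]]) z by apply/tE; apply: mem_gen.
move=> Nx; have /gen_consP[c [w [sw xE]]] := Ns _ Nx.
pose G := gen [set` [seq c *: v + y c | c <- cs] ++ t].
have Zc : Z c by exists w; rewrite -xE.
have /csE cg := Zc.
have [z [zG zN zs]] : exists z, [/\ z \in G, N z & z - c *: v \in gen [set` s]].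
  move: c cg {Zc xE}.
  apply: (gen_ind (P := fun c : R^o =>
    exists z, [/\ z \in G, N z & z - c *: v \in gen [set` s]])).
    split; first by exists 0; rewrite scale0r subr0 !rpred0; split=> //; case: sN.
    move=> a c d [z [zG zN zs]] [z' [zG' zN' zs']]; exists (a *: z + z'); split.
    - by rewrite rpredD ?rpredZ.
    - exact: (proj2 sN).
    rewrite scalerDl opprD addrACA -scalerA -scalerBr.
    by rewrite rpredD ?rpredZ.
  move=> c cs'; have [sy Ny] := yE c (Zcs _ cs').
  exists (c *: v + y c); split=> //.
    by apply: mem_gen; rewrite /= mem_cat; apply/orP; left; apply/mapP; exists c.
  by rewrite addrAC subrr add0r.
rewrite -[x](subrK z); apply: rpredD => //.
have /tE : (N `&` [set x | x \in gen [set` s]]) (x - z).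
  split; first exact: submodB.
  have -> : x - z = w - (z - c *: v) by rewrite xE opprB addrA [w + _]addrC.
  exact: rpredB.
apply: (gen_ind (P := fun u => u \in G)); first exact: is_submod_mem.
by move=> u ut; apply: mem_gen; rewrite /= mem_cat orbC ut.
Qed.

(** Supplies the resolution that [type_is] asks for when a type has to be exhibited. *)
Lemma fg_resolution (M : lmodType R) (s : seq M) : (forall x, x \in gen [set` s]) ->
  exists (P0 P1 P2 : lmodType R) (d2 : {linear P2 -> P1})
      (d1 : {linear P1 -> P0}) (d0 : {linear P0 -> M}),
    [/\ projective_mod P0, projective_mod P1 & projective_mod P2] /\
    [/\ range d0 = setT, exact_at d1 d0 & exact_at d2 d1].
Proof.
move=> sT; have [d0 d0E] := free_cover s.
have free_fg n : exists t : seq 'rV[R]_n, forall x, x \in gen [set` t].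
  exists [seq delta_mx 0 j | j <- enum 'I_n] => x.
  rewrite (row_sum_delta x); apply: rpred_sum => j _; apply: rpredZ.
  by apply: mem_gen => /=; apply: map_f; rewrite mem_enum.
have ker_cover n (N : lmodType R) (d : {linear 'rV[R]_n -> N}) :
    exists p (d' : {linear 'rV[R]_p -> 'rV[R]_n}), exact_at d' d.
  have [t tT] := free_fg n.
  have sK : is_submod [set x | d x = 0].
    split=> [|a x y /= x0 y0]; first exact: linear0.
    by rewrite linearP x0 y0 scaler0 addr0.
  have [u uE] := noeth_submod sK (fun x _ => tT x).
  have [d' d'E] := free_cover u; exists (size u), d'.
  by rewrite /exact_at d'E; apply/seteqP; split=> x /uE.
have [n1 [d1 e1]] := ker_cover _ _ d0.
have [n2 [d2 e2]] := ker_cover _ _ d1.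
exists 'rV[R]_(size s), 'rV[R]_n1, 'rV[R]_n2, d2, d1, d0; split.
  by split; apply: free_projective.
by split=> //; rewrite d0E; apply/seteqP; split=> // x _; apply: sT.
Qed.

End Noetherian.

(** * Local rings of dimension one *)

Section LenleOne.
Variables (R : comNzRingType) (M : lmodType R).

Lemma lenle1P (A B : set M) : is_submod A ->
  (forall y1 y2, B y1 -> B y2 -> A y1 \/ exists c, A (y2 - c *: y1)) ->
  lenle A B 1.
Proof.
move=> sA H k D h DB; case: k h => // k h; case: k h => // k h.
have [] : exists C0 C1, [/\ is_submod C0, is_submod C1, A `<=` C0, C0 `<` C1 & C1 `<` D].
  inversion h as [|k1 C1 D1 h1 sD1 ltD1]; subst.
  inversion h1 as [|k0 C0 D0 h0 sD0 ltD0]; subst.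
  by exists C0, C1; split=> //; [apply: hc_submod h0|apply: hc_sub h0].
move=> C0 [C1 [sC0 sC1 AC0 [C01 nC10] [C1D nDC1]]].
have [y1 C1y1 nC0y1] : exists2 y1, C1 y1 & ~ C0 y1.
  apply: contrapT => n; apply: nC10 => y C1y; apply: contrapT => nC0y.
  by apply: n; exists y.
case: nDC1 => y2 Dy2.
have [/AC0//|[c /AC0/C01 C1y]] := H y1 y2 (DB _ (C1D _ C1y1)) (DB _ Dy2).
by rewrite -[y2](subrK (c *: y1)); apply: submodD => //; apply: submodZ.
Qed.

End LenleOne.

Section LocalRing.
Variables (R : comNzRingType) (m : ideal R).
Hypotheses (noethR : noetherian R) (localR : local_ring m).
Local Notation mR := [set x : R^o | x \in m].

Lemma max_ideal1 : (1 : R^o) \notin m. Proof. by case: localR => -[]. Qed.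

Lemma max_idealM (a b : R) : a \in m -> b * a \in m.
Proof. by move=> am; apply: (rpredZ b) am. Qed.

Lemma max_idealMr (a b : R) : a \in m -> a * b \in m.
Proof. by move=> am; rewrite mulrC; apply: max_idealM. Qed.

Lemma proper_sub_max (I : set R^o) : is_submod I -> ~ I 1 -> I `<=` mR.
Proof.
move=> sI nI1.
have [J [sJ nJ1 IJ] maxJ] : exists2 J : set R^o, [/\ is_submod J, ~ J 1 & I `<=` J] &
    forall K, [/\ is_submod K, ~ K 1 & I `<=` K] -> J `<=` K -> K `<=` J.
  have [||J FJ maxJ] := noeth_max noethR (F := fun K => [/\ is_submod K, ~ K 1 & I `<=` K]).
  - by move=> K [].
  - by exists I; split.
  - by exists J.
have maxJ' : maximal_ideal (gen J).
  split; first by apply/negP => /(mem_gen_submod _ sJ).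
  move=> K K1 JK x Kx; apply/mem_gen_submod => //.
  apply: (maxJ [set x | x \in K]) => //; last by move=> y Jy; apply: JK; apply/mem_gen_submod.
  split; [exact: is_submod_mem|exact/negP|].
  by move=> y /IJ Jy; apply: JK; apply/mem_gen_submod.
by have [_ uniq] := localR; move=> x /IJ Jx; rewrite /mkset -(uniq _ maxJ'); apply/mem_gen_submod.
Qed.

Lemma unit_not_max (a : R) : a \notin m -> exists b, b * a = 1.
Proof.
move=> am; case: (pselect (line (a : R^o) 1)) => [[b _ ba]|n1]; first by exists b.
by have := proper_sub_max (is_submod_line _) n1 (line_id (a : R^o)); rewrite /mkset (negPf am).
Qed.

Lemma unit_1B (a : R) : a \in m -> exists b, b * (1 - a) = 1.
Proof.
move=> am; apply: unit_not_max; apply/negP => ma.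
by have := rpredD ma am; rewrite subrK (negPf max_ideal1).
Qed.

Lemma nakayama (M : lmodType R) (A W : set M) (s : seq M) :
  is_submod W -> (forall x, A x <-> x \in gen [set` s]) ->
  A `<=` addm W [set x | x \in mulI m (gen A)] -> A `<=` W.
Proof.
move=> sW As AW.
have sA : is_submod A.
  by split=> [|a x y /As xs /As ys]; apply/As; rewrite ?rpred0 // rpredD // rpredZ.
have I0 : mR 0 by apply: rpred0.
have ID (a b : R) : mR a -> mR b -> mR (a + b) by apply: rpredD.
have IN (a : R) : mR a -> mR (- a) by move=> ma; apply: (submodN (is_submod_mem m) ma).
have IM (a b : R) : mR a -> mR b -> mR (a * b) by move=> _; apply: max_idealM.
have [mu mmu kmu] : exists2 mu, mR mu & forall v, v \in s -> W ((1 - mu) *: v).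
  apply: determinant_trick => // v vs.
  have /AW[w [x [Ww xm ->]]] : A v by apply/As; apply: mem_gen.
  apply: combD => //; first exact: combW.
  move: x xm; apply: gen_ind.
    split=> [|a x y cx cy]; first by apply: combW => //; case: sW.
    by apply: combD => //; apply: combZ => // c mc; apply: max_idealM.
  move=> _ [a [x [am xA ->]]]; have /As : A x by apply/(mem_gen_submod _ sA).
  move: x {xA}; apply: gen_ind.
    split=> [|b x y cx cy]; first by rewrite scaler0; apply: combW => //; case: sW.
    rewrite scalerDr; apply: combD => //; rewrite scalerA mulrC -scalerA.
    by apply: combZ => // c mc; apply: max_idealM.
  by move=> x xs; apply: comb_mem.
have [b bE] := unit_1B mmu.
move=> x /As; move: x; apply: gen_ind => // v vs.
by rewrite -[v]scale1r -bE -scalerA; apply: submodZ => //; apply: kmu.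
Qed.

Lemma lenle_socle (M : lmodType R) (C C' : set M) t :
  is_submod C -> (forall a, a \in m -> C (a *: t)) -> C' `<=` addm C (line t) ->
  lenle C C' 1.
Proof.
move=> sC mt C'C; apply: lenle1P => // y1 y2 /C'C[c1 [_ [C1 [r1 _ <-] ->]]].
move=> /C'C[c2 [_ [C2 [r2 _ <-] ->]]].
case: (boolP (r1 \in m)) => [rm|/unit_not_max[b bE]].
  by left; apply: submodD => //; apply: mt.
right; exists (r2 * b); rewrite scalerDr scalerA -mulrA bE mulr1 opprD addrACA subrr addr0.
by apply: submodB => //; apply: submodZ.
Qed.

(** If [a *: t] is outside [C] for some [a] in [m], it replaces [t]. The span shrinks strictly
    because [1 - c * a] is a unit, so the length bound ends the descent. *)
Lemma socle_of_lenle (M : lmodType R) (C : set M) n t :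
  is_submod C -> ~ C t -> lenle C (addm C (line t)) n ->
  exists t', [/\ addm C (line t) t', ~ C t' & forall a, a \in m -> C (a *: t')].
Proof.
move=> sC; elim: n t => [|n IH] t nCt l.
  case: nCt; apply: (lenle0 l) => //; last exact: addm_subr (line_id _).
    exact/is_submod_add/is_submod_line.
  exact/addm_subl/is_submod_line.
case: (pselect (forall a, a \in m -> C (a *: t))) => [mt|/existsNP[a /not_implyP[am nCa]]].
  by exists t; split=> //; apply: addm_subr (line_id _).
have sub : addm C (line (a *: t)) `<=` addm C (line t).
  move=> _ [x [_ [Cx [c _ <-] ->]]]; exists x, (c *: (a *: t)); split=> //.
  by exists (c * a); rewrite ?scalerA.
have [|t' [/sub t'1 t'2 t'3]] := IH (a *: t) nCa; last by exists t'.
move=> k D h DC; rewrite -ltnS; apply: (l k.+1 (addm C (line t))) => //.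
apply: hcS h _ _; first exact/is_submod_add/is_submod_line.
split; first exact: subset_trans sub.
move=> /(_ _ (addm_subr sC (line_id t))) /DC[x [_ [Cx [c _ <-] tE]]].
have [|b bE] := @unit_1B (c * a); first exact: max_idealM.
apply: nCt; rewrite -[t]scale1r -bE -scalerA; apply: submodZ => //.
by rewrite scalerBl scale1r -scalerA {1}tE addrK.
Qed.

(** Take [t] outside [J] with [J : t] maximal. If [y * t] were outside [J], maximality would keep
    every [y ^+ a * t] outside, yet some power of [y] is in [J]. *)
Lemma socle_of_radical (J : set R^o) : is_submod J -> ~ J 1 ->
  (forall y, y \in m -> exists N, J (y ^+ N)) ->
  exists2 t : R^o, ~ J t & forall a, a \in m -> J (a * t).
Proof.
move=> sJ J1 radJ; pose col t : set R^o := [set c : R^o | J (c * t)].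
have scol t : is_submod (col t).
  split; first by rewrite /col /= mul0r; case: sJ.
  by move=> a x y Jx Jy; rewrite /col /= mulrDl -scalerAl; apply: (proj2 sJ).
have [||_ [t nJt <-] maxt] := noeth_max noethR (F := fun I => exists2 t, ~ J t & col t = I).
- by move=> _ [t _ <-].
- by exists (col 1); exists 1.
exists t => // y ym; apply: contrapT => nJyt.
have [N yN] := radJ y ym.
have yt a : ~ J (y ^+ a * t).
  elim: a => [|a IH]; first by rewrite expr0 mul1r.
  rewrite exprS -mulrA => Jy; apply: nJyt.
  apply: (maxt (col (y ^+ a * t))); first by exists (y ^+ a * t).
    by move=> c Jc; rewrite /col /= mulrCA; apply: (submodZ (y ^+ a) sJ).
  exact: Jy.
by apply: (yt N); rewrite mulrC; apply: (submodZ t sJ).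
Qed.

(** A maximal counterexample can be enlarged by a socle element, which accounts for length at most
    one. *)
Lemma finite_length_radical (J : set R^o) : is_submod J ->
  (forall y, y \in m -> exists N, J (y ^+ N)) -> exists n, lenle J setT n.
Proof.
move=> sJ radJ; apply: contrapT => nfin.
have [||I [sI radI nI] maxI] := noeth_max noethR (F := fun I => [/\ is_submod I,
    (forall y, y \in m -> exists N, I (y ^+ N)) & ~ exists n, lenle I setT n]).
- by move=> I [].
- by exists J; split.
have I1 : ~ I 1.
  move=> I1; apply: nI; exists 0%N; apply: lenle_id => x _.
  by have := submodZ x sI I1; rewrite /GRing.scale /= mulr1.
have [t nIt mt] := socle_of_radical sI I1 radI.
have sI' := is_submod_add sI (is_submod_line t).
have II' := addm_subl (A := I) (is_submod_line t).
apply: nIt; apply: (maxI (addm I (line t))) => //; last exact: addm_subr (line_id _).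
split=> //; first by move=> y /radI[N yN]; exists N; apply: II'.
move=> [n ln]; apply: nI; exists (1 + n)%N; apply: (lenle_add sI') => //.
by apply: (lenle_socle sI mt) => //; apply: subset_refl.
Qed.

End LocalRing.

Section DimensionOne.
Variables (R : comNzRingType) (m : ideal R).
Hypotheses (noethR : noetherian R) (localR : local_ring m).
Hypothesis dimR : krull_dim R^o 1.
Local Notation mR := [set x : R^o | x \in m].

Lemma prime_avoiding (I0 : set R^o) (T : set R) : is_submod I0 -> T 1 ->
  (forall a b, T a -> T b -> T (a * b)) -> (forall a, T a -> ~ I0 a) ->
  exists P : ideal R, [/\ prime_ideal P, I0 `<=` [set x | x \in P] & forall a, T a -> a \notin P].
Proof.
move=> sI0 T1 TM TI0.
have [||P [sP I0P TP] maxP] := noeth_max noethR (F := fun I => [/\ is_submod I,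
    I0 `<=` I & forall a, T a -> ~ I a]).
- by move=> I [].
- by exists I0; split.
have gP x : (x \in gen P) <-> P x by apply: mem_gen_submod.
exists (gen P); split; last by move=> a Ta; apply/negP => /gP; apply: TP.
  split; first by apply/negP => /gP; apply: TP.
  move=> u v uv; apply: contrapT => /negP; rewrite negb_or => /andP[/negP nu /negP nv].
  have meet w : w \notin gen P -> exists2 a, T a & addm P (line (w : R^o)) a.
    move=> /negP nw; apply: contrapT => nT; apply: nw; apply/gP.
    apply: (maxP (addm P (line (w : R^o)))); last exact: addm_subr (line_id _).
      split; first exact/is_submod_add/is_submod_line.
        by apply: subset_trans I0P _; apply/addm_subl/is_submod_line.
      by move=> a Ta Pa; apply: nT; exists a.
    exact/addm_subl/is_submod_line.
  have [a Ta [p [_ [Pp [c _ <-] aE]]]] := meet u (introN idP nu).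
  have [b Tb [q [_ [Pq [d _ <-] bE]]]] := meet v (introN idP nv).
  apply: (TP _ (TM _ _ Ta Tb)); rewrite aE mulrDl; apply: (submodD sP).
    by rewrite mulrC; apply: (submodZ b sP Pp).
  rewrite bE mulrDr; apply: (submodD sP); first exact: (submodZ (c *: (u : R^o)) sP Pq).
  have -> : c *: (u : R^o) * (d *: (v : R^o)) = (c * d) *: (u * v : R^o).
    by rewrite /GRing.scale /= mulrACA.
  by apply: submodZ => //; apply/gP.
by move=> x /I0P Px; apply/gP.
Qed.

Lemma max_prime : prime_ideal m.
Proof.
split; first exact: max_ideal1.
move=> u v uv; apply: contrapT => /negP; rewrite negb_or => /andP[nu nv].
have [a aE] := unit_not_max noethR localR nu.
have [b bE] := unit_not_max noethR localR nv.
have := max_ideal1 localR; rewrite -[1]mulr1 -{1}aE -bE mulrACA.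
by rewrite (max_idealM _ uv).
Qed.

(** Otherwise a prime [P] contains [x] but not [y]. As [x] is regular, no [x ^+ i * s] with [s]
    outside [P] is zero, so some prime [p] avoids them all, and [p < P < m] contradicts dimension
    one. *)
Lemma radical_nzd (x : R) : (forall y, x * y = 0 -> y = 0) -> 
  forall y, y \in m -> exists N, line (x : R^o) (y ^+ N).
Proof.
move=> nzdx y ym; apply: contrapT => nN.
have [||||P [primeP xP yP]] := @prime_avoiding (line (x : R^o)) [set a | exists N, a = y ^+ N].
- exact: is_submod_line.
- by exists 0%N.
- by move=> _ _ [N ->] [N' ->]; exists (N + N')%N; rewrite exprD.
- by move=> _ [N ->] yN; apply: nN; exists N.
have Px : x \in P by apply: xP; apply: (line_id (x : R^o)).
have [P1 Pm] := primeP.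
have [||||p [primep _ Tp]] :=
  @prime_avoiding [set 0] [set a | exists i s, s \notin P /\ a = x ^+ i * s].
- exact: is_submod0.
- by exists 0%N, 1; rewrite mulr1.
- move=> _ _ [i [s [sP ->]]] [j [t [tP ->]]]; exists (i + j)%N, (s * t).
  rewrite exprD mulrACA; split=> //; apply/negP => /Pm.
  by rewrite (negPf sP) (negPf tP).
- move=> _ [i [s [sP ->]]] z; have s0 : s = 0.
    by elim: i z => [|i IH]; rewrite ?expr0 ?mul1r // exprS -mulrA => /nzdx.
  by rewrite s0 rpred0 in sP.
have pP : {subset p <= P}.
  move=> s ps; apply: contrapT => /negP nPs.
  by have := Tp s; rewrite ps => /(_ _)/negP; apply=> //; exists 0%N, s; rewrite expr0 mul1r.
have Pm' : {subset P <= m}.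
  have := proper_sub_max noethR localR (is_submod_mem P) (elimN idP P1).
  by move=> sub z Pz; apply: sub.
have [_ /(_ 2%N (fun i => if i is 0%N then p else if i is 1%N then P else m))] := dimR.
suff /[swap]/[apply] : dim_chain R^o 2
  (fun i => if i is 0%N then p else if i is 1%N then P else m) by [].
split=> [i _|i|a a0]; last first.
- by have := a0 1; rewrite /GRing.scale /= mulr1 => ->; apply: rpred0.
- case: i => [|[|i]] // _; split=> // sub.
    have := Tp x; rewrite (sub x Px) => /(_ _)/negP; apply=> //.
    by exists 1%N, 1; rewrite expr1 mulr1.
  by have := yP y; rewrite (sub y ym) => /(_ _)/negP; apply=> //; exists 1%N; rewrite expr1.
- by case: i => [|[|i]] //; apply: max_prime.
Qed.

Lemma finite_length_nzd (x : R) (J : set R^o) : (forall y, x * y = 0 -> y = 0) ->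
  is_submod J -> J x -> exists n, lenle J setT n.
Proof.
move=> nzdx sJ Jx; apply: (finite_length_radical noethR localR) => // y ym.
have [N [c _ cE]] := radical_nzd nzdx ym.
by exists N; rewrite -cE; apply: submodZ.
Qed.

Lemma krull_dim_uniq (M : lmodType R) d d' : krull_dim M d -> krull_dim M d' -> d = d'.
Proof.
move=> [[p cp] maxd] [[p' cp'] maxd']; apply/eqP; rewrite eqn_leq.
by rewrite (maxd' _ _ cp) (maxd _ _ cp').
Qed.

Lemma regular_element (M : lmodType R) : cohen_macaulay m M -> krull_dim M 1 ->
  exists2 x, x \in m & forall y : M, x *: y = 0 -> y = 0.
Proof.
move=> [_ [d dimM [[s [sm regs _] ss] _]]] dimM1.
have d1 := krull_dim_uniq dimM dimM1; rewrite d1 in ss.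
case: s ss sm regs => [|x [|? ?]] // _ sm regs; exists x; first exact/sm/mem_head.
(* The first quotient in a regular sequence is by the submodule generated by nothing; the remaining
   lines show that it is zero. *)
move=> y xy; have /= := regs 0%N (erefl _) (@qproj _ _ _ y).
rewrite -linearZ xy linear0 => /(_ (erefl _)) /qproj_eq0.
move: y {xy}; apply: gen_ind; first exact: is_submod0.
move=> _ [a [z [aT _ ->]]] /=; suff -> : a = 0 by rewrite scale0r.
move: a aT; apply: gen_ind; first exact: (@is_submod0 _ R^o).
by [].
Qed.

End DimensionOne.

(** * Type and duality *)

Section Multiples.
Variables (R : comNzRingType) (N : lmodType R).

Definition multiples (x : R) : set N := range (fun y => x *: y).

Lemma is_submod_multiples x : is_submod (multiples x).
Proof.
split; first by exists 0; rewrite ?scaler0.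
move=> a _ _ [y _ <-] [z _ <-]; exists (a *: y + z) => //.
by rewrite scalerDr !scalerA mulrC.
Qed.

Definition nzd_on (x : R) := forall y : N, x *: y = 0 -> y = 0.

Lemma nzd_onI x (y z : N) : nzd_on x -> x *: y = x *: z -> y = z.
Proof.
move=> nzdx e; apply/eqP; rewrite -subr_eq0; apply/eqP/nzdx.
by rewrite scalerBr e subrr.
Qed.

(** Modulo [multiples x] this is the socle of [N / xN]. *)
Definition col_max (m : ideal R) (x : R) : set N :=
  [set z | forall a, a \in m -> multiples x (a *: z)].

Lemma is_submod_col_max m x : is_submod (col_max m x).
Proof.
have [M0 MZ] := is_submod_multiples x.
split=> [a _|b y z yM zM a am]; first by rewrite scaler0.
by rewrite scalerDr scalerA mulrC -scalerA; apply: MZ; [apply: yM|apply: zM].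
Qed.

Lemma multiples_sub_col_max m x : multiples x `<=` col_max m x.
Proof.
by move=> _ [y _ <-] a _; exists (a *: y) => //; rewrite !scalerA mulrC.
Qed.

End Multiples.
Arguments multiples {R} N x.
Arguments nzd_on {R} N x.
Arguments col_max {R} N m x.

Section Ext.
Variables (R : comNzRingType) (m : ideal R).

Lemma is_submod_cocycles (P1 P2 N : lmodType R) (d2 : {linear P2 -> P1}) :
  is_submod [set f : P1 -> N | linear f /\ forall x, f (d2 x) = 0].
Proof.
split=> [|a f g [fl f0] [gl g0]].
  by split=> // a x y /=; rewrite /GRing.zero /= scaler0 addr0.
split=> [b x y|x]; last first.
  by rewrite -[LHS]/(a *: f (d2 x) + g (d2 x)) f0 g0 scaler0 addr0.
rewrite -[LHS]/(a *: f (b *: x + y) + g (b *: x + y)) fl gl.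
rewrite -[RHS]/(b *: (a *: f x + g x) + (a *: f y + g y)).
by rewrite !scalerDr !scalerA [a * b]mulrC addrACA.
Qed.

Lemma is_submod_coboundaries (P0 P1 N : lmodType R) (d1 : {linear P1 -> P0}) :
  is_submod [set f : P1 -> N | exists g : {linear P0 -> N}, f = g \o d1].
Proof.
split.
  have l0 : linear (fun _ : P0 => 0 : N) by move=> a x y; rewrite scaler0 addr0.
  by exists (mklin l0); apply/funext.
move=> a _ _ [f ->] [g ->].
have l : linear (fun x => a *: f x + g x).
  by move=> b x y; rewrite (linearP f) (linearP g) /= !scalerDr !scalerA [a * b]mulrC addrACA.
by exists (mklin l); apply/funext.
Qed.

(* With [p0] in [P0] lifting the unit of the residue field, [x *: p0] is [d1 q] for some [q],
   and the class of a cocycle [f] is determined by [f q], which does not depend on [q]. *)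
Lemma ext1_len (N P0 P1 P2 : lmodType R) (d2 : {linear P2 -> P1})
    (d1 : {linear P1 -> P0}) (d0 : {linear P0 -> residue_field m}) x n :
  x \in m -> nzd_on N x -> projective_mod P0 -> range d0 = setT ->
  exact_at d1 d0 -> exact_at d2 d1 ->
  length_is (subquot (cocycles N d2) (coboundaries N d1)) n <->
  len (multiples N x) (col_max N m x) n.
Proof.
move=> xm nzdx proj0 d0T e1 e2.
have cocP f : f \in cocycles N d2 <-> linear f /\ forall x, f (d2 x) = 0.
  by apply: mem_gen_submod; apply: is_submod_cocycles.
have cobP f : f \in coboundaries N d1 <-> exists g : {linear P0 -> N}, f = g \o d1.
  by apply: mem_gen_submod; apply: is_submod_coboundaries.
have d12 p : d1 (d2 p) = 0.
  by have : [set y | d1 y = 0] (d2 p) by rewrite -e2; exists p.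
have d01 p : d0 (d1 p) = 0.
  by have : [set y | d0 y = 0] (d1 p) by rewrite -e1; exists p.
have ex1 p : d0 p = 0 -> exists q, d1 q = p.
  by move=> p0; have : [set y | d0 y = 0] p by []; rewrite -e1 => -[q _ <-]; exists q.
have ex2 p : d1 p = 0 -> exists q, d2 q = p.
  by move=> p0; have : [set y | d1 y = 0] p by []; rewrite -e2 => -[q _ <-]; exists q.
have cocB f u v : f \in cocycles N d2 -> d1 u = d1 v -> f u = f v.
  move=> /cocP[fl f0] e; have [|q qE] := ex2 (u - v); first by rewrite linearB e subrr.
  by rewrite -[u](subrK v) -qE addrC -[v]scale1r fl f0 !scale1r addr0.
rewrite length_subquot; last first.
  by move=> f /cobP[g ->]; apply/cocP; split=> [a u v|u] /=; rewrite ?linearP // d12 linear0.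
have [al alE] : exists al : {linear P0 -> R^o}, @qproj _ _ m \o al =1 d0.
  apply: proj0; apply/seteqP; split=> // y _.
  by have [z <-] := qproj_surj y; exists z.
have [p0 p0E] : exists p0, d0 p0 = @qproj _ R^o m 1.
  by have : [set: residue_field m] (@qproj _ R^o m 1) by []; rewrite -d0T => -[p _ <-]; exists p.
have d0p0 (a : R) : d0 (a *: p0) = @qproj _ R^o m a.
  by rewrite linearZ /= p0E -linearZ /GRing.scale /= mulr1.
have alm p : d0 p = 0 -> al p \in m by rewrite -alE /= => /qproj_eq0.
have /choice[h hE] : forall a, exists q, a \in m -> d1 q = a *: p0.
  move=> a; case: (boolP (a \in m)) => [am|_]; last by exists 0.
  by have [|q qE] := ex1 (a *: p0); [rewrite d0p0; apply/qproj_eq0|exists q].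
have linZ (f : P1 -> N) b u : linear f -> f (b *: u) = b *: f u.
  by move=> fl; rewrite -[f](_ : mklin fl = f :> (_ -> _)) // linearZ.
have linB (f : P1 -> N) u v : linear f -> f (u - v) = f u - f v.
  by move=> fl; rewrite -[f](_ : mklin fl = f :> (_ -> _)) // linearB.
have key f a : f \in cocycles N d2 -> a \in m -> a *: f (h x) = x *: f (h a).
  move=> fc am; have [fl _] := (cocP f).1 fc.
  rewrite -!linZ //; apply: cocB => //.
  by rewrite !linearZ /= !hE // !scalerA mulrC.
apply: (@len_corr _ _ _ (fun f : P1 -> N => f (h x))).
- exact: is_submod_multiples.
- exact: is_submod_mem.
- exact: is_submod_col_max.
- exact: multiples_sub_col_max.
- by [].
- by move=> f fc a am; exists (f (h a)); rewrite // key.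
- move=> f /=; split=> [fcob|[fc [n0 _ fx]]].
    have /cobP[g fE] := fcob; split.
      apply/cocP; rewrite fE; split=> [a u v|u] /=; first by rewrite !linearP.
      by rewrite d12 linear0.
    by exists (g p0) => //; rewrite fE /= hE // linearZ.
  have [fl f0] := (cocP f).1 fc.
  have fh a : a \in m -> f (h a) = a *: n0.
    move=> am; apply: (nzd_onI nzdx).
    by rewrite -key // -fx !scalerA mulrC.
  have /choice[k kE] : forall p, exists q, d1 q = p - (al p : R) *: p0.
    move=> p; apply: ex1; rewrite linearB d0p0 -alE /= subrr.
    by [].
  have gl : linear (fun p => (al p : R) *: n0 + f (k p)).
    move=> a u v; rewrite linearP scalerDl -scalerA scalerDr addrACA; congr (_ + _).
    rewrite -fl; apply: cocB => //; rewrite linearP !kE linearP.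
    by rewrite scalerDl -scalerA scalerBr opprD addrACA.
  apply/cobP; exists (mklin gl); apply/funext => q /=.
  have am : al (d1 q) \in m by apply: alm.
  rewrite -fh // [f q](_ : f q = f (h (al (d1 q)) + k (d1 q))).
    by have := fl 1 (h (al (d1 q))) (k (d1 q)); rewrite !scale1r.
  by apply: cocB => //; rewrite linearD hE // kE addrC subrK.
- move=> z zT.
  have /choice[y yE] : forall a, exists y, a \in m -> a *: z = x *: y.
    move=> a; case: (boolP (a \in m)) => [am|_]; last by exists 0.
    by have [y _ yE] := zT a am; exists y.
  pose f q := y (al (d1 q)).
  have fE q : (al (d1 q) : R) *: z = x *: f q by apply: yE; apply: alm.
  have fl : linear f.
    move=> a u v; apply: (nzd_onI nzdx).
    rewrite -fE scalerDr scalerA mulrC -scalerA -!fE !linearP scalerDl.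
    by rewrite -scalerA.
  exists f.
    by apply/cocP; split=> // q; apply: nzdx; rewrite -fE d12 linear0 scale0r.
  have fx : f (h x) = (al p0 : R) *: z.
    by apply: (nzd_onI nzdx); rewrite -fE hE // linearZ scalerA.
  rewrite fx -{1}[z]scale1r -scalerBl; apply: zT.
  suff /qproj_eq0 : @qproj _ R^o m (1 - al p0) = 0 by [].
  have /= := alE p0; rewrite p0E => e.
  apply: (etrans (linearB (@qproj _ R^o m) 1 (al p0))); apply/eqP.
  by rewrite subr_eq0 eq_sym; apply/eqP.
Qed.

(** The socle of [N0 / N1] is zero or simple. *)
Definition simple_socle (N0 : lmodType R) (N1 : set N0) : Prop :=
  forall z1 z2 : N0, (forall a, a \in m -> N1 (a *: z1)) ->
    (forall a, a \in m -> N1 (a *: z2)) -> N1 z1 \/ exists c, N1 (z2 - c *: z1).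

Lemma len1_simple (N : lmodType R) (A B : set N) : is_submod A -> A `<=` B ->
  len A B 1 -> forall z1 z2, B z1 -> B z2 -> A z1 \/ exists c, A (z2 - c *: z1).
Proof.
move=> sA AB [l h] z1 z2 Bz1 Bz2; case: (pselect (A z1)) => [|nAz1]; first by left.
right; have sB := hc_submod h.
have sA1 := is_submod_add sA (is_submod_line z1).
have h1 : hc A 1 (addm A (line z1)).
  apply: (hcS (hc0 sA (@subset_refl _ A))) => //; split; first exact/addm_subl/is_submod_line.
  by move=> sub; apply/nAz1/sub; apply: (addm_subr sA); apply: line_id.
have A1B : addm A (line z1) `<=` B by apply: addm_sub => //; apply: line_sub.
have [a [_ [Aa [c _ <-] z2E]]] : addm A (line z1) z2.
  apply: contrapT => nz2.
  have h2 : hc A 2 B by apply: (hcS h1 sB); split=> // /(_ _ Bz2).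
  by have := l 2%N B h2 (@subset_refl _ B).
by exists c; rewrite z2E addrK.
Qed.

(** Multiplication by [x] carries the elements that [m] sends into [range h] to the image of
    [col_max N m x], so the socle of [N / xN] controls that of [N0 / range h]. *)
Lemma simple_socle_range (N N0 : lmodType R) (h : {linear N -> N0}) x :
  x \in m -> nzd_on N0 x -> injective h ->
  len (multiples N x) (col_max N m x) 1 -> simple_socle (range h).
Proof.
move=> xm nzdx hI l1 z1 z2 mz1 mz2.
have [t1 _ t1E] := mz1 x xm; have [t2 _ t2E] := mz2 x xm.
have colT z t : (forall a, a \in m -> range h (a *: z)) -> h t = x *: z -> col_max N m x t.
  move=> mz tE a am; have [k _ kE] := mz a am; exists k => //; apply: hI.
  by rewrite !linearZ /= kE tE !scalerA mulrC.
have mulT z t : h t = x *: z -> multiples N x t -> range h z.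
  move=> tE [k _ kE]; exists k => //; apply: (nzd_onI nzdx).
  by rewrite -linearZ /= kE tE.
have := len1_simple (is_submod_multiples N x) (@multiples_sub_col_max _ N m x) l1
  (colT _ _ mz1 t1E) (colT _ _ mz2 t2E).
case=> [/(mulT _ _ t1E)|[c tc]]; [by left|right; exists c].
by apply: mulT tc; rewrite linearB linearZ /= t1E t2E scalerBr !scalerA mulrC.
Qed.

(* The half of canonical duality that needs only type one: enlarging [C] by a simple module
   shrinks its dual by at most a simple module. *)
Lemma dual_lenle (M1 M2 N0 : lmodType R) (N1 : set N0) (p : M1 -> M2 -> N0) (A : set M1)
    (C C' : set M2) n :
  noetherian R -> local_ring m ->
  (forall y, linear (p y)) -> (forall c, linear (p^~ c)) ->
  is_submod N1 -> simple_socle N1 -> is_submod A -> is_submod C -> is_submod C' ->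
  C `<=` C' -> lenle C C' n ->
  lenle [set y | A y /\ forall c, C' c -> N1 (p y c)]
        [set y | A y /\ forall c, C c -> N1 (p y c)] n.
Proof.
move=> noethR localR pl2 pl1 sN1 soc sA sC sC'.
pose H D := [set y | A y /\ forall c : M2, D c -> N1 (p y c)].
have p0 c : p 0 c = 0 by rewrite -[p 0 c]/(mklin (pl1 c) 0) linear0.
have sH D : is_submod (H D).
  split; first by split=> [|c _]; [case: sA|rewrite p0; case: sN1].
  move=> a y z [Ay Ny] [Az Nz]; split; first exact: (proj2 sA).
  by move=> c Dc; rewrite pl1; apply: (proj2 sN1); [apply: Ny|apply: Nz].
have mH D D' : D `<=` D' -> H D' `<=` H D.
  by move=> DD' y [Ay Ny]; split=> // c /DD'/Ny.
elim: n C sC => [|n IH] C sC CC' l.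
  apply: lenle_id => y [Ay Ny]; split=> // c /(lenle0 l sC sC' CC'); exact: Ny.
case: (pselect (C' `<=` C)) => [C'C|/existsNP[t /not_implyP[C't nCt]]].
  by apply: lenle_leq (leq0n _) _; apply: lenle_id; apply: mH.
have tC' : addm C (line t) `<=` C' by apply: addm_sub => //; apply: line_sub.
have [|t' [Ct' nCt' mt']] := socle_of_lenle noethR localR sC nCt (n := n.+1).
  exact: lenle_sub l.
have sC1 := is_submod_add sC (is_submod_line t').
have C1C' : addm C (line t') `<=` C'.
  by apply: addm_sub => //; apply: line_sub => //; apply: tC'.
have CC1 := addm_subl (A := C) (is_submod_line t').
have [|_ [<-] l1] := lenle_lt sC sC1 _ C1C' l.
  by split=> // /(_ t') H1; apply: nCt'; apply: H1; apply: addm_subr (line_id _).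
rewrite -[n.+1]addn1; apply: (@lenle_add _ _ _ (H (addm C (line t')))).
- exact: sH.
- exact: sH.
- exact: mH.
- exact: mH.
- exact: IH.
apply: lenle1P => // y1 y2 [Ay1 N1y1] [Ay2 N1y2].
have pZ y a c : p y (a *: c) = a *: p y c.
  by rewrite -[p y _]/(mklin (pl2 y) _) linearZ.
have up y : A y -> (forall c, C c -> N1 (p y c)) -> N1 (p y t') -> H (addm C (line t')) y.
  move=> Ay Ny Nt; split=> // _ [c [_ [Cc [b _ <-] ->]]].
  by rewrite -[c]scale1r pl2 scale1r pZ; apply: submodD; [|apply: Ny|apply: submodZ].
have mN y : (forall c, C c -> N1 (p y c)) -> forall a, a \in m -> N1 (a *: p y t').
  by move=> Ny a am; rewrite -pZ; apply: Ny; apply: mt'.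
have [N1y1t|[c N1c]] := soc _ _ (mN _ N1y1) (mN _ N1y2); first by left; apply: up.
right; exists c; have [Ay Ny] : H C (y2 - c *: y1) by apply: submodB => //; apply: submodZ.
apply: up => //; suff -> : p (y2 - c *: y1) t' = p y2 t' - c *: p y1 t' by [].
by rewrite -[p _ t']/(mklin (pl1 t') _) linearB linearZ.
Qed.

End Ext.

(** * Finite injective dimension *)

Section Injective.
Variables (R : comNzRingType) (E : lmodType R).
Hypothesis injE : injective_mod E.

Lemma injective_ideal (J : set R^o) (phi : R -> E) : is_submod J ->
  (forall a b c : R, J b -> J c -> phi (a * b + c) = a *: phi b + phi c) ->
  exists u, forall b : R, J b -> phi b = b *: u.
Proof.
move=> sJ phil; pose A := submod (gen J).
have JA (x : A) : J (val x) by apply/(mem_gen_submod _ sJ); apply: (valP x).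
have fl : linear (fun x : A => phi (val x)).
  by move=> a x y; rewrite linearP; apply: phil; apply: JA.
have gl : linear (fun x : A => val x : R^o) by move=> a x y; rewrite linearP.
have [|h hE] := injE (g := mklin gl) (mklin fl); first by move=> x y /= /val_inj.
exists (h 1) => b Jb; have bJ : b \in gen J by apply/(mem_gen_submod _ sJ).
have /= <- := hE (Sub b bJ).
by rewrite -linearZ /GRing.scale /= mulr1.
Qed.

(** The hypothesis makes [t] to [e] a well-defined map on [(J + R t) / J]. Injectivity extends it to
    [R / J], and [g] is the image of [1]. *)
Lemma injective_extend (J : set R^o) (t : R) (e : E) : is_submod J ->
  (forall c : R, J (c * t) -> c *: e = 0) ->
  exists g : E, (forall j : R, J j -> j *: g = 0) /\ t *: g = e.
Proof.
move=> sJ te.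
have /choice[c cE] : forall z : R, exists c : R, addm J (line (t : R^o)) z -> J (z - c * t).
  move=> z; case: (pselect (addm J (line (t : R^o)) z)); last by exists 0.
  by move=> [j [_ [Jj [c _ <-] ->]]]; exists c; rewrite addrK.
have well z d : J (z - d * t) -> addm J (line (t : R^o)) z -> c z *: e = d *: e.
  move=> Jd /cE Jc; apply/eqP; rewrite -subr_eq0 -scalerBl; apply/eqP/te.
  have := submodB sJ Jd Jc; rewrite opprB addrC addrA subrK.
  by rewrite mulrBl.
have sJt := is_submod_add sJ (is_submod_line (t : R^o)).
have [a b d Jb Jd|g gE] := injective_ideal (phi := fun z => c z *: e) sJt.
  rewrite scalerA -scalerDl; apply: well; last exact: (proj2 sJt).
  have := (proj2 sJ) a _ _ (cE _ Jb) (cE _ Jd).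
  rewrite /GRing.scale /= mulrBr mulrDl mulrA opprD addrACA; apply.
exists g; split=> [j Jj|].
  rewrite -gE; last exact: (addm_subl (is_submod_line (t : R^o))).
  rewrite (well j 0) ?scale0r ?mul0r ?subr0 //.
  exact: (addm_subl (is_submod_line (t : R^o))).
have Jt := addm_subr sJ (line_id (t : R^o)).
rewrite -gE // (well t 1) ?scale1r // mul1r subrr; by case: sJ.
Qed.

End Injective.

Section FiniteInjectiveDimension.
Variables (R : comNzRingType) (m : ideal R) (K : lmodType R).
Hypotheses (noethR : noetherian R) (localR : local_ring m) (dimR : krull_dim R^o 1).
Variables (E : nat -> lmodType R) (d : forall i, {linear E i -> E i.+1})
  (eps : {linear K -> E 0%N}) (n : nat).
Hypotheses (injE : forall i, injective_mod (E i)) (epsI : injective eps)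
  (exact0 : exact_at eps (d 0)) (exactS : forall i, exact_at (d i) (d i.+1))
  (Elarge : forall i, (n < i)%N -> forall x : E i, x = 0).
Variable x : R.
Hypotheses (xm : x \in m) (nzdx : nzd_on R^o x).

Lemma resolution_dd i y : d i.+1 (d i y) = 0.
Proof. by have : [set z | d i.+1 z = 0] (d i y) by rewrite -exactS; exists y. Qed.

Lemma resolution_ker i z : d i.+1 z = 0 -> exists y, d i y = z.
Proof.
by move=> z0; have : [set z | d i.+1 z = 0] z by []; rewrite -exactS => -[y _ <-]; exists y.
Qed.

(* [Ext^(i+1)(R/m, K) = 0]. *)
Definition lifts_socle i := forall e : E i.+1, d i.+1 e = 0 ->
  (forall a, a \in m -> a *: e = 0) ->
  exists2 f, d i f = e & forall a, a \in m -> a *: f = 0.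

(* [Ext^(i+1)(R/J, K) = 0] for every ideal [J] containing [x]. *)
Definition lifts_cyclic i := forall (J : set R^o) (g : E i.+1), is_submod J -> J x ->
  d i.+1 g = 0 -> (forall a : R, J a -> a *: g = 0) ->
  exists2 g', d i g' = g & forall a : R, J a -> a *: g' = 0.

Lemma socle_coeff (J : set R^o) (t c : R) : is_submod J -> ~ J t -> J (c * t) -> c \in m.
Proof.
move=> sJ nJt Jct; case: (boolP (c \in m)) => // /(unit_not_max noethR localR)[b bE].
by case: nJt; rewrite -[t]mul1r -bE -mulrA; apply: (submodZ b sJ).
Qed.

(** Noetherian induction along [R/m -> R/I -> R/(I + R t)], where [t] spans a simple submodule of
    [R/I] and [I] is maximal without the lifting property. *)
Lemma lifts_socle_cyclic i : lifts_socle i -> lifts_cyclic i.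
Proof.
move=> lift J g sJ Jx g0 Jg; apply: contrapT => nlift.
pose bad (J : set R^o) := [/\ is_submod J, J x & exists g : E i.+1,
  [/\ d i.+1 g = 0, forall a : R, J a -> a *: g = 0 &
    ~ exists2 g', d i g' = g & forall a : R, J a -> a *: g' = 0]].
have [||I [sI Ix [{Jg nlift}g [{}g0 Ig nlift]]] maxI] := noeth_max noethR (F := bad).
- by move=> I [].
- by exists J; split=> //; exists g.
have I1 : ~ I 1.
  move=> I1; apply: nlift; exists 0; last by move=> a _; rewrite scaler0.
  by rewrite linear0 -[g]scale1r Ig.
have [t nIt mt] := socle_of_radical noethR sI I1 (fun y ym =>
  let: ex_intro N xN := radical_nzd noethR localR dimR nzdx ym in
  ex_intro _ N (line_sub sI Ix xN)).
have [||e' e'E me'] := lift (t *: g).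
- by rewrite linearZ /= g0 scaler0.
- by move=> a am; rewrite scalerA Ig //; apply: mt.
have [c Ict|u [Iu tu]] := injective_extend (@injE i) (t := t) (e := e') sI.
  exact/me'/(socle_coeff sI nIt).
have sI' := is_submod_add sI (is_submod_line t).
have II' := addm_subl (A := I) (is_submod_line t).
have It' := addm_subr sI (line_id t).
(* [g - d i u] is killed by [t] as well as by [I], so maximality of [I] lifts it. *)
have [u' u'E I'u'] : exists2 g', d i g' = g - d i u &
    forall a : R, addm I (line t) a -> a *: g' = 0.
  apply: contrapT => nl; apply: nIt; apply: (maxI (addm I (line t))) => //.
  split=> //; first exact: II'.
  exists (g - d i u); split=> //; first by rewrite linearB resolution_dd g0 subrr.
  move=> _ [a [_ [Ia [c _ <-] ->]]].
  have ta : t *: (g - d i u) = 0.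
    by rewrite scalerBr -e'E -tu linearZ subrr.
  have Ia0 : a *: (g - d i u) = 0.
    have dau : d i (a *: u) = a *: d i u by rewrite linearZ.
    by rewrite scalerBr -dau (Iu a Ia) linear0 (Ig a Ia) subrr.
  by rewrite scalerDl Ia0 -[c *: t]/(c * t) -scalerA ta scaler0 addr0.
apply: nlift; exists (u + u'); first by rewrite linearD u'E addrC subrK.
by move=> a Ia; rewrite scalerDr Iu // I'u' ?addr0 //; apply: II'.
Qed.

Lemma nzd_injective_divisible i (h : E i) : exists h', x *: h' = h.
Proof.
have [c|h' [_ h'E]] := injective_extend (@injE i) (t := x) (e := h) (@is_submod0 _ R^o).
  by rewrite /= mulrC => /nzdx ->; rewrite scale0r.
by exists h'.
Qed.

Lemma socle_mod_nzd : exists2 s : R, ~ line (x : R^o) s &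
  forall a, a \in m -> line (x : R^o) (a * s).
Proof.
apply: (socle_of_radical noethR (is_submod_line _)); last exact: radical_nzd.
move=> [c _]; rewrite /GRing.scale /= => cx.
by have := max_ideal1 localR; rewrite -cx (max_idealM c xm).
Qed.

(* [R/m] embeds into [R/x], whose projective dimension is one. *)
Lemma lifts_cyclic_socle i : lifts_cyclic i.+2 -> lifts_socle i.+1.
Proof.
move=> lift e e0 me; have [s ns ms] := socle_mod_nzd.
have sx := is_submod_line (x : R^o); have xx := line_id (x : R^o).
have [c xcs|g [xg sg]] := injective_extend (@injE i.+2) (t := s) (e := e) sx.
  exact/me/(socle_coeff sx ns).
have [|||a|g' g'E Jg'] := lift (addm (line (x : R^o)) (line (s : R^o))) (d i.+2 g).
- exact/is_submod_add/is_submod_line.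
- exact: addm_subl (is_submod_line _) _ xx.
- exact: resolution_dd.
- move=> [y [_ [xy [c _ <-] ->]]].
  rewrite scalerDl -!linearZ /= (xg y xy) linear0 add0r.
  by rewrite -[c *: (s : R^o)]/(c * s) -scalerA sg linearZ /= e0 scaler0.
have [f fE] : exists f, d i.+1 f = g - g'.
  by apply: resolution_ker; rewrite linearB g'E subrr.
have xg' : x *: g' = 0 by apply: Jg'; exact: addm_subl (is_submod_line _) _ xx.
have sg' : s *: g' = 0 by apply: Jg'; exact: addm_subr sx _ (line_id _).
(* [x *: f] is the boundary of some [h]. Dividing [h] by [x] corrects [f] to an element killed by
   [x]; its multiple by [s] is then killed by [m]. *)
have [h hE] : exists h, d i h = x *: f.
  by apply: resolution_ker; rewrite linearZ /= fE scalerBr (xg _ xx) xg' subrr.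
have [h' h'E] := nzd_injective_divisible h.
have xf' : x *: (f - d i h') = 0 by rewrite scalerBr -linearZ /= h'E hE subrr.
exists (s *: (f - d i h')).
  by rewrite linearZ linearB /= resolution_dd subr0 fE scalerBr sg sg' subr0.
move=> a /ms[c _ cE]; rewrite scalerA -cE -[c *: (x : R^o)]/(c * x).
by rewrite -scalerA xf' scaler0.
Qed.

(** Descent from the end of the resolution: each round passes from the residue field to cyclic
    modules, and back in the degree below. *)
Lemma lifts_cyclic1 : lifts_cyclic 1.
Proof.
apply: lifts_socle_cyclic.
have large i : (n <= i)%N -> lifts_socle i.
  move=> ni e e0 me; exists 0; last by move=> a _; rewrite scaler0.
  by rewrite [e](Elarge _) // linear0.
suff H j i : (i + j = n)%N -> lifts_socle i.+1 by exact: (H n 0%N).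
elim: j i => [|j IH] i; first by rewrite addn0 => ->; apply: large.
rewrite addnS -addSn => /IH/lifts_socle_cyclic; exact: lifts_cyclic_socle.
Qed.

(* If [q K] is contained in [x K], every map [R -> K] extends along [R -> R + R (q/x)]; but
   [Ext^1(R + R (q/x), K) = 0] and [Ext^1(R/m, K) <> 0] forbid this unless [q/x] is in [R]. *)
Lemma faithful_resolution (t : K) : nzd_on K x -> col_max K m x t -> ~ multiples K x t ->
  forall q : R, (forall k : K, multiples K x (q *: k)) -> exists c, q = x * c.
Proof.
move=> nzdK tcol nt.
(* A general [q] is replaced by an element of [R x + R q] that is in the socle modulo [R x]. *)
suff H (q : R) : (forall a, a \in m -> exists b, a * q = x * b) ->
    (forall k : K, multiples K x (q *: k)) -> exists c, q = x * c.
  move=> q qK; apply: contrapT => nq.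
  have nxq : ~ line (x : R^o) q by move=> [c _ cE]; apply: nq; exists c; rewrite -cE mulrC.
  have sx := is_submod_line (x : R^o).
  have [N lN] := finite_length_nzd noethR localR dimR nzdx sx (line_id (x : R^o)).
  have [|q' [[_ [_ [[b _ <-] [c _ <-] q'E]]] nq' mq']] :=
    socle_of_lenle noethR localR sx nxq (n := N).
    exact: lenle_sub lN.
  have [a am|k|c' c'E] := H q'.
  - have [b' _ b'E] := mq' a am; exists b'; exact: etrans (esym b'E) (mulrC _ _).
  - rewrite q'E -[b *: (x : R^o)]/(b * x) -[c *: (q : R^o)]/(c * q) scalerDl.
    apply: submodD; [exact: is_submod_multiples| |].
      by exists (b *: k) => //; rewrite scalerA mulrC.
    by rewrite -scalerA; apply: submodZ => //; apply: is_submod_multiples.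
  by apply: nq'; exists c' => //; rewrite c'E mulrC.
move=> mq qK; apply: contrapT => nq.
have sx := is_submod_line (x : R^o); have xx := line_id (x : R^o).
have nxq : ~ line (x : R^o) q by move=> [c _ cE]; apply: nq; exists c; rewrite -cE mulrC.
have deps k : d 0 (eps k) = 0.
  by have : [set y | d 0 y = 0] (eps k) by rewrite -exact0; exists k.
have kerd y : d 0 y = 0 -> exists k, eps k = y.
  by move=> y0; have : [set y | d 0 y = 0] y by []; rewrite -exact0 => -[k _ <-]; exists k.
(* [phi] divides [a *: t] by [x]. It is a map [m -> K] that does not extend to [R], and [d 0 u]
   below represents the obstruction in [Ext^1(R/m, K)]. *)
have /choice[phi phiE] : forall a : R, exists k, a \in m -> a *: t = x *: k.
  move=> a; case: (boolP (a \in m)) => [am|_]; last by exists 0.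
  by have [k _ kE] := tcol a am; exists k.
have [a b c bm cm|u uE] :=
  injective_ideal (@injE 0) (phi := fun a => eps (phi a)) (is_submod_mem m).
  rewrite -linearP; congr (eps _); apply: (nzd_onI nzdK).
  rewrite -phiE; last exact: (proj2 (is_submod_mem m)).
  by rewrite scalerDr !scalerA [x * a]mulrC -scalerA -!phiE // scalerDl scalerA.
have me1 a : a \in m -> a *: d 0 u = 0.
  by move=> am; rewrite -linearZ /= -uE // deps.
have nsoc f : d 0 f = d 0 u -> ~ forall a, a \in m -> a *: f = 0.
  move=> fE mf; have [k kE] : exists k, eps k = u - f.
    by apply: kerd; rewrite linearB fE subrr.
  apply: nt; exists k => //; apply: epsI.
  rewrite linearZ /= kE scalerBr mf // subr0 -uE //.
  by congr (eps _); apply: (nzd_onI nzdK); rewrite phiE.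
have [c xcq|g [xg qg]] := injective_extend (@injE 1) (t := q) (e := d 0 u) sx.
  exact/me1/(socle_coeff sx nxq).
have [|||a|g' g'E Jg'] := @lifts_cyclic1 (addm (line (x : R^o)) (line (q : R^o))) (d 1 g).
- exact/is_submod_add/is_submod_line.
- exact: addm_subl (is_submod_line _) _ xx.
- exact: resolution_dd.
- move=> [y [_ [xy [c _ <-] ->]]].
  rewrite scalerDl -!linearZ /= (xg y xy) linear0 add0r.
  by rewrite -[c *: (q : R^o)]/(c * q) -scalerA qg linearZ /= resolution_dd scaler0.
have [u' u'E] : exists u', d 0 u' = g - g'.
  by apply: resolution_ker; rewrite linearB g'E subrr.
have xg' : x *: g' = 0 by apply: Jg'; exact: addm_subl (is_submod_line _) _ xx.
have qg' : q *: g' = 0 by apply: Jg'; exact: addm_subr sx _ (line_id _).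
have [k0 k0E] : exists k0, eps k0 = x *: u'.
  by apply: kerd; rewrite linearZ /= u'E scalerBr (xg _ xx) xg' subrr.
(* Here [q K] inside [x K] enters: [k1] is [(q/x) k0], and subtracting it from [q *: u'] gives a
   forbidden lift of [d 0 u] killed by [m]. *)
have [k1 _ k1E] := qK k0.
apply: (nsoc (q *: u' - eps k1)).
  by rewrite linearB linearZ /= u'E deps subr0 scalerBr qg qg' subr0.
move=> a am; have [b bE] := mq a am.
rewrite scalerBr scalerA bE mulrC -scalerA -k0E -!linearZ /= -linearB.
rewrite [b *: k0 - _](_ : _ = 0) ?linear0 //; apply/eqP; rewrite subr_eq0; apply/eqP.
apply: (nzd_onI nzdK).
by rewrite scalerA -bE -scalerA -k1E !scalerA mulrC.
Qed.

End FiniteInjectiveDimension.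

(** * Powers of an ideal and principal reductions *)

Lemma mulr_regularZ (R : comNzRingType) (a x : R) (y : R^o) :
  x * (a *: y) = a *: (x * y : R^o).
Proof. exact: mulrCA. Qed.

Definition mulset (R : comNzRingType) (x : R) (A : set R^o) : set R^o :=
  (fun y : R^o => x * y : R^o) @` A.

Lemma is_submod_mulset (R : comNzRingType) (x : R) (A : set R^o) :
  is_submod A -> is_submod (mulset x A).
Proof.
move=> [A0 sA]; split; first by exists 0; rewrite ?mulr0.
move=> a _ _ [u Cu <-] [v Cv <-]; exists (a *: u + v); first exact: sA.
by rewrite mulrDr mulr_regularZ.
Qed.

Section IdealPowers.
Variables (R : comNzRingType) (m I : ideal R).

Definition pow (n : nat) : set R^o := [set a | a \in ideal_exp I n].
(** [pow n] modulo [max_pow n] is the degree [n] part of the fiber cone of [I]. *)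
Definition max_pow (n : nat) : set R^o := [set a | a \in mulI m (ideal_exp I n)].

Lemma is_submod_pow n : is_submod (pow n). Proof. exact: is_submod_mem. Qed.
Lemma is_submod_max_pow n : is_submod (max_pow n). Proof. exact: is_submod_mem. Qed.

Lemma pow0 a : pow 0 a. Proof. exact: mem_full. Qed.

Lemma powS a b n : a \in I -> pow n b -> pow n.+1 (a * b).
Proof. by move=> aI bn; apply: mem_gen; exists a, b. Qed.

Lemma pow_ideal n a b : pow n b -> pow n (a * b).
Proof. exact: (submodZ a (is_submod_pow n)). Qed.

Lemma powM n k a b : pow n a -> pow k b -> pow (n + k) (a * b).
Proof.
elim: n a => [|n IH] a an bk; first exact: pow_ideal.
move: a an; apply: gen_ind; last first.
  by move=> _ [c [x [cI xn ->]]]; rewrite /GRing.scale /= -mulrA; apply: powS => //; apply: IH.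
split; first by rewrite mul0r; case: (is_submod_pow (n.+1 + k)).
by move=> a x y Px Py; rewrite mulrDl -scalerAl; apply: (proj2 (is_submod_pow _)).
Qed.

Lemma pow_subS n : pow n.+1 `<=` pow n.
Proof.
move=> a; rewrite -addn1 addnC.
apply: (gen_ind (P := pow n)); first exact: is_submod_pow.
by move=> _ [c [x [cI xn ->]]]; apply: pow_ideal.
Qed.

Lemma powX h x j : pow h x -> pow (h * j) (x ^+ j).
Proof.
move=> hx; elim: j => [|j IH]; first by rewrite muln0; apply: pow0.
by rewrite exprS mulnS; apply: powM.
Qed.

Lemma powD_ind n k (Z : set R^o) : is_submod Z ->
  (forall a b, pow n a -> pow k b -> Z (a * b)) -> pow (n + k) `<=` Z.
Proof.
elim: n Z => [|n IH] Z sZ Zab.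
  by move=> b bk; rewrite -[b]mul1r; apply: Zab => //; apply: pow0.
apply: (gen_ind (P := Z)) => // _ [c [y [cI yn ->]]].
apply: (IH [set y | Z (c * y)]) yn; last first.
  by move=> a b an bk; rewrite /mkset mulrA; apply: Zab => //; apply: powS.
split; first by rewrite /mkset mulr0; case: sZ.
by move=> a u v Zu Zv; rewrite /mkset mulrDr mulr_regularZ; apply: (proj2 sZ).
Qed.

Lemma max_powM a n b : a \in m -> pow n b -> max_pow n (a * b).
Proof. by move=> am bn; apply: mem_gen; exists a, b. Qed.

Lemma max_pow_sub n : max_pow n `<=` pow n.
Proof.
apply: (gen_ind (P := pow n)); first exact: is_submod_pow.
by move=> _ [c [x [_ xn ->]]]; apply: pow_ideal.
Qed.

Lemma max_pow_mul k n a b : pow k a -> max_pow n b -> max_pow (k + n) (a * b).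
Proof.
move=> ak; move: b; apply: (gen_ind (P := fun b => max_pow (k + n) (a * b))); last first.
  move=> _ [c [y [cm yn ->]]]; rewrite /GRing.scale /= mulrCA.
  by apply: max_powM => //; apply: powM.
split; first by rewrite mulr0; case: (is_submod_max_pow (k + n)).
by move=> c u v Zu Zv; rewrite mulrDr mulr_regularZ; apply: (proj2 (is_submod_max_pow _)).
Qed.

Lemma pow_sub_max_pow n : {subset I <= m} -> pow n.+1 `<=` max_pow n.
Proof.
move=> Im; apply: (gen_ind (P := max_pow n)); first exact: is_submod_max_pow.
by move=> _ [c [y [cI yn ->]]]; apply: max_powM => //; apply: Im.
Qed.

(** The degree [n] part of the [x]-power torsion of the fiber cone, for [x] of degree [h]. *)
Definition pow_torsion (x : R) (h n : nat) : set R^o :=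
  [set y | pow n y /\ exists j, max_pow (n + h * j) (x ^+ j * y)].

Lemma pow_torsion_shift x h n j i y : pow h x ->
  max_pow (n + h * j) (x ^+ j * y) -> max_pow (n + h * (i + j)) (x ^+ (i + j) * y).
Proof.
move=> hx xy; rewrite exprD -mulrA mulnDr addnCA.
by apply: max_pow_mul => //; apply: powX.
Qed.

Lemma is_submod_pow_torsion x h n : pow h x -> is_submod (pow_torsion x h n).
Proof.
move=> hx; split.
  split; first by case: (is_submod_pow n).
  by exists 0%N; rewrite mulr0; case: (is_submod_max_pow (n + h * 0)).
move=> a u v [un [i xu]] [vn [j xv]]; split; first exact: (proj2 (is_submod_pow n)).
exists (i + j)%N; rewrite mulrDr mulr_regularZ; apply: (proj2 (is_submod_max_pow _)).
  by rewrite [(i + j)%N]addnC; apply: pow_torsion_shift.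
exact: pow_torsion_shift.
Qed.

Lemma max_pow_sub_torsion x h n : max_pow n `<=` pow_torsion x h n.
Proof.
move=> y my; split; first exact: max_pow_sub.
by exists 0%N; rewrite expr0 mul1r muln0 addn0.
Qed.

(** In the fiber cone [x * y] is zero, so every cross term vanishes. *)
Lemma orthogonal_power n x y j : pow n x -> pow n y -> max_pow (n + n) (x * y) ->
  max_pow (n * j.+1) ((x + y) ^+ j * x - x ^+ j.+1).
Proof.
move=> xn yn xy; elim: j => [|j IH].
  by rewrite expr0 mul1r expr1 subrr; case: (is_submod_max_pow (n * 1)).
have -> : (x + y) ^+ j.+1 * x - x ^+ j.+2 =
    (x + y) * ((x + y) ^+ j * x - x ^+ j.+1) + x ^+ j * (x * y).
  by rewrite !exprS; ring.
apply: (submodD (is_submod_max_pow _)).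
  rewrite mulnS; apply: max_pow_mul => //.
  exact: (submodD (is_submod_pow n)).
have -> : (n * j.+2 = n * j + (n + n))%N by lia.
by apply: max_pow_mul => //; apply: powX.
Qed.

End IdealPowers.

Lemma prod_pred1 (R : comNzRingType) (y : R) (t : seq R) :
  all (pred1 y) t -> \prod_(z <- t) z = y ^+ size t.
Proof.
elim: t => [|z t IH] /=; first by rewrite big_nil.
by case/andP => /eqP-> /IH e; rewrite big_cons e exprS.
Qed.

Lemma nat_max (Q : nat -> Prop) N : Q 0%N -> (forall k, Q k -> (k <= N)%N) ->
  exists2 k, Q k & forall l, Q l -> (l <= k)%N.
Proof.
move=> Q0; elim: N => [|N IH] QN; first by exists 0%N.
case: (pselect (Q N.+1)) => [QS|nQ]; first by exists N.+1.
apply: IH => k Qk; have := QN k Qk; rewrite leq_eqVlt => /orP[/eqP kN|//].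
by case: nQ; rewrite -kN.
Qed.

(** * A homogeneous parameter of the fiber cone *)

Section PrincipalReduction.
Variables (R : comNzRingType) (m I : ideal R).
Hypotheses (noethR : noetherian R) (localR : local_ring m).
Variables (n0 E : nat).
Hypothesis bound : forall n, (n0 <= n)%N -> lenle (max_pow m I n) (pow I n) E.
Local Notation P := (pow I).
Local Notation mP := (max_pow m I).
Local Notation L := (pow_torsion m I).

(** [k] bounds from below the length, in degree [n], of the fiber cone modulo its [x]-torsion. That
    [h] divides [n] lets degrees be matched with powers of [x]. *)
Definition chain_above (k : nat) (x : R) (h n : nat) : Prop :=
  [/\ (0 < h)%N, P h x, (h %| n)%N, (n0 <= n)%N & exists2 D, hc (L x h n) k D & D `<=` P n].

Lemma chain_above_shift k x h n : chain_above k x h n ->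
  [/\ (0 < h)%N, P h x, (h %| n + h)%N, (n0 <= n + h)%N &
    exists2 D, hc (L x h (n + h)) k D & D `<=` addm (mulset x (P n)) (L x h (n + h))].
Proof.
move=> [h0 hx hn n0n [D hD DP]]; split=> //.
- by rewrite dvdn_add.
- exact: leq_trans (leq_addr _ _).
have sL := is_submod_pow_torsion m (n + h) hx.
pose F (C : set R^o) : set R^o := addm (mulset x C) (L x h (n + h)).
have Lx y : P n y -> L x h (n + h) (x * y) -> L x h n y.
  move=> yn [_ [j xy]]; split=> //; exists j.+1.
  by rewrite exprSr -mulrA mulnS addnA.
exists (F D); last first.
  move=> _ [_ [z [[y Dy <-] Lz ->]]]; exists (x * y), z; split=> //.
  by exists y => //; apply: DP.
apply: (@hc_narrow _ _ (F (L x h n))); first exact/addm_subr/is_submod_mulset/is_submod_pow_torsion.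
apply: (hc_map (B := P n)) => //; last exact: is_submod_pow_torsion.
  by move=> C sC _ _; apply: is_submod_add => //; apply: is_submod_mulset.
move=> C C' sC sC' LC CP [CC' nCC']; split.
  by move=> _ [_ [z [[y Cy <-] Lz ->]]]; exists (x * y), z; split=> //; exists y => //; apply: CC'.
move=> FF; apply: nCC' => d Cd.
have [_ [z [[c Cc <-] Lz xdE]]] := FF (x * d) (addm_subl sL (ex_intro2 _ _ d Cd (erefl _))).
rewrite -[d](subrK c); apply: submodD => //; apply: LC; apply: Lx.
  apply: submodB; [exact: is_submod_pow|exact: CP|exact/CP/CC'].
by rewrite mulrBr xdE addrAC subrr add0r.
Qed.

Lemma chain_above_shiftn k x h n i : chain_above k x h n -> chain_above k x h (n + h * i).
Proof.
move=> c; elim: i => [|i IH]; first by rewrite muln0 addn0.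
have [h0 hx hn n0n [D hD DP]] := chain_above_shift IH.
rewrite mulnS [(h + _)%N]addnC addnA; split=> //; exists D => // y /DP[_ [z [[w Pw <-] [Pz _] ->]]].
apply: (submodD (is_submod_pow I _)) => //.
by rewrite [(_ + h)%N]addnC; apply: powM.
Qed.

Definition power_torsion_nil x h N := forall l, L x h N l -> exists p, mP (N * p) (l ^+ p).

(* Choose [x] with the longest chain above its torsion. A non-nilpotent torsion element [l]
   would give a better choice: a suitable sum of powers of [x] and [l], whose cross terms
   vanish. *)
Lemma maximal_chain : {subset I <= m} -> exists x h n, [/\ (0 < h)%N, P h x, (h %| n)%N,
  P (n + h) `<=` addm (mulset x (P n)) (L x h (n + h)) &
  power_torsion_nil x h (n + h)].
Proof.
move=> Im.
have [|k [x [h [n c]]]|k [x [h [n c]]] kmax] :=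
  nat_max (Q := fun k => exists x h n, chain_above k x h n) (N := E).
- exists 0, 1%N, n0; split=> //; first by case: (is_submod_pow I 1).
  exists (P n0) => //; apply: hc0; first exact: is_submod_pow.
  by move=> y [].
- have [_ hx _ n0n [D hD DP]] := c; apply: (bound n0n) DP.
  by apply: hc_narrow hD; apply: max_pow_sub_torsion.
have [h0 hx hn n0n _] := c; exists x, h, n; split=> //.
  (* The shifted chain ends inside [x P n + L]. Were this smaller than [P (n + h)], the latter could
     be added on top. *)
  have [_ _ hn' n0n' [D hD DL]] := chain_above_shift c.
  apply: contrapT => nP.
  have sub : addm (mulset x (P n)) (L x h (n + h)) `<=` P (n + h).
    apply: addm_sub; [exact: is_submod_pow| |by move=> y []].
    by move=> _ [y Py <-]; rewrite addnC; apply: powM.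
  suff /kmax : exists x h n, chain_above k.+1 x h n by rewrite ltnn.
  exists x, h, (n + h)%N; split=> //; exists (P (n + h)) => //.
  apply: hcS hD (is_submod_pow I _) _; split; first exact: subset_trans sub.
  by move=> PD; apply: nP; apply: subset_trans PD DL.
move=> l Ll; apply: contrapT => nnil; have [Pl [J0 xl]] := Ll.
set N := (n + h)%N in Ll nnil Pl xl.
have [a Na a0] : exists2 a, N = (h * a)%N & (0 < a)%N.
  have /dvdnP[a Na] : (h %| N)%N by rewrite dvdn_addl.
  by exists a; [rewrite Na mulnC|rewrite lt0n; apply/eqP => a0; move: Na; rewrite a0 /N; lia].
(* The successor keeps [J] positive and gives [l ^+ J] a factor [l] to pair with [x ^+ J]. The
   exponents make [x'] and [l'] both of degree [M]. *)
pose J := J0.+1.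
have xJl : mP (N + h * J) (x ^+ J * l) by rewrite /J -add1n; apply: pow_torsion_shift.
pose M := (N * J)%N; pose x' := x ^+ (a * J); pose l' := l ^+ J.
have M0 : (0 < M)%N by rewrite /M Na /J !muln_gt0 h0 a0.
have MaJ : M = (h * (a * J))%N by rewrite /M Na mulnA.
have Px' : P M x' by rewrite MaJ; apply: powX.
have Pl' : P M l' by apply: powX.
have xl' : mP (M + M) (x' * l').
  have -> : x' * l' = (x ^+ (a * J - J) * l ^+ J0) * (x ^+ J * l).
    have -> : x' = x ^+ (a * J - J) * x ^+ J by rewrite -exprD subnK // leq_pmull.
    have -> : l' = l ^+ J0 * l by rewrite /l' /J exprSr.
    ring.
  have -> : (M + M = (h * (a * J - J) + N * J0) + (N + h * J))%N.
    by rewrite {1}MaJ mulnBr /M /J mulnS; nia.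
  by apply: max_pow_mul => //; apply: powM; apply: powX.
pose z := x' + l'.
have Pz : P M z by apply: (submodD (is_submod_pow I M)).
have zx j := orthogonal_power j Px' Pl' xl'.
have zl j : mP (M * j.+1) (z ^+ j * l' - l' ^+ j.+1).
  by rewrite /z [x' + l']addrC; apply: orthogonal_power => //; rewrite mulrC.
(* [z] acts on [x'] as [x'] does, so torsion for [z] is torsion for [x]. *)
have Lz n' : L z M n' `<=` L x h n'.
  move=> y [Py [j zy]]; split=> //; exists (a * J * j.+1)%N.
  have -> : x ^+ (a * J * j.+1) * y = x' * (z ^+ j * y) - (z ^+ j * x' - x' ^+ j.+1) * y.
    by rewrite exprM -/x'; ring.
  have -> : (n' + h * (a * J * j.+1) = M * j.+1 + n')%N by rewrite mulnA -MaJ addnC.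
  apply: (submodB (is_submod_max_pow m I _)).
    have -> : (M * j.+1 + n' = M + (n' + M * j))%N by rewrite mulnS; lia.
    exact: max_pow_mul.
  by rewrite mulrC addnC; apply: max_pow_mul.
(* A degree at least [n] and congruent to it modulo [h]. In it [l' ^+ n.+1] is torsion for [x] but
   not for [z], which adds a step at the bottom of the chain. *)
pose n' := (M * n.+1)%N.
have [i n'E] : exists i, n' = (n + h * i)%N.
  have /dvdnP[b nb] := hn.
  exists (a * J * n.+1 - b)%N.
  rewrite mulnBr [(h * b)%N]mulnC -nb mulnA -MaJ -/n' subnKC //.
  exact: leq_trans (leqnSn n) (leq_pmull _ M0).
have [_ _ hn' n0n' [D hD DP]] := chain_above_shiftn i c.
rewrite -n'E in hn' n0n' hD DP.
suff /kmax : exists x h n, chain_above k.+1 x h n by rewrite ltnn.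
exists z, M, n'; split=> //; first exact: dvdn_mulr.
exists D => //; rewrite -addn1; apply: hc_cat hD.
apply: (@hcS _ _ _ 0 (L z M n')); last 2 first.
- exact: is_submod_pow_torsion.
- split=> // sub.
  have Pl1 : P n' (l' ^+ n.+1) by apply: powX.
  have [|_ [j]] := sub (l' ^+ n.+1).
    split=> //; exists (a * J)%N; rewrite -/x' -MaJ exprS mulrA mulrC.
    have -> : (n' + M = M * n + (M + M))%N by rewrite /n' mulnS; lia.
    by apply: max_pow_mul => //; apply: powX.
  rewrite exprS mulrA => zl1; apply: nnil; exists (J * (j.+1 + n))%N.
  have -> : l ^+ (J * (j.+1 + n)) =
      z ^+ j * l' * l' ^+ n - l' ^+ n * (z ^+ j * l' - l' ^+ j.+1).
    by rewrite exprM -/l' exprD; ring.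
  have -> : (N * (J * (j.+1 + n)) = M * n + M * j.+1)%N by rewrite /M; lia.
  apply: (submodB (is_submod_max_pow m I _)); last by apply: max_pow_mul => //; apply: powX.
  by have -> : (M * n + M * j.+1 = n' + M * j)%N by rewrite /n'; lia.
by apply: hc0 => //; apply: is_submod_pow_torsion.
Qed.

Section NilpotentGenerators.
Variables (x : R) (h n : nat).
Let N := (n + h)%N.

(** The degree [N * p.+1] part of the ideal of the fiber cone generated by [x]: the factor [x] has
    degree [h], and [N = n + h]. *)
Definition pow_mod (p : nat) : set R^o :=
  addm (mulset x (P (N * p + n))) (mP (N * p.+1)).

Lemma is_submod_pow_mod p : is_submod (pow_mod p).
Proof.
apply: is_submod_add; last exact: is_submod_max_pow.
exact/is_submod_mulset/is_submod_pow.
Qed.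

Lemma pow_modM j p a u : P (N * j) a -> pow_mod p u -> pow_mod (j + p) (a * u).
Proof.
move=> Pa [_ [v [[w Pw <-] mv ->]]]; exists (x * (a * w)), (a * v); split.
- by exists (a * w) => //; rewrite mulnDr -addnA; apply: powM.
- by rewrite -addnS mulnDr; apply: max_pow_mul.
- by rewrite mulrDr mulrCA.
Qed.

Lemma pow_mod_nil y : P N `<=` addm (mulset x (P n)) (L x h N) ->
  power_torsion_nil x h N -> P N y -> exists p, pow_mod p (y ^+ p.+1).
Proof.
move=> PN nil Py; have [_ [l [[w Pw <-] Ll yE]]] := PN y Py.
have [Pl _] := Ll; have [p lp] := nil l Ll; exists p.
have [v Pv ->] : exists2 v, P (N * p + n) v & y ^+ p.+1 = x * v + l ^+ p.+1.
  elim: (p) => [|q [v Pv e]]; first by exists w; rewrite // muln0 add0n.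
  exists (y * v + l ^+ q.+1 * w).
    apply: (submodD (is_submod_pow I _)).
      by rewrite mulnS -addnA; apply: powM.
    by apply: powM => //; apply: powX.
  by rewrite exprS e mulrDr {2}yE [l ^+ q.+2]exprS; ring.
exists (x * v), (l ^+ p.+1); split=> //; first by exists v.
by rewrite mulnS exprS; apply: max_pow_mul.
Qed.

Lemma pow_prod t : (forall y, y \in t -> P N y) -> P (N * size t) (\prod_(z <- t) z).
Proof.
elim: t => [|y t IH] Pt; first by rewrite muln0; apply: pow0.
rewrite big_cons mulnS; apply: powM; first exact/Pt/mem_head.
by apply: IH => z zt; apply: Pt; rewrite inE zt orbT.
Qed.

(** Pigeonhole: either [y] occurs at least [p.+1] times in [t], or more than [q0] factors are other
    generators. *)
Lemma pow_mod_monomials (s : seq R) : (forall y, y \in s -> P N y) ->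
  (forall y, y \in s -> exists p, pow_mod p (y ^+ p.+1)) ->
  exists q, forall t : seq R, all (mem s) t -> size t = q.+1 -> pow_mod q (\prod_(z <- t) z).
Proof.
elim: s => [|y s IH] Ps nil; first by exists 0%N => -[].
have [z zs|z zs|q0 qE] := IH; first by apply: Ps; rewrite inE zs orbT.
  by apply: nil; rewrite inE zs orbT.
have [p pE] := nil y (mem_head _ _); exists (p + q0)%N => t ts st.
pose t1 := filter (pred1 y) t; pose t2 := filter (predC (pred1 y)) t.
have pt : perm_eq t (t1 ++ t2) by rewrite perm_sym; apply/permPl/perm_filterC.
have st12 : (size t1 + size t2 = (p + q0).+1)%N by rewrite -size_cat -(perm_size pt).
have PN u : {subset u <= t} -> forall z, z \in u -> P N z.
  by move=> ut z /ut zt; apply: Ps; move/allP: ts; apply.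
have t1t : {subset t1 <= t} by move=> z; rewrite mem_filter => /andP[].
have t2t : {subset t2 <= t} by move=> z; rewrite mem_filter => /andP[].
rewrite (perm_big _ pt) big_cat /=.
have [le|lt] := leqP p.+1 (size t1).
  rewrite (prod_pred1 (filter_all (pred1 y) t)) -/t1.
  have -> : y ^+ size t1 = y ^+ (size t1 - p.+1) * y ^+ p.+1 by rewrite -exprD subnK.
  have -> : (p + q0 = (size t1 - p.+1 + size t2) + p)%N by lia.
  rewrite mulrAC; apply: pow_modM => //.
  rewrite mulnDr; apply: powM; last exact/pow_prod/PN.
  by apply: powX; apply: Ps; apply: mem_head.
have le2 : (q0.+1 <= size t2)%N by lia.
rewrite -(cat_take_drop q0.+1 t2) big_cat /= [X in _ * X]mulrC mulrA.
have -> : (p + q0 = (size t1 + size (drop q0.+1 t2)) + q0)%N by rewrite size_drop; lia.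
apply: pow_modM.
  rewrite mulnDr; apply: powM; apply: pow_prod; apply: PN => //.
  by move=> z /mem_drop/t2t.
apply: qE; last by rewrite size_takel.
apply/allP => z /mem_take; rewrite mem_filter /= => /andP[zy zt].
by move/allP: ts => /(_ z zt); rewrite /= inE (negPf zy).
Qed.

Lemma pow_monomials_ind (s : seq R) k (Z : set R^o) : is_submod Z ->
  (forall y, P N y <-> y \in gen [set` (s : seq R^o)]) ->
  (forall t : seq R, all (mem s) t -> size t = k -> Z (\prod_(z <- t) z)) -> P (N * k) `<=` Z.
Proof.
move=> + sE; elim: k Z => [|k IH] Z sZ Zt.
  move=> a _; have /(submodZ a sZ) := Zt [::] isT (erefl _).
  by rewrite big_nil /GRing.scale /= mulr1.
rewrite mulnS; apply: powD_ind => // a b /sE + Pb; move: a.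
apply: (gen_ind (P := fun a => Z (a * b))).
  split; first by rewrite mul0r; case: sZ.
  by move=> c u v Zu Zv; rewrite mulrDl -scalerAl; apply: (proj2 sZ).
move=> y ys; apply: (IH [set b | Z (y * b)]) Pb.
  split; first by rewrite /mkset mulr0; case: sZ.
  by move=> c u v Zu Zv; rewrite /mkset mulrDr mulr_regularZ; apply: (proj2 sZ).
move=> t ts st; rewrite /mkset; have := Zt (y :: t).
by rewrite big_cons /= ts st andbT; apply.
Qed.

End NilpotentGenerators.

Lemma principal_reduction : {subset I <= m} -> exists p xi,
  [/\ (0 < p)%N, P p xi & P (p + p) `<=` mulset xi (P p)].
Proof.
move=> Im; have [x [h [n [h0 hx hn PN nil]]]] := maximal_chain Im.
pose N := (n + h)%N.
have [s sE] := noeth_fg noethR (is_submod_pow I N).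
have [y ys|y ys|q qE] := @pow_mod_monomials x h n s.
- by apply/sE; apply: mem_gen.
- by apply: pow_mod_nil => //; apply/sE; apply: mem_gen.
have PZ := pow_monomials_ind (is_submod_pow_mod x h n q) sE qE.
pose k0 := (N * q + n)%N.
have Nq : (N * q.+1 = h + k0)%N by rewrite /k0 /N mulnS; lia.
(* In this degree everything is divisible by [x] modulo [m], and Nakayama's lemma removes the
   error. *)
have red0 : P (h + k0) `<=` mulset x (P k0).
  have [u uE] := noeth_fg noethR (is_submod_pow I (h + k0)).
  apply: (nakayama noethR localR _ uE); first exact/is_submod_mulset/is_submod_pow.
  rewrite -Nq => y /PZ[w [v [xw mv ->]]]; exists w, v; split=> //.
  move: v mv; apply: (gen_ind (P := fun v => v \in _)); first exact: is_submod_mem.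
  move=> _ [a [b [am bP ->]]]; apply: mem_gen; exists a, b; split=> //.
  by apply: mem_gen.
have red k : (k0 <= k)%N -> P (h + k) `<=` mulset x (P k).
  move=> k0k; rewrite -(subnKC k0k) addnA; apply: powD_ind.
    exact/is_submod_mulset/is_submod_pow.
  move=> a b /red0[w Pw <-] Pb; exists (w * b); first exact: powM.
  by rewrite mulrA.
have redj j k : (k0 <= k)%N -> P (h * j + k) `<=` mulset (x ^+ j) (P k).
  move=> k0k; elim: j => [|j IH].
    by rewrite muln0 add0n => y Py; exists y => //; rewrite expr0 mul1r.
  rewrite mulnS -addnA => y /red[|w /IH[v Pv <-] <-].
    by apply: leq_trans k0k _; apply: leq_addl.
  by exists v => //; rewrite exprS mulrA.
(* The exponent [h * k0.+1] is positive and at least [k0], as [redj] requires. *)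
exists (h * k0.+1)%N, (x ^+ k0.+1); split; first by rewrite muln_gt0 h0.
  exact: powX.
apply: redj; nia.
Qed.

End PrincipalReduction.

(** * From almost Gorenstein to the trace *)

Lemma linear_inverse (R : comNzRingType) (U V : lmodType R) (f : {linear U -> V}) :
  bijective f -> exists2 g : {linear V -> U}, cancel f g & cancel g f.
Proof.
case=> g fK gK; have gl : linear g.
  by move=> a x y; apply: (can_inj fK); rewrite linearP !gK.
by exists (mklin gl).
Qed.

Section RegularElements.
Variables (R : comNzRingType).
Implicit Types (x : R) (A B : set R^o).

Lemma nzd_on_mul x y : nzd_on R^o x -> nzd_on R^o y -> nzd_on R^o (x * y).
Proof. by move=> nx ny z; rewrite -scalerA => /nx/ny. Qed.

Lemma nzd_on_exp x k : nzd_on R^o x -> nzd_on R^o (x ^+ k).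
Proof.
move=> nx; elim: k => [|k IH]; first by move=> z; rewrite scale1r.
by rewrite exprS; apply: nzd_on_mul.
Qed.

Lemma nzd_on_dvd x y z : nzd_on R^o x -> x = y * z -> nzd_on R^o y.
Proof. by move=> nx e w yw; apply: nx; rewrite e mulrC -scalerA yw scaler0. Qed.

Lemma len_mulset x A B k : nzd_on R^o x -> is_submod A -> is_submod B -> A `<=` B ->
  len A B k -> len (mulset x A) (mulset x B) k.
Proof.
move=> nx sA sB AB; suff [] : len A B k <-> len (mulset x A) (mulset x B) k by [].
apply: (@len_corr _ _ _ (fun y : R^o => x * y : R^o)).
- exact: is_submod_mulset.
- by [].
- exact: is_submod_mulset.
- by move=> _ [y /AB By <-]; exists y.
- by move=> a u v _ _; rewrite mulrDr mulr_regularZ.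
- by move=> b Bb; exists b.
- move=> b; split=> [Ab|[_ [a Aa /(nzd_onI nx) <-]]] //.
  by split; [apply: AB|exists b].
- by move=> _ [b Bb <-]; exists b => //; rewrite subrr; case: (is_submod_mulset x sA).
Qed.

Lemma mulset_line x y : mulset x (line (y : R^o)) = line (x * y : R^o).
Proof.
apply/seteqP; split=> [_ [_ [c _ <-] <-]|_ [c _ <-]].
  by exists c => //; rewrite mulr_regularZ.
by exists (c *: (y : R^o)); [exists c|rewrite mulr_regularZ].
Qed.

Lemma mulsetT x : mulset x setT = line (x : R^o).
Proof.
apply/seteqP; split=> [_ [c _ <-]|_ [c _ <-]]; exists c => //; exact: mulrC.
Qed.

Lemma len_line_exp x l k : nzd_on R^o x -> len (line (x : R^o)) setT l ->
  len (line (x ^+ k : R^o)) setT (k * l).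
Proof.
move=> nx lx; elim: k => [|k IH].
  rewrite (_ : line _ = setT) ?mul0n; last first.
    by apply/seteqP; split=> // a _; exists a => //; rewrite /GRing.scale /= mulr1.
  by apply: len_id.
have sx := is_submod_line (x ^+ k : R^o).
have := len_mulset nx sx (@is_submodT _ R^o) (@subsetT _ _) IH.
rewrite mulset_line mulsetT -exprS => lk.
rewrite mulSn addnC; apply: (len_add _ _ _ _ lk lx) => //.
- exact: is_submod_line.
- rewrite exprSr; move=> _ [c _ <-]; exists (c * x ^+ k) => //.
  by rewrite /GRing.scale /= mulrA.
Qed.

End RegularElements.

Section Trace.
Variables (R : comNzRingType) (m : ideal R) (K : lmodType R).

Lemma mem_trace (M : lmodType R) (f : {linear M -> R^o}) y : f y \in trace M.
Proof. by apply: mem_gen; exists f => //; exists y. Qed.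

(** [z] is the value at [y] of the map [w h / xi] from [A] to [R], well defined because [xi] is
    regular. *)
Lemma mem_trace_div (h : {linear K -> R^o}) (A : submodClosed K) (w xi : R) : nzd_on R^o xi ->
  (forall y, y \in A -> exists z, w * h y = xi * z) ->
  forall y z, y \in A -> w * h y = xi * z -> z \in trace (submod A).
Proof.
move=> nxi div y z yA e.
have /choice[f fE] : forall y : submod A, exists z, w * h (val y) = xi * z.
  by case=> u uA; apply: div.
have fl : linear (f : submod A -> R^o).
  move=> a u v; apply: (nzd_onI nxi).
  have e1 : val (a *: u + v) = a *: val u + val v by rewrite linearP.
  rewrite -[LHS]/(xi * f _) -fE e1 linearP /= mulrDr mulr_regularZ !fE.
  by rewrite -[RHS]/(xi * (a * f u + f v)) mulrDr [in RHS]mulrCA.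
have -> : z = mklin fl (Sub y yA).
  by apply: (nzd_onI nxi); rewrite -[LHS]e -[RHS]/(xi * f _) -fE.
exact: mem_trace.
Qed.

End Trace.

Section CanonicalModule.
Variables (R : comNzRingType) (m : ideal R) (K : lmodType R).
Hypotheses (noethR : noetherian R) (localR : local_ring m) (dimR : krull_dim R^o 1).
Hypothesis canK : canonical_module m K.

Lemma type_len (N : lmodType R) x n : x \in m -> nzd_on N x -> type_is m N n ->
  len (multiples N x) (col_max N m x) n.
Proof.
move=> xm nx [P0 [P1 [P2 [d2 [d1 [d0 [[p0 _ _] [d0T e1 e2 ln]]]]]]]].
exact/(ext1_len n xm nx p0 d0T e1 e2).
Qed.

Lemma nonzero_mod_canonical x : x \in m -> nzd_on K x ->
  exists2 t, col_max K m x t & ~ multiples K x t.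
Proof.
move=> xm nxK; have [_ _ type1 _] := canK; have [_ h1] := type_len xm nxK type1.
inversion h1 as [|k C D h sD [CD nDC]]; subst.
apply: contrapT => no; apply: nDC => z Dz; apply: (hc_sub h).
by apply: contrapT => nz; apply: no; exists z.
Qed.

(** A fraction [q / x] that maps [K] into itself lies in [R]. Finite injective dimension enters
    here. *)
Lemma canonical_faithful x q : x \in m -> nzd_on R^o x -> nzd_on K x ->
  (forall k : K, multiples K x (q *: k)) -> exists c, q = x * c.
Proof.
move=> xm nx nxK qK; have [_ _ _ [E [d [eps [n [injE epsI e0 eS El]]]]]] := canK.
have [t colt nt] := nonzero_mod_canonical xm nxK.
exact: (faithful_resolution noethR localR dimR injE epsI e0 eS El xm nx nxK colt nt).
Qed.

Lemma canonical_simple_socle (N0 : lmodType R) (h : {linear K -> N0}) x :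
  x \in m -> nzd_on K x -> nzd_on N0 x -> injective h -> simple_socle m (range h).
Proof.
move=> xm nxK nx hI; have [_ _ type1 _] := canK.
exact: (simple_socle_range xm nx hI (type_len xm nxK type1)).
Qed.

End CanonicalModule.

Section FiniteColength.
Variables (R : comNzRingType) (m : ideal R).
Hypotheses (noethR : noetherian R) (localR : local_ring m).

(** If no power of [x] were in [J], the ideals [J + R x^i] would decrease strictly, since
    [1 - c * x] is a unit. *)
Lemma finite_length_exp (J : set R^o) l x : is_submod J -> lenle J setT l -> x \in m ->
  exists N, J (x ^+ N).
Proof.
move=> sJ lJ xm; apply: contrapT => nN.
have sJx i := is_submod_add sJ (is_submod_line (x ^+ i : R^o)).
suff h k i : hc J k (addm J (line (x ^+ i : R^o))).
  by have := lJ _ _ (h l.+1 0%N) (@subsetT _ _); rewrite ltnn.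
elim: k i => [|k IH] i; first by apply: hc0 => //; apply/addm_subl/is_submod_line.
apply: hcS (IH i.+1) (sJx i) _; split.
  move=> _ [y [_ [Jy [c _ <-] ->]]]; exists y, (c *: (x ^+ i.+1 : R^o)); split=> //.
  by exists (c * x) => //; rewrite exprS -scalerA.
move=> sub; have [y [_ [Jy [c _ <-] e]]] := sub _ (addm_subr sJ (line_id (x ^+ i : R^o))).
have [b bE] := unit_1B noethR localR (max_idealM c xm).
apply: nN; exists i; rewrite -[x ^+ i]mul1r -bE -mulrA; apply: (submodZ b sJ).
rewrite mulrBl mul1r -mulrA -exprS -[c * _]/(c *: (x ^+ i.+1 : R^o)) {1}e addrK.
exact: Jy.
Qed.

End FiniteColength.

Section PowersOfIdeals.
Variables (R : comNzRingType) (m I : ideal R).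

Lemma pow_anti k n : (k <= n)%N -> pow I n `<=` pow I k.
Proof.
elim: n => [|n IH]; first by rewrite leqn0 => /eqP->.
rewrite leq_eqVlt => /orP[/eqP->//|/IH]; apply: subset_trans; exact: pow_subS.
Qed.

Lemma pow1 a : pow I 1 a <-> a \in I.
Proof.
split=> [|aI]; last by rewrite -[a]mulr1; apply: powS => //; apply: pow0.
move: a; apply: (gen_ind (P := fun a => a \in I)); first exact: is_submod_mem.
by move=> _ [c [y [cI _ ->]]]; rewrite /GRing.scale /= mulrC; apply: (rpredZ y).
Qed.

Lemma hilbert_len e1 : hilbert_e1_is I e1 -> exists (e0 : int) n0, forall n, (n0 < n)%N ->
  exists2 l : nat, len (pow I n) setT l & (l%:Z = e0 * n%:Z - e1)%R.
Proof.
move=> [e0 [n0 H]]; exists e0, n0 => -[//|n] /H[l hl e]; exists l => //.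
exact/length_quot.
Qed.

End PowersOfIdeals.

Section AlmostGorensteinTrace.
Variables (R : comNzRingType) (m : ideal R) (K : lmodType R).
Hypotheses (noethR : noetherian R) (localR : local_ring m) (dimR : krull_dim R^o 1).
Hypothesis canK : canonical_module m K.
Variables (I : ideal R) (h : {linear K -> R^o}).
Hypotheses (hI : injective h) (hE : range h = [set a | a \in I]).
Variable (x : R).
Hypotheses (xm : x \in m) (nx : nzd_on R^o x).
Local Notation P := (pow I).

Lemma nzd_on_embedded y : nzd_on R^o y -> nzd_on K y.
Proof.
by move=> ny k yk; apply: hI; rewrite linear0; apply: ny; rewrite -linearZ yk linear0.
Qed.

Lemma embedded_mem k : h k \in I.
Proof. by have : range h (h k) by []; rewrite hE. Qed.

Lemma embedded_ex a : a \in I -> exists k, h k = a.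
Proof. by move=> aI; have : [set a | a \in I] a by []; rewrite -hE => -[k _ <-]; exists k. Qed.

Lemma embedded_faithful xi q : xi \in m -> nzd_on R^o xi ->
  (forall i, i \in I -> exists2 j, j \in I & q * i = xi * j) -> exists c, q = xi * c.
Proof.
move=> xim nxi qI; apply: (canonical_faithful noethR localR dimR canK xim nxi).
  exact: nzd_on_embedded.
move=> k; have [_ /embedded_ex[k' <-] e] := qI _ (embedded_mem k).
by exists k' => //; apply: hI; rewrite !linearZ.
Qed.

(** * The overring given by a principal reduction *)

Section Reduction.
Variables (p : nat) (xi : R).
Hypotheses (xim : xi \in m) (nxi : nzd_on R^o xi) (Pxi : P p.+1 xi)
  (red : P (p.+1 + p.+1) `<=` mulset xi (P p.+1)).
Local Notation J := (P p.+1).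
Local Notation lxi := (line (xi : R^o)).

Lemma line_sub_reduction : lxi `<=` J.
Proof. exact: line_sub (is_submod_pow _ _) Pxi. Qed.

Lemma pow_reduction j : P (p.+1 * j.+1) = mulset (xi ^+ j) J.
Proof.
elim: j => [|j IH].
  by rewrite muln1; apply/seteqP; split=> [y Py|_ [y Py <-]];
    [exists y => //; rewrite mul1r|rewrite mul1r].
rewrite mulnS; apply/seteqP; split=> [|_ [y Jy <-]]; last first.
  by rewrite addnC; apply: powM => //; apply: powX.
apply: powD_ind; first exact/is_submod_mulset/is_submod_pow.
move=> a b Ja; rewrite IH => -[c Jc <-]; rewrite mulrCA.
have [d Jd <-] := red (powM Ja Jc); exists d => //.
by rewrite exprSr mulrA.
Qed.

(** [xi ^+ j J] is a power of [I], and its colength is [j.+1 * lam - delta]. *)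
Lemma e1_reduction e1 delta : hilbert_e1_is I e1 -> len lxi J delta -> e1 = delta%:Z.
Proof.
move=> /hilbert_len[e0 [n0 H]] ld.
have [lam llam] : exists lam, len lxi setT lam.
  have [n ln] := finite_length_nzd noethR localR dimR nxi (is_submod_line _) (line_id (xi : R^o)).
  have [|l _ ll] := lenleP (@is_submodT _ R^o) _ ln; last by exists l.
  by [].
have key j : (n0 < p.+1 * j.+1)%N ->
    (j.+1 * lam)%:Z = delta%:Z + (e0 * (p.+1 * j.+1)%:Z - e1) :> int.
  move=> /H[l]; rewrite pow_reduction => ll <-.
  have sJ := is_submod_pow I p.+1.
  have nxj := nzd_on_exp (k := j) nxi.
  have := len_mulset nxj (is_submod_line (xi : R^o)) sJ line_sub_reduction ld.
  rewrite mulset_line -exprSr => l1.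
  have lT := len_add (is_submod_mulset _ sJ) (@is_submodT _ R^o) _ (@subsetT _ _) l1 ll.
  rewrite -PoszD; congr Posz; apply: len_uniq (len_line_exp _ nxi llam) (lT _).
  rewrite exprSr -mulset_line => _ [y ly <-]; exists y => //; exact: line_sub_reduction.
(* Two consecutive values of [j] force [lam = e0 * p.+1], and then [e1 = delta]. *)
have k1 := key n0 ltac:(nia); have k2 := key n0.+1 ltac:(nia).
nia.
Qed.

(* With [S] the overring [J / xi] of [R], this is the dual [I : S] of [S]. *)
Definition colon_reduction : set R^o :=
  [set y | y \in I /\ forall c, J c -> exists2 j, j \in I & y * c = xi * j].
Local Notation Y := colon_reduction.

Lemma scaled_linear : linear (fun k => xi * h k : R^o).
Proof. by move=> a u v; rewrite linearP /= mulrDr mulr_regularZ. Qed.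

Lemma range_scaled : range (mklin scaled_linear) = [set z | exists2 i, i \in I & z = xi * i].
Proof.
apply/seteqP; split=> [_ [k _ <-]|_ [i /embedded_ex[k <-] ->]]; last by exists k.
by exists (h k) => //; apply: embedded_mem.
Qed.

Lemma scaled_simple_socle : simple_socle m (range (mklin scaled_linear)).
Proof.
apply: (canonical_simple_socle canK xm (nzd_on_embedded nx) nx).
by move=> k l /(nzd_onI nxi)/hI.
Qed.

(** Duality into [xi I], a copy of [K] in [R]; the factor [xi] clears the denominator of
    [J / xi]. *)
Lemma dual_lenle_mul (A C C' : set R^o) n : is_submod A -> is_submod C -> is_submod C' ->
  C `<=` C' -> lenle C C' n ->
  lenle [set y | A y /\ forall c, C' c -> exists2 i, i \in I & y * c = xi * i]
        [set y | A y /\ forall c, C c -> exists2 i, i \in I & y * c = xi * i] n.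
Proof.
move=> sA sC sC' CC' l.
have sN : is_submod [set z : R^o | exists2 i, i \in I & z = xi * i].
  rewrite -range_scaled; split; first by exists 0; rewrite ?linear0.
  by move=> a _ _ [u _ <-] [v _ <-]; exists (a *: u + v); rewrite // linearP.
apply: (@dual_lenle R m R^o R^o R^o [set z | exists2 i, i \in I & z = xi * i]
  (fun y c : R^o => y * c : R^o) A C C' n) => //.
- by move=> y a u v; rewrite mulrDr mulr_regularZ.
- by move=> c a u v; rewrite mulrDl -scalerAl.
- by rewrite -range_scaled; apply: scaled_simple_socle.
Qed.

(** With [W = I^p / xi], the product [y W I] is [y S], which lies in [I]; hence [y W] lies in
    [I : I = R]. *)
Lemma colon_mul w y : P p w -> Y y -> exists c, w * y = xi * c.
Proof.
move=> Pw [yI Yy]; apply: (embedded_faithful xim nxi) => i iI.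
have Jwi : J (w * i) by rewrite mulrC; apply: powS.
by have [j jI e] := Yy _ Jwi; exists j; rewrite // -e mulrAC mulrC.
Qed.

(** [Y] is stable under [S]. So for [s] in [S] the element [c s = (w / xi) (s y)] lies in [R], and
    [c] is a unit. *)
Lemma colon_unit w y c : P p w -> Y y -> w * y = xi * c -> c \notin m -> J `<=` lxi.
Proof.
move=> Pw [yI Yy] e /(unit_not_max noethR localR)[b bE] s Js.
have [y' y'I sy] := Yy s Js.
have Yy' : Y y'.
  split=> // c' Jc'; have [s' Js' ss'] := red (powM Js Jc').
  have [j jI e'] := Yy s' Js'; exists j => //.
  apply: (nzd_onI nxi); rewrite -[LHS]/(xi * (y' * c')) -[RHS]/(xi * (xi * j)).
  transitivity ((xi * y') * c'); first by ring.
  transitivity ((y * s) * c'); first by rewrite sy.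
  transitivity (y * (s * c')); first by ring.
  transitivity (xi * (y * s')); first by rewrite -ss'; ring.
  by rewrite e'.
have [z zE] := colon_mul Pw Yy'.
exists (b * z) => //; rewrite -[LHS]/(b * z * xi) -mulrA [z * xi]mulrC.
have -> : xi * z = s * c; last by rewrite [s * c]mulrC mulrA bE mul1r.
apply: (nzd_onI nxi); rewrite -[LHS]/(xi * (xi * z)) -[RHS]/(xi * (s * c)).
transitivity (w * (xi * y')); first by rewrite -zE; ring.
transitivity (w * (y * s)); first by rewrite sy.
transitivity (s * (w * y)); first by ring.
by rewrite e; ring.
Qed.

Local Notation mI := [set a : R^o | a \in mulI m I].

(** As [xi] lies in [I I^p], the element [y] is a sum of products of elements of [I] by elements
    [w y / xi] of [m]. *)
Lemma colon_sub : (forall w y c, P p w -> Y y -> w * y = xi * c -> c \in m) -> Y `<=` mI.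
Proof.
move=> cm y Yy.
pose Z : set R^o := [set s | exists2 z, mI z & y * s = xi * z].
have sZ : is_submod Z.
  split; first by exists 0; rewrite /mkset ?rpred0 ?mulr0.
  move=> a u v [z mz e] [z' mz' e']; exists (a *: z + z').
    by apply: rpredD => //; apply: rpredZ.
  by rewrite mulrDr mulr_regularZ e e' mulrDr mulr_regularZ.
have [z mz e] : Z xi.
  have : P (1 + p) xi by rewrite add1n.
  apply: powD_ind => // a b /pow1 aI Pb; have [c e] := colon_mul Pb Yy.
  exists (c * a); last by transitivity (a * (b * y)); [ring|rewrite e; ring].
  by apply: mem_gen; exists c, a; split=> //; apply: cm Pb Yy e.
by rewrite (nzd_onI nxi (_ : xi *: y = xi *: z)) // -[LHS]/(xi * y) mulrC.
Qed.

(** Under duality into [xi I], the dual of [I] is [R xi] and the dual of [m I] contains [R xi : m],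
    so the socle of [R / R xi] is no longer than [I / m I]. *)
Lemma type_le_generators r n : type_is m R^o r -> lenle mI [set a : R^o | a \in I] n ->
  (r <= n)%N.
Proof.
move=> /(type_len xim nxi) lr ln.
have sm := is_submod_mem (mulI m I); have sI := is_submod_mem I.
have mII : mI `<=` [set a : R^o | a \in I].
  apply: (gen_ind (P := fun a => a \in I)); first exact: is_submod_mem.
  by move=> _ [a [b [_ bI ->]]]; apply: rpredZ.
apply: (len_le_lenle lr).
apply: lenle_sub (dual_lenle_mul (is_submod_col_max R^o m xi) sm sI mII ln).
  move=> q [_ qI]; have [|c ->] := @embedded_faithful xi q xim nxi; last by exists c.
  by move=> i /qI.
move=> q colq; split=> //.
apply: (gen_ind (P := fun c => exists2 i, i \in I & q * c = xi * i)).
  split; first by exists 0; rewrite ?rpred0 ?mulr0.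
  move=> a u v [z zI e] [z' zI' e']; exists (a *: z + z').
    by apply: rpredD => //; apply: rpredZ.
  by rewrite mulrDr mulr_regularZ e e' mulrDr mulr_regularZ.
move=> _ [a [i [am iI ->]]]; have [c _ e] := colq a am.
exists (c * i); first by apply: (rpredZ c).
transitivity ((a * q) * i); first by rewrite -[a *: i]/(a * i); ring.
by rewrite -[a * q]/(a *: q) -e -[xi *: c]/(xi * c); ring.
Qed.

Lemma reduction_trace e1 r : hilbert_e1_is I e1 -> type_is m R^o r -> (e1 <= r%:Z)%R ->
  {subset m <= trace (submod (mulI m (full K)))}.
Proof.
move=> hil typ le1.
have hmI k : k \in mulI m (full K) -> h k \in mulI m I.
  apply: (gen_ind (P := fun k => h k \in mulI m I)).
    split; first by rewrite linear0 rpred0.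
    by move=> a u v ? ?; rewrite linearP; apply: rpredD => //; apply: rpredZ.
  move=> _ [a [k' [am _ ->]]]; rewrite linearZ; apply: mem_gen.
  by exists a, (h k'); split=> //; apply: embedded_mem.
have div w y : P p w -> y \in mulI m I -> exists c, w * y = xi * c.
  move=> Pw ymI.
  case: (pselect (exists w y c, [/\ P p w, Y y, w * y = xi * c & c \notin m])).
    move=> [w' [y' [c [Pw' Yy' e cm]]]]; have Jl := colon_unit Pw' Yy' e cm.
    suff H : [set y | lxi (w * y)] y by have [c' _ <-] := H; exists c'; apply: mulrC.
    move: y ymI; apply: gen_ind; last first.
      move=> _ [a [i [_ iI ->]]]; rewrite /mkset mulr_regularZ.
      apply: submodZ; first exact: is_submod_line.
      by apply: Jl; rewrite mulrC; apply: powS.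
    have sl := is_submod_line (xi : R^o).
    split; first by rewrite /mkset mulr0; case: sl.
    by move=> a u v Hu Hv; rewrite /mkset mulrDr mulr_regularZ; apply: (proj2 sl).
  move=> no; have YmI : Y `<=` mI.
    apply: colon_sub => w' y' c Pw' Yy' e; apply: contrapT => /negP cm.
    by apply: no; exists w', y', c.
  apply: colon_mul => //.
  have sJ := is_submod_pow I p.+1; have sl := is_submod_line (xi : R^o).
  have [n ln] := finite_length_nzd noethR localR dimR nxi sl (line_id (xi : R^o)).
  have [|delta _ ld] := lenleP sJ line_sub_reduction (n := n).
    exact: lenle_sub ln.
  have e1d := e1_reduction hil ld.
  have lY : lenle Y [set a : R^o | a \in I] delta.
    apply: lenle_sub (dual_lenle_mul (is_submod_mem I) sl sJ line_sub_reduction (proj1 ld)).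
      by [].
    move=> i iI; split=> // _ [c _ <-]; exists (c * i); first exact: (rpredZ c).
    by rewrite -[c *: _]/(c * xi); ring.
  have sY : is_submod Y.
    split; first by split=> [|c _]; [apply: rpred0|exists 0; rewrite ?rpred0 ?mul0r ?mulr0].
    move=> a u v [uI Yu] [vI Yv]; split; first by apply: rpredD => //; apply: rpredZ.
    move=> c Jc; have [i iI e] := Yu c Jc; have [j jI e'] := Yv c Jc.
    exists (a *: i + j); first by apply: rpredD => //; apply: rpredZ.
    by rewrite mulrDl -scalerAl e e' mulrDr mulr_regularZ.
  (* If [Y] were strictly smaller than [m I], the length of [I / m I] would be at most [delta - 1],
     but it is at least [r], which is at least [delta]. *)
  apply: contrapT => nYy.
  have [||n' n'E l'] := lenle_lt sY (is_submod_mem (mulI m I)) _ _ lY.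
  - by split=> // /(_ y ymI).
  - apply: (gen_ind (P := fun a => a \in I)); first exact: is_submod_mem.
    by move=> _ [a [b [_ bI ->]]]; apply: rpredZ.
  have := type_le_generators typ l'; move: le1; rewrite e1d n'E; lia.
move=> a am.
pose T := trace (submod (mulI m (full K))).
(* As [xi] lies in [I I^p], the element [a] is a sum of values [w h(a k) / xi], all in the trace. *)
pose Z : set R^o := [set s | exists2 z, z \in T & a * s = xi * z].
have sZ : is_submod Z.
  split; first by exists 0; rewrite ?rpred0 ?mulr0.
  move=> b u v [z mz e] [z' mz' e']; exists (b *: z + z').
    by apply: rpredD => //; apply: rpredZ.
  by rewrite mulrDr mulr_regularZ e e' mulrDr mulr_regularZ.
have [z zT e] : Z xi.
  have : P (1 + p) xi by rewrite add1n.
  apply: powD_ind => // _ w /pow1/embedded_ex[k <-] Pw.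
  have akm : a *: k \in mulI m (full K).
    by apply: mem_gen; exists a, k; split=> //; apply: mem_full.
  have [c e] := div w _ Pw (hmI _ akm); exists c.
    apply: (mem_trace_div (h := h) nxi _ akm e) => y ym.
    by apply: div => //; apply: hmI.
  transitivity (w * h (a *: k)); last exact: e.
  by rewrite linearZ /= -[a *: h k]/(a * h k); ring.
by rewrite (nzd_onI nxi (_ : xi *: a = xi *: z)) // -[LHS]/(xi * a) mulrC.
Qed.

End Reduction.
End AlmostGorensteinTrace.

Theorem almost_gorenstein_trace (R : comNzRingType) (m : ideal R) (K : lmodType R)
    (noethR : noetherian R) (localR : local_ring m)
    (cmR : cohen_macaulay m R^o) (dimR : krull_dim R^o 1) (canK : canonical_module m K) :
  almost_gorenstein m K -> {subset m <= trace (submod (mulI m (full K)))}.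
Proof.
move=> [I [e1 [r [[f fbij] hil typ le1]]]].
have [g fK gK] := linear_inverse fbij.
have hl : linear (fun k => val (g k) : R^o) by move=> a u v; rewrite !linearP.
pose h := mklin hl.
have hI : injective h by move=> u v /val_inj/(can_inj gK).
have hE : range h = [set a | a \in I].
  apply/seteqP; split=> [_ [k _ <-]|a aI]; first by rewrite /h /=; case: (g k).
  by exists (f (Sub a aI)) => //=; rewrite fK.
have [x xm nx] := regular_element cmR dimR.
(* If [I] is the unit ideal, [h] takes the value [1] and maps [m K] onto an ideal containing [m]. *)
case: (boolP ((1 : R) \in I)) => [I1|nI1].
  move=> a am; have [k kE] := embedded_ex hE I1.
  have nx1 : nzd_on R^o 1 by move=> y; rewrite scale1r.
  have akm : a *: k \in mulI m (full K).
    by apply: mem_gen; exists a, k; split=> //; apply: mem_full.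
  apply: (mem_trace_div (h := h) (w := 1) nx1 _ akm).
    by move=> y _; exists (h y).
  congr (1 * _); have hak : h (a *: k) = a *: h k by rewrite linearZ.
  apply: (etrans hak).
  apply: (etrans (congr1 (fun z : R^o => a *: z) kE)); exact: mulr1.
have Im : {subset I <= m}.
  have sub := proper_sub_max noethR localR (is_submod_mem I) (elimN idP nI1).
  by move=> a aI; apply: sub.
have [e0 [n0 H]] := hilbert_len hil.
have [p [xi [p0 Pxi red]]] : exists p xi, [/\ (0 < p)%N, pow I p xi &
    pow I (p + p) `<=` mulset xi (pow I p)].
  (* [I^n / m I^n] is a quotient of [I^n / I^(n+1)], which has length [e0] for large [n]. *)
  apply: (principal_reduction noethR localR (n0 := n0.+1) (E := `|e0|%N)) => // n nn0.
  have [l0 ll0 e0E] := H n nn0; have [|l1 ll1 e1E] := H n.+1; first exact: leqW.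
  have [||q [l0' [lq ll0' lE]]] := len_split (is_submod_pow I n) (@is_submodT _ R^o) _ _ ll1.
  - exact: pow_subS.
  - exact: subsetT.
  have l0E := len_uniq ll0 ll0'.
  have -> : `|e0|%N = q by move: e0E e1E; rewrite lE -l0E; nia.
  by apply: lenle_sub (proj1 lq) => //; apply: pow_sub_max_pow.
case: p p0 Pxi red => // p _ Pxi red.
have xim : xi \in m by apply: Im; apply/pow1; apply: pow_anti Pxi.
(* A power of the regular element [x] lies in [I^(2p+2)], so it is a multiple of [xi]. *)
have nxi : nzd_on R^o xi.
  pose n := (n0 + (p.+1 + p.+1)).+1.
  have [|l [ll _] _] := H n; first by rewrite /n; lia.
  have [N PN] := finite_length_exp noethR localR (is_submod_pow I n) ll xm.
  have [|w _ e] := red (x ^+ N); first by apply: pow_anti PN; rewrite /n; lia.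
  exact: nzd_on_dvd (nzd_on_exp (k := N) nx) (esym e).
exact: (reduction_trace noethR localR dimR canK hI hE xm nx xim nxi Pxi red hil typ le1).
Qed.

(** * The total quotient ring *)

Section Localization.
Variables (R : comNzRingType) (x : R) (nx : nzd_on R^o x).

Definition inversion_poly : {poly R} := x%:P * 'X - 1.

(** The argument carries the regularity of [x] to the ideal instance, which has to show that the
    ideal is proper. *)
Definition inversion_pred (_ : nzd_on R^o x) : {pred {poly R}} :=
  fun p => `[< exists q, p = q * inversion_poly >].

(** For nonzero [q] the leading coefficient times [x] survives in degree [size q], because [x] is
    regular. *)
Lemma inversion_const q c : c%:P = q * inversion_poly -> c = 0.
Proof.
move=> e; case: (eqVneq q 0) => [q0|q0].
  by move/eqP: e; rewrite q0 mul0r polyC_eq0 => /eqP.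
have sq : (0 < size q)%N by rewrite size_poly_gt0.
have /(congr1 (fun p : {poly R} => p`_(size q))) := e.
rewrite coefC gtn_eqF // mulrBr mulr1 mulrA coefB coefMX gtn_eqF //.
rewrite coefMC [q`_(size q)]nth_default // subr0 => /esym qx.
have /eqP := nx (y := lead_coef q : R^o) (etrans (mulrC _ _) qx).
by rewrite lead_coef_eq0 (negPf q0).
Qed.

Lemma inversion_closed : idealr_closed (inversion_pred nx).
Proof.
split; first by apply/asboolP; exists 0; rewrite mul0r.
  apply/negP => /asboolP[q]; rewrite -[1]/(1%:P) => /inversion_const/eqP.
  by rewrite oner_eq0.
move=> a _ _ /asboolP[p ->] /asboolP[q ->]; apply/asboolP.
by exists (a * p + q); rewrite mulrDl mulrA.
Qed.

HB.instance Definition _ := isIdealr.Build {poly R} (inversion_pred nx) inversion_closed.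

Definition localization := {ideal_quot (inversion_pred nx)}.
HB.instance Definition _ := GRing.ComNzRing.on localization.

Definition loc_pi (p : {poly R}) : localization := (\pi_localization p)%qT.

Definition loc_scale (a : R) (q : localization) : localization := loc_pi a%:P * q.

Lemma loc_pi_mul : {morph loc_pi : p q / p * q}. Proof. exact: rmorphM. Qed.
Lemma loc_pi_add : {morph loc_pi : p q / p + q}. Proof. exact: rmorphD. Qed.
Lemma loc_pi1 : loc_pi 1 = 1. Proof. exact: rmorph1. Qed.

Fact loc_scaleA a b q : loc_scale a (loc_scale b q) = loc_scale (a * b) q.
Proof. by rewrite /loc_scale mulrA -loc_pi_mul -polyCM. Qed.
Fact loc_scale1 : left_id 1 loc_scale.
Proof. by move=> q; rewrite /loc_scale loc_pi1 mul1r. Qed.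
Fact loc_scaleDr : right_distributive loc_scale +%R.
Proof. by move=> a p q; rewrite /loc_scale mulrDr. Qed.
Fact loc_scaleDl q : {morph loc_scale^~ q : a b / a + b}.
Proof. by move=> a b; rewrite /loc_scale polyCD loc_pi_add mulrDl. Qed.

HB.instance Definition _ := GRing.Zmodule_isLmodule.Build R localization
  loc_scaleA loc_scale1 loc_scaleDr loc_scaleDl.

Fact loc_scaleAl (a : R) (p q : localization) : a *: (p * q) = a *: p * q.
Proof. exact: mulrA. Qed.

HB.instance Definition _ := GRing.Lmodule_isLalgebra.Build R localization loc_scaleAl.
HB.instance Definition _ := GRing.Lalgebra_isComAlgebra.Build R localization.

Lemma loc_scaleE a (q : localization) : a *: q = loc_pi a%:P * q. Proof. by []. Qed.

Lemma loc_pi_eq0 p : loc_pi p = 0 -> exists q, p = q * inversion_poly.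
Proof.
move=> p0; suff /asboolP : p \in inversion_pred nx by [].
rewrite -[p]subr0 Quotient.idealrBE; apply/eqP.
by rewrite [LHS]p0 rmorph0.
Qed.

Lemma loc_pi_x : x *: loc_pi 'X = 1.
Proof.
rewrite loc_scaleE -loc_pi_mul; apply/eqP; rewrite -subr_eq0 -loc_pi1; apply/eqP.
rewrite -[RHS](_ : loc_pi 0 = 0); last exact: rmorph0.
rewrite -[LHS](_ : loc_pi (x%:P * 'X - 1) = _); last exact: rmorphB.
apply/eqP; rewrite -Quotient.idealrBE subr0; apply/asboolP.
by exists 1; rewrite mul1r.
Qed.

Lemma loc_inj (a : R) : a *: (1 : localization) = 0 -> a = 0.
Proof. by rewrite loc_scaleE mulr1 => /loc_pi_eq0[q]; apply: inversion_const. Qed.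

End Localization.

(** These two properties are the interface to [R[1/x]] from here on. *)
Lemma localization_exists (R : comNzRingType) (x : R) : nzd_on R^o x ->
  exists (Q : comAlgType R) (xi : Q),
    x *: xi = 1 /\ forall a : R, a *: (1 : Q) = 0 -> a = 0.
Proof.
move=> nx; exists (localization nx), (loc_pi nx 'X); split.
- exact: loc_pi_x.
- exact: loc_inj.
Qed.

(** * The endomorphism ring of the maximal ideal *)

Section Endomorphisms.
Variables (R : comNzRingType) (m : ideal R).
Hypotheses (noethR : noetherian R) (localR : local_ring m) (dimR : krull_dim R^o 1).
Variables (x : R) (Q : comAlgType R) (xi : Q).
Hypotheses (xm : x \in m) (nx : nzd_on R^o x) (xxi : x *: xi = 1)
  (Qinj : forall a : R, a *: (1 : Q) = 0 -> a = 0).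

Definition base_ring : set Q := [set q | exists a : R, q = a%:A].
Definition base_max : set Q := [set q | exists2 a : R, a \in m & q = a%:A].
(* The endomorphism ring [m : m] of the maximal ideal, inside the total quotient ring. *)
Definition endo_ring : set Q := [set b | forall a, a \in m -> base_max (a *: b)].
Local Notation RQ := base_ring.
Local Notation mQ := base_max.
Local Notation B := endo_ring.

Lemma nzd_on_loc : nzd_on Q x.
Proof. by move=> q xq; rewrite -[q]mul1r -xxi -scalerAl scalerAr xq mulr0. Qed.

Lemma base_inj (a b : R) : a%:A = b%:A :> Q -> a = b.
Proof.
move=> e; apply/eqP; rewrite -subr_eq0; apply/eqP/Qinj.
by rewrite scalerBl e subrr.
Qed.

Lemma is_submod_base_ring : is_submod RQ.
Proof.
split; first by exists 0; rewrite scale0r.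
by move=> a _ _ [b ->] [c ->]; exists (a * b + c); rewrite scalerDl scalerA.
Qed.

Lemma is_submod_base_max : is_submod mQ.
Proof.
split; first by exists 0; [exact: rpred0|rewrite scale0r].
move=> a _ _ [b bm ->] [c cm ->]; exists (a * b + c); last by rewrite scalerDl scalerA.
by apply: rpredD => //; apply: max_idealM.
Qed.

Lemma is_submod_endo : is_submod B.
Proof.
split=> [a _|a b c Bb Bc d dm].
  by rewrite scaler0; case: is_submod_base_max.
rewrite scalerDr scalerA mulrC -scalerA; apply: (proj2 is_submod_base_max).
  exact: Bb.
exact: Bc.
Qed.

Lemma base_sub_endo : RQ `<=` B.
Proof.
by move=> _ [a ->] b bm; exists (b * a); rewrite ?scalerA // max_idealMr.
Qed.

Lemma max_sub_base : mQ `<=` RQ. Proof. by move=> _ [a _ ->]; exists a. Qed.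

Lemma endo1 : B 1. Proof. by apply: base_sub_endo; exists 1; rewrite scale1r. Qed.

Lemma base_max_mul q b : mQ q -> B b -> mQ (q * b).
Proof. by move=> [a am ->] Bb; rewrite -scalerAl mul1r; apply: Bb. Qed.

Lemma endoM b c : B b -> B c -> B (b * c).
Proof. by move=> Bb Bc a am; rewrite scalerAl; apply: base_max_mul => //; apply: Bb. Qed.

(** Multiplication by [x] sends submodules between [m] and [B] injectively to ideals of [R]
    containing [x * x]. *)
Lemma endo_finite : exists n, lenle mQ B n.
Proof.
pose F (C : set Q) : set R^o := [set a : R^o | exists2 c, C c & a%:A = x *: c].
have sF C : is_submod C -> is_submod (F C).
  move=> [C0 sC]; split; first by exists 0; rewrite ?scale0r ?scaler0.
  move=> a u v [c Cc e] [d Cd e']; exists (a *: c + d); first exact: sC.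
  by rewrite scalerDl -[a *: u]/(a * u) -scalerA e e' scalerDr !scalerA mulrC.
have nx2 := nzd_on_mul nx nx.
have [|n ln] := finite_length_nzd noethR localR dimR nx2 (sF _ is_submod_base_max).
  by exists x%:A; [exists x|rewrite scalerA].
exists n; apply: (lenle_map (F := F) (B' := setT)) ln => //.
- by move=> C sC _ _; apply: sF.
- move=> C C' _ _ _ C'B [CC' nCC']; split.
    by move=> a [c Cc e]; exists c => //; apply: CC'.
  move=> FF; apply: nCC' => c Cc; have [a _ e] := C'B c Cc x xm.
  have [d Cd e'] : F C a by apply: FF; exists c.
  by rewrite (nzd_onI nzd_on_loc (_ : x *: c = x *: d)) // e.
- exact: is_submod_base_max.
Qed.

Definition endo_ideal (L : set Q) : Prop :=
  [/\ is_submod L, L `<=` B & forall b q, B b -> L q -> L (b * q)].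

(** The last clause says that [B / M] is a field. That ideals above [m] suffice is shown by
    [endo_unit_ideal]. *)
Definition endo_maximal (M : set Q) : Prop :=
  [/\ endo_ideal M, mQ `<=` M, ~ M 1 &
    forall b, B b -> ~ M b -> exists2 b', B b' & M (1 - b' * b)].

(** Adding an element not invertible modulo [L] uses up length, so finite length replaces Zorn's
    lemma. *)
Lemma endo_maximal_above n L : lenle L B n -> endo_ideal L -> mQ `<=` L -> ~ L 1 ->
  exists2 M, endo_maximal M & L `<=` M.
Proof.
elim: n L => [|n IH] L lB [sL LB idL] mL nL1.
  by case: nL1; apply: (lenle0 lB sL is_submod_endo LB endo1).
case: (pselect (forall b, B b -> ~ L b -> exists2 b', B b' & L (1 - b' * b))) => [H|].
  by exists L.
move=> /existsNP[b /not_implyP[Bb /not_implyP[nLb nb']]].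
pose bB : set Q := [set c * b | c in B].
have sbB : is_submod bB.
  split; first by exists 0; rewrite ?mul0r //; case: is_submod_endo.
  move=> a _ _ [c Bc <-] [d Bd <-]; exists (a *: c + d).
    exact: (proj2 is_submod_endo).
  by rewrite mulrDl scalerAl.
have sL' := is_submod_add sL sbB.
have LL' := addm_subl (A := L) sbB.
have L'B : addm L bB `<=` B.
  by apply: addm_sub is_submod_endo LB _ => _ [c Bc <-]; apply: endoM.
have L'b : addm L bB b by apply: (addm_subr sL); exists 1; [apply: endo1|rewrite mul1r].
have [|_ [<-] l'] := lenle_lt sL sL' _ L'B lB; first by split=> // /(_ _ L'b).
have [|||M maxM L'M] := IH _ l'; last by exists M => //; apply: subset_trans L'M.
- split=> // c _ Bc [y [_ [Ly [d Bd <-] ->]]]; exists (c * y), (c * (d * b)).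
  split; [exact: idL|exists (c * d); [exact: endoM|by rewrite mulrA]|].
  by rewrite mulrDr.
- exact: subset_trans LL'.
move=> [y [_ [Ly [c Bc <-] e]]]; apply: nb'; exists c => //.
by rewrite e addrK.
Qed.

Lemma endo_maximal_prime M a b : endo_maximal M -> B a -> B b -> M (a * b) -> ~ M a -> M b.
Proof.
move=> [[sM MB idM] _ _ maxM] Ba Bb Mab nMa; have [c Bc Mc] := maxM a Ba nMa.
rewrite -[b](subrK (c * (a * b))); apply: submodD => //; last exact: idM.
have -> : b - c * (a * b) = b * (1 - c * a)
  by rewrite mulrBr mulr1 [b * (c * a)]mulrCA [b * a]mulrC.
exact: idM.
Qed.

(** If [1] is in [L + m], then [L] contains some [1 - a] with [a] in [m], which is a unit of [R]. *)
Lemma endo_unit_ideal L : endo_ideal L ->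
  (forall M, endo_maximal M -> exists2 q, L q & ~ M q) -> L 1.
Proof.
move=> [sL LB idL] HL; apply: contrapT => nL1.
have sL' := is_submod_add sL is_submod_base_max.
have mB : mQ `<=` B by apply: subset_trans base_sub_endo; apply: max_sub_base.
have [n ln] := endo_finite.
have [||||M maxM L'M] := @endo_maximal_above n (addm L mQ).
- by apply: lenle_sub ln => //; apply: addm_subr.
- split=> //; first exact: addm_sub is_submod_endo LB mB.
  move=> b _ Bb [y [z [Ly mz ->]]]; exists (b * y), (b * z).
  by rewrite mulrDr; split=> //; [apply: idL|rewrite mulrC; apply: base_max_mul].
- exact: addm_subr.
- move=> [y [_ [Ly [a am ->] e]]]; apply: nL1.
  have [b bE] := unit_1B noethR localR am.
  have -> : 1 = b *: y :> Q.
    have -> : y = (1 - a)%:A by apply/esym/eqP; rewrite scalerBl scale1r subr_eq; apply/eqP.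
    by rewrite scalerA bE scale1r.
  exact: submodZ.
have [q Lq nMq] := HL M maxM; apply/nMq/L'M.
exact: (addm_subl is_submod_base_max).
Qed.

(* A replacement for prime avoidance which works for finite residue fields: each
   step makes one more maximal ideal of the semilocal ring [B] harmless. *)
Lemma endo_avoidance (U : Type) (c : U -> Q) (D : set (U -> Q)) :
  D (fun=> 0) -> (forall e d d', B e -> D d -> D d' -> D (fun u => d u + e * d' u)) ->
  (forall u, B (c u)) -> (forall d u, D d -> B (d u)) ->
  (forall M, endo_maximal M -> (exists u, ~ M (c u)) \/ exists2 d, D d & exists u, ~ M (d u)) ->
  exists2 d, D d & forall M, endo_maximal M -> exists u, ~ M (c u + d u).
Proof.
move=> D0 DD Bc BD HM.
have mB : mQ `<=` B by apply: subset_trans base_sub_endo; apply: max_sub_base.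
(* [N] stands for the intersection of the maximal ideals already repaired. Its length over [m] drops
   at each round. *)
suff H n N d : lenle mQ N n -> endo_ideal N -> mQ `<=` N -> D d ->
    (forall M, endo_maximal M -> N `<=` M -> exists u, ~ M (c u + d u)) ->
    exists2 d, D d & forall M, endo_maximal M -> exists u, ~ M (c u + d u).
  have [n ln] := endo_finite; apply: (H n B (fun=> 0)) => //.
    by split=> //; [apply: is_submod_endo|move=> *; apply: endoM].
  by move=> M [_ _ nM1 _] BM; case: nM1; apply: BM; apply: endo1.
elim: n N d => [|n IH] N d lN idN mN Dd good;
  case: (pselect (forall M, endo_maximal M -> exists u, ~ M (c u + d u))) => [g|]; try by exists d.
all: move=> /existsNP[M /not_implyP[maxM /forallNP bad]].
all: have {}bad u : M (c u + d u) by apply: contrapT.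
all: have nNM : ~ (N `<=` M) by move=> /(good M maxM)[u]; apply; apply: bad.
all: have [[sM MB idM] mM nM1 fM] := maxM; have [sN NB iN] := idN.
  by case: nNM; apply: subset_trans mM; apply: (lenle0 lN is_submod_base_max).
have /existsNP[e /not_implyP[Ne nMe]] := nNM.
have [g Dg [u0 nMg]] : exists2 g, D g & exists u, ~ M (g u).
  have [[u nMc]|//] := HM M maxM; exists d => //; exists u => Md.
  by apply: nMc; rewrite -[c u](addrK (d u)); apply: submodB.
have Be : B e by apply: NB.
(* [e] is in [N] but not in [M]: adding [e * g] repairs [M] and changes nothing modulo the maximal
   ideals above [N]. *)
pose d' u := d u + e * g u.
have idN' : endo_ideal (N `&` M).
  split; first exact: is_submodI.
    by move=> q [/NB].
  by move=> b q Bb [Nq Mq]; split; [apply: iN|apply: idM].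
have mN' : mQ `<=` N `&` M by move=> q mq; split; [apply: mN|apply: mM].
have lN' : lenle mQ (N `&` M) n.
  move=> k C h CN; rewrite -ltnS; apply: (lN k.+1 N) => //.
  apply: hcS h sN _; split; first by apply: subset_trans CN _ => q [].
  by move=> NC; apply: nNM => q /NC/CN[].
apply: (IH (N `&` M) d') => //; first exact: DD.
move=> M' maxM' NM'; have [[sM' M'B idM'] mM' nM'1 fM'] := maxM'.
  case: (pselect (N `<=` M')) => [NM''|/existsNP[a /not_implyP[Na nM'a]]].
    have [u nu] := good M' maxM' NM''; exists u => Mu; apply: nu.
    rewrite -[c u + d u](addrK (e * g u)); apply: submodB => //.
      by rewrite -addrA.
    by rewrite mulrC; apply: idM' => //; [apply: BD|apply: NM''].
  have MM' : M `<=` M'.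
    move=> b Mb; apply: (endo_maximal_prime (a := a)) => //; [exact: NB|exact: MB|].
    apply: NM'; split; first by rewrite mulrC; apply: iN => //; apply: MB.
    by apply: idM => //; apply: NB.
  have M'M : M' `<=` M.
    move=> b M'b; apply: contrapT => nMb; have [b' Bb' Mb'] := fM b (M'B _ M'b) nMb.
    apply: nM'1; rewrite -[1](subrK (b' * b)); apply: submodD => //; first exact: MM'.
    exact: idM'.
  exists u0 => M'u; have /(_ (M'M _ M'u))Meg : M (c u0 + d' u0) -> M (e * g u0).
    move=> Mu; have -> : e * g u0 = (c u0 + d' u0) - (c u0 + d u0).
      by rewrite /d' addrA [RHS]addrC addKr.
    exact: submodB.
  by apply: nMg; apply: (endo_maximal_prime maxM Be _ Meg nMe); apply: BD.
Qed.

End Endomorphisms.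

(** * Maps from the canonical module to the endomorphism ring *)

Section CanonicalEmbedding.
Variables (R : comNzRingType) (m : ideal R) (K : lmodType R).
Hypotheses (noethR : noetherian R) (localR : local_ring m) (dimR : krull_dim R^o 1).
Variables (x : R) (Q : comAlgType R) (xi : Q).
Hypotheses (xm : x \in m) (nx : nzd_on R^o x) (xxi : x *: xi = 1)
  (Qinj : forall a : R, a *: (1 : Q) = 0 -> a = 0).
Hypothesis nprin : ~ exists2 a : R, a \in m & forall b : R, b \in m -> exists c, b = c * a.
Local Notation RQ := (@base_ring R Q).
Local Notation mQ := (@base_max R m Q).
Local Notation B := (@endo_ring R m Q).

Let nxQ : nzd_on Q x := nzd_on_loc xxi.

(** If some [a b] were a unit [c], then [a' = (a' b / c) a] for every [a'] in [m], and [m] would be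
    principal. *)
Lemma endo_of_dual b : (forall a, a \in m -> RQ (a *: b)) -> B b.
Proof.
move=> Rb a am; have [c ac] := Rb a am; exists c => //; apply: contrapT => /negP nc.
have [d dc] := unit_not_max noethR localR nc.
apply: nprin; exists a => // a' a'm; have [c' a'c] := Rb a' a'm.
exists (d * c'); rewrite -[a']mul1r -dc -!mulrA; congr (_ * _).
apply: (base_inj Qinj).
by rewrite [c * a']mulrC [c' * a]mulrC -!scalerA -ac -a'c !scalerA [a * a']mulrC.
Qed.

Definition endo_valued : set (K -> Q) := [set f | linear f /\ forall k, B (f k)].

(** Every map [m K -> R] extends to a map from [K] into [R : m = B]. If all these had values in [M],
    the trace would lie in [m M], so [m = m M]; the determinant trick then gives [mu] in [M] with
    [(1 - mu) x = 0], that is [mu = 1]. *)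
Lemma endo_valued_avoid (M : set Q) :
  {subset m <= trace (submod (mulI m (full K)))} -> endo_maximal m M ->
  exists2 f, endo_valued f & exists k, ~ M (f k).
Proof.
move=> trm [[sM MB idM] _ nM1 _]; apply: contrapT => no.
have all_in f k : endo_valued f -> M (f k).
  by move=> vf; apply: contrapT => nf; apply: no; exists f => //; exists k.
pose mM := gen [set q : Q | exists a q', [/\ a \in m, M q' & q = a *: q']].
have xK k : x *: k \in mulI m (full K).
  by apply: mem_gen; exists x, k; split=> //; apply: mem_full.
have trM (phi : {linear submod (mulI m (full K)) -> R^o}) z : (phi z)%:A \in mM.
  pose f k : Q := (phi (Sub (x *: k) (xK k)) : R) *: xi.
  have fl : linear f.
    move=> a u v; rewrite /f scalerA -scalerDl; congr (_ *: _).
    rewrite -[a * _]/(a *: (phi _ : R^o)) -linearP; congr (phi _).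
    apply: val_inj; rewrite [RHS]linearP !SubK.
    by rewrite scalerDr !scalerA mulrC.
  have fE y : f (val y) = (phi y)%:A.
    apply: (nzd_onI nxQ); rewrite /f scalerA [x * _]mulrC -scalerA xxi [RHS]scalerA; congr (_ *: _).
    have <- : phi (x *: y) = x * phi y by rewrite linearZ.
    congr (phi _).
    by apply: val_inj; rewrite [RHS]linearZ SubK.
  have vf : endo_valued f.
    split=> // k; apply: endo_of_dual => a am.
    have akm : a *: k \in mulI m (full K).
      by apply: mem_gen; exists a, k; split=> //; apply: mem_full.
    exists (phi (Sub (a *: k) akm)); rewrite -fE SubK.
    by rewrite (linear_funZ a k fl).
  rewrite -fE; case: z => y ym /=; move: y ym {fE}.
  apply: (gen_ind (P := fun y => f y \in mM)).
    split; first by rewrite (linear_fun0 fl) rpred0.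
    by move=> a u v fu fv; rewrite fl; apply: rpredD => //; apply: rpredZ.
  move=> _ [a [k [am _ ->]]]; rewrite (linear_funZ _ _ fl).
  by apply: mem_gen; exists a, (f k); split=> //; apply: all_in.
have mmM a : a \in m -> a%:A \in mM.
  move=> /trm; apply: (gen_ind (P := fun a : R^o => a%:A \in mM)).
    split; first by rewrite scale0r rpred0.
    move=> c u v uM vM; rewrite scalerDl -[c *: u]/(c * u) -scalerA.
    by apply: rpredD => //; apply: rpredZ.
  by move=> _ [phi _ [z _ <-]]; apply: trM.
have [s sE] := noeth_fg noethR (is_submod_mem m).
pose base (a : R^o) : Q^o := (a : R)%:A : Q; pose S := map base s.
have ID (a b : Q) : M a -> M b -> M (a + b) by apply: submodD.
have IN (a : Q) : M a -> M (- a) by apply: submodN.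
have IM (a b : Q) : M a -> M b -> M (a * b) by move=> /MB; apply: idM.
have M0 : M 0 by case: sM.
have sW := @is_submod0 _ Q^o.
have [mu Mmu kmu] : exists2 mu, M mu & forall v, v \in S -> [set (0 : Q^o)] ((1 - mu) *: v).
  apply: determinant_trick => // v /mapP[a sa ->].
  have /mmM : a \in m by apply/sE; apply: mem_gen.
  have cZ (c : R) (v' : Q) : comb M [set 0] S (v' : Q^o) -> comb M [set 0] S (c *: v' : Q^o).
    move=> cv; rewrite -[v']mul1r scalerAl.
    apply: (combZ sW (a := c%:A : Q)) => // e Me.
    by rewrite -scalerAl mul1r; apply: submodZ.
  apply: (gen_ind (P := fun q : Q => comb M [set 0] S (q : Q^o))).
    split; first exact: combW.
    by move=> c u v' cu cv; apply: combD => //; apply: cZ.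
  move=> _ [b [q [/sE bm Mq ->]]]; move: b bm.
  apply: (gen_ind (P := fun b : R^o => comb M [set 0] S (b *: q : Q^o))).
    split; first by rewrite scale0r; apply: combW.
    move=> c u v' cu cv; rewrite scalerDl -[c *: u]/(c * u) -scalerA.
    by apply: combD => //; apply: cZ.
  move=> b bs; rewrite -[b *: q]mulr1 -scalerAl scalerAr.
  by apply: (comb_mem M0 sW) => //; apply: map_f.
have kx : (1 - mu) * x%:A = 0.
  have /sE : x \in m by [].
  apply: (gen_ind (P := fun a : R^o => (1 - mu) * a%:A = 0)).
    split; first by rewrite scale0r mulr0.
    move=> c u v e e'; rewrite scalerDl -[c *: u]/(c * u) -scalerA mulrDr -scalerAr.
    by rewrite e e' scaler0 addr0.
  by move=> a sa; apply: kmu; apply: map_f.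
apply: nM1; have -> // : 1 = mu.
apply/eqP; rewrite -subr_eq0; apply/eqP/nxQ.
by rewrite -[RHS]kx -scalerAr mulr1.
Qed.

Definition endo_span (f : K -> Q) : submodClosed Q :=
  gen [set q : Q | exists b k, B b /\ q = b * f k].

Lemma endo_span_ideal f : endo_valued f -> endo_ideal m [set q : Q | q \in endo_span f].
Proof.
move=> [_ Bf]; split; first exact: is_submod_mem.
  apply: (gen_ind (P := B)); first exact: is_submod_endo.
  by move=> _ [b [k [Bb ->]]]; apply: endoM.
move=> b q Bb; move: q; apply: (gen_ind (P := fun q => b * q \in endo_span f)).
  split; first by rewrite mulr0 rpred0.
  by move=> a u v bu bv; rewrite mulrDr -scalerAr; apply: rpredD => //; apply: rpredZ.
move=> _ [c [k [Bc ->]]]; rewrite mulrA; apply: mem_gen.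
by exists (b * c), k; split=> //; apply: endoM.
Qed.

(** Avoidance starting from the zero map, with the maps [K -> B] themselves as corrections. *)
Lemma generator_exists : {subset m <= trace (submod (mulI m (full K)))} ->
  exists2 f, endo_valued f & 1 \in endo_span f.
Proof.
move=> trm.
have [|||||f vf good] :=
  @endo_avoidance _ _ noethR localR dimR _ _ _ xm nx xxi K (fun=> 0) endo_valued.
- split; first by move=> a u v; rewrite scaler0 addr0.
  by move=> k; case: (is_submod_endo m Q).
- move=> e d d' Be [dl dB] [dl' dB']; split.
    move=> a u v; rewrite dl dl' mulrDr -scalerAr scalerDr; exact: addrACA.
  by move=> k; apply: (submodD (is_submod_endo m Q)) => //; apply: endoM.
- by move=> k; case: (is_submod_endo m Q).
- by move=> d k [].
- by move=> M maxM; right; apply: endo_valued_avoid.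
exists f => //; apply: (endo_unit_ideal noethR localR dimR xm nx xxi (endo_span_ideal vf)).
move=> M maxM; have [k nMk] := good M maxM; exists (f k); last by rewrite add0r in nMk.
by apply: mem_gen; exists 1, k; rewrite mul1r; split=> //; apply: endo1.
Qed.

End CanonicalEmbedding.

(** * A map whose image generates the unit ideal *)

Section GeneratingMap.
Variables (R : comNzRingType) (m : ideal R) (K : lmodType R).
Hypotheses (noethR : noetherian R) (localR : local_ring m) (dimR : krull_dim R^o 1).
Hypothesis canK : canonical_module m K.
Variables (x : R) (Q : comAlgType R) (xi : Q).
Hypotheses (xm : x \in m) (nx : nzd_on R^o x) (nxK : nzd_on K x) (xxi : x *: xi = 1)
  (Qinj : forall a : R, a *: (1 : Q) = 0 -> a = 0).
Local Notation RQ := (@base_ring R Q).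
Local Notation mQ := (@base_max R m Q).
Local Notation B := (@endo_ring R m Q).

Let nxQ : nzd_on Q x := nzd_on_loc xxi.
Let sB : is_submod B := is_submod_endo m Q.
Let smQ : is_submod mQ := is_submod_base_max m Q.
Let sRQ : is_submod RQ := is_submod_base_ring Q.
Let mRQ : mQ `<=` RQ := @max_sub_base R m Q.
Let RB : RQ `<=` B := @base_sub_endo R m Q.
Let mB : mQ `<=` B := subset_trans mRQ RB.

Definition scale_set (A : set Q) : set Q := [set x *: q | q in A].

Lemma is_submod_scale_set A : is_submod A -> is_submod (scale_set A).
Proof.
move=> [A0 sA]; split; first by exists 0; rewrite ?scaler0.
move=> a _ _ [u Cu <-] [v Cv <-]; exists (a *: u + v); first exact: sA.
by rewrite scalerDr !scalerA mulrC.
Qed.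

Lemma len_scale_set A A' n : is_submod A -> is_submod A' -> A `<=` A' ->
  len A A' n -> len (scale_set A) (scale_set A') n.
Proof.
move=> sA sA' AA'; suff [] : len A A' n <-> len (scale_set A) (scale_set A') n by [].
apply: (@len_corr _ _ _ (fun q : Q => x *: q)) => //.
- exact: is_submod_scale_set.
- exact: is_submod_scale_set.
- by move=> _ [q /AA' Aq <-]; exists q.
- by move=> a u v _ _; rewrite scalerDr !scalerA mulrC.
- by move=> q Aq; exists q.
- move=> q; split=> [Aq|[_ [q' Aq' /(nzd_onI nxQ) <-]]] //.
  by split; [apply: AA'|exists q].
- by move=> _ [q Aq <-]; exists q; rewrite // subrr; case: (is_submod_scale_set sA).
Qed.

Lemma scale_set_sub A : is_submod A -> scale_set A `<=` A.
Proof. by move=> sA _ [q Aq <-]; apply: submodZ. Qed.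

Lemma len_endo_exists A A' : is_submod A -> is_submod A' -> mQ `<=` A -> A `<=` A' -> A' `<=` B ->
  exists n, len A A' n.
Proof.
move=> sA sA' mA AA' A'B; have [n ln] := endo_finite noethR localR dimR xm nx xxi.
by have [|p _ lp] := lenleP sA' AA' (n := n); [apply: lenle_sub ln|exists p].
Qed.

Lemma len_base n : len (line (x : R^o)) setT n -> len (scale_set RQ) RQ n.
Proof.
suff [] : len (line (x : R^o)) setT n <-> len (scale_set RQ) RQ n by [].
apply: (@len_corr _ _ _ (fun a : R^o => (a : R)%:A : Q)) => //.
- exact: is_submod_scale_set.
- exact: scale_set_sub.
- by move=> a u v _ _; rewrite scalerDl -[a *: u]/(a * u) scalerA.
- by move=> a _; exists a.
- move=> a; split=> [[c _ <-]|[_ [_ [c ->]]]].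
    by split=> //; exists c%:A; [exists c|rewrite scalerA [c *: _]mulrC].
  by rewrite scalerA => /(base_inj Qinj) <-; exists c => //; apply: mulrC.
- by move=> _ [a ->]; exists a => //; rewrite subrr; case: (is_submod_scale_set sRQ).
Qed.

(** [A / m] and [xA / xm] have equal lengths, so by additivity [A / xA] is as long as [m / xm],
    whatever [A] is; compare with [A = R]. *)
Lemma len_lattice A n : is_submod A -> mQ `<=` A -> A `<=` B ->
  len (line (x : R^o)) setT n -> len (scale_set A) A n.
Proof.
move=> sA mA AB /len_base lR.
have smx := is_submod_scale_set smQ; have mxm := scale_set_sub smQ.
have [n1 l1] : exists n1, len (scale_set mQ) mQ n1.
  have [c lc] := len_endo_exists smQ sRQ (@subset_refl _ _) mRQ RB.
  have l2 := len_scale_set smQ sRQ mRQ lc.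
  have smR : scale_set mQ `<=` scale_set RQ by move=> _ [q /mRQ Rq <-]; exists q.
  have l3 := len_add (is_submod_scale_set sRQ) sRQ smR (scale_set_sub sRQ) l2 lR.
  have [p [q [lp _ _]]] := len_split smQ sRQ mxm mRQ l3.
  by exists p.
suff key A' n' : is_submod A' -> mQ `<=` A' -> A' `<=` B -> len (scale_set A') A' n' -> n' = n1.
  have [c lc] := len_endo_exists smQ sA (@subset_refl _ _) mA AB.
  have lm := len_add smQ sA mxm mA l1 lc.
  have smA : scale_set mQ `<=` scale_set A by move=> _ [q /mA Aq <-]; exists q.
  have [p [q [lp lq _]]] := len_split (is_submod_scale_set sA) sA smA (scale_set_sub sA) lm.
  by rewrite (key RQ n) // -(key A q).
move=> sA' mA' A'B l.
have [c lc] := len_endo_exists smQ sA' (@subset_refl _ _) mA' A'B.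
have lm := len_add smQ sA' mxm mA' l1 lc.
have smA : scale_set mQ `<=` scale_set A' by move=> _ [q /mA' Aq <-]; exists q.
have lc' := len_scale_set smQ sA' mA' lc.
have := len_add (is_submod_scale_set sA') sA' smA (scale_set_sub sA') lc' l.
by move=> /(len_uniq lm)/eqP; rewrite addnC eqn_add2l => /eqP.
Qed.

Section Map.
Variable f : K -> Q.
Hypotheses (vf : endo_valued m f) (f1 : 1 \in endo_span m f).
Let fl : linear f := proj1 vf.
Let Bf : forall k, B (f k) := proj2 vf.
Local Notation K' := (range f).

Lemma is_submod_range_map : is_submod K'.
Proof.
split; first by exists 0; rewrite // (linear_fun0 fl).
by move=> a _ _ [u _ <-] [v _ <-]; exists (a *: u + v); rewrite ?fl.
Qed.

(** Multiply an expression of [1] as a sum of terms [b * f k] by [a]: each [a *: b] is again in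
    [m]. *)
Lemma max_range_span a : a \in m ->
  a%:A \in gen [set q | exists c k, c \in m /\ q = c *: f k].
Proof.
move: f1 => + am; suff H q : q \in endo_span m f ->
    a *: q \in gen [set q | exists c k, c \in m /\ q = c *: f k] by move/H.
move: q; apply: (gen_ind (P := fun q => a *: q \in gen _)).
  split; first by rewrite scaler0 rpred0.
  move=> b u v bu bv; rewrite scalerDr scalerA mulrC -scalerA.
  by apply: rpredD => //; apply: rpredZ.
move=> _ [b [k [Bb ->]]]; rewrite scalerAl; have [c cm ->] := Bb a am.
by rewrite -scalerAl mul1r; apply: mem_gen; exists c, k.
Qed.

Lemma max_sub_range : mQ `<=` K'.
Proof.
have sK := is_submod_range_map.
move=> _ [a am ->]; have := max_range_span am; move: (a%:A).
apply: (gen_ind (P := K')) => // _ [c [k [_ ->]]].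
by apply: submodZ => //; exists k.
Qed.

Lemma range_sub_endo : K' `<=` B. Proof. by move=> _ [k _ <-]. Qed.

Lemma embedding_injective (s : seq K) : (forall k, k \in gen [set` s]) -> injective f.
Proof.
move=> sT; pose N : set K := [set k | f k = 0].
have sN : is_submod N.
  split; first exact: linear_fun0.
  by move=> a u v fu fv; rewrite /N /mkset fl fu fv scaler0 addr0.
have sx := is_submod_line (x : R^o).
have [n ln] := finite_length_nzd noethR localR dimR nx sx (line_id (x : R^o)).
have [lam _ ll] := lenleP (@is_submodT _ R^o) (@subsetT _ _) ln.
have sxK := is_submod_multiples K x.
have soc : simple_socle m (multiples K x).
  have xl : linear (fun k : K => x *: k) by move=> a u v; rewrite scalerDr !scalerA mulrC.
  apply: (canonical_simple_socle (h := mklin xl) canK xm nxK nxK).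
  by move=> u v /(nzd_onI nxK).
(* The elements of [K] sent into [xK] by [R] form [xK], and those sent there by [x] form [K], so
   duality bounds [K / xK] by [R / xR]. *)
have lK : lenle (multiples K x) setT lam.
  have lin2 (c : K) : linear (fun a : R^o => (a : R) *: c).
    by move=> a u v; rewrite scalerDl -[a *: u]/(a * u) scalerA.
  have lin1 (a : R^o) : linear (fun c : K => (a : R) *: c).
    by move=> b u v; rewrite scalerDr !scalerA mulrC.
  have := dual_lenle (p := fun (c : K) (a : R^o) => (a : R) *: c) noethR localR lin2 lin1 sxK soc
    (@is_submodT _ K) sx (@is_submodT _ R^o) (@subsetT _ _) (proj1 ll).
  apply: lenle_sub.
    by move=> k [_ /(_ 1 I)]; rewrite scale1r.
  by move=> k _; split=> // _ [c _ <-]; exists (c *: k); rewrite // scalerA -[c *: _]/(c * x) mulrC.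
have sNx := is_submod_add sN sxK.
(* [K / (N + xK)] is [f(K) / x f(K)], already as long as [R / xR]; with [lK] this leaves [N] inside
   [xK]. *)
have lN : len (addm N (multiples K x)) setT lam.
  have lat := len_lattice is_submod_range_map max_sub_range range_sub_endo ll.
  apply: (proj2 (_ : len _ _ _ <-> len (scale_set K') K' lam)) lat.
  apply: (@len_corr _ _ _ f) => //.
  - exact/is_submod_scale_set/is_submod_range_map.
  - exact: is_submod_range_map.
  - exact: scale_set_sub is_submod_range_map.
  - by move=> a u v _ _; rewrite fl.
  - move=> k; split=> [[y [_ [fy [z _ <-] ->]]]|[_ [_ [z _ <-] e]]].
      split=> //; rewrite -[y]scale1r fl scale1r fy add0r; exists (f z); first by exists z.
      by rewrite (linear_funZ _ _ fl).
    exists (k - x *: z), (x *: z); rewrite subrK; split=> //; last by exists z.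
    by rewrite /N /mkset addrC -scaleNr fl -e scaleNr addNr.
  - move=> _ [k _ <-]; exists k => //; rewrite subrr.
    by case: (is_submod_scale_set is_submod_range_map).
have Nx : N `<=` multiples K x.
  apply: contrapT => nN.
  have [|n' lamE ln'] := lenle_lt sxK sNx _ (@subsetT _ _) lK.
    split; first exact: addm_subr.
    by move=> sub; apply: nN; apply: subset_trans sub; apply: addm_subl.
  by have := len_le_lenle lN ln'; rewrite lamE ltnn.
have [t tE] := noeth_submod noethR sN (fun k _ => sT k).
(* [f] kills [x *: z] only if it kills [z], so [N = x N]. *)
have N0 : N `<=` [set 0].
  apply: (nakayama noethR localR (@is_submod0 _ K) tE) => k Nk.
  have [z _ zk] := Nx k Nk; exists 0, k; split=> //; last by rewrite add0r.
  apply: mem_gen; exists x, z; split=> //; apply/(mem_gen_submod _ sN).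
  by apply: nxQ; rewrite -(linear_funZ _ _ fl) zk.
move=> u v uv; apply/eqP; rewrite -subr_eq0; apply/eqP/N0.
by rewrite /N /mkset addrC -scaleN1r fl uv scaleN1r addNr.
Qed.

Lemma range_simple_socle : injective f -> simple_socle m K'.
Proof. exact: (canonical_simple_socle (h := mklin fl) canK xm nxK nxQ). Qed.

Definition range_square : submodClosed Q := gen [set q | exists k l, q = f k * f l].
Local Notation K2 := [set q : Q | q \in range_square].

Lemma max_sub_square : mQ `<=` K2.
Proof.
move=> _ [a am ->]; have := max_range_span am; move: (a%:A).
apply: (gen_ind (P := fun q => q \in range_square)); first exact: is_submod_mem.
move=> _ [c [k [cm ->]]]; have := max_range_span cm; rewrite -[f k]mul1r scalerAl.
move: (c%:A); apply: (gen_ind (P := fun q => q * f k \in range_square)).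
  split; first by rewrite mul0r rpred0.
  by move=> b u v bu bv; rewrite mulrDl -scalerAl; apply: rpredD => //; apply: rpredZ.
move=> _ [d [l [dm ->]]]; rewrite -scalerAl; apply: rpredZ; apply: mem_gen.
by exists l, k.
Qed.

Lemma endo_span_sub (H : set Q) : is_submod H -> (forall b k, B b -> H (b * f k)) -> B `<=` H.
Proof.
move=> sH HH b Bb; rewrite -[b]mulr1; move: f1.
apply: (gen_ind (P := fun q => H (b * q))).
  split; first by rewrite mulr0; case: sH.
  by move=> a u v bu bv; rewrite mulrDr -scalerAr; apply: (proj2 sH).
by move=> _ [c [k [Bc ->]]]; rewrite mulrA; apply: HH; apply: endoM.
Qed.

Lemma range_square_sub : K2 `<=` B.
Proof.
apply: (gen_ind (P := B)) => // _ [k [l ->]]; exact: endoM.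
Qed.

(* [K'] has colength at most one in [B]: were [K' * K'] contained in a hyperplane [H],
   then [K'] would be a line modulo the largest ideal [J] contained in [H], and lifting a
   generator of [B / J] would give a unit. *)
Lemma unit_or_square : injective f ->
  (exists k, exists2 b, B b & b * f k = 1) \/ B `<=` K2.
Proof.
move=> fI; have sK := is_submod_range_map.
case: (pselect (B `<=` K2)) => [|nBK2]; [by right|left].
have [H [sH K2H HB nBH maxH]] : exists H : set Q, [/\ is_submod H, K2 `<=` H, H `<=` B,
    ~ (B `<=` H) & forall C, is_submod C -> H `<` C -> C `<=` B -> B `<=` C].
  have [n ln] : exists n, lenle K2 B n.
    have [n ln] := endo_finite noethR localR dimR xm nx xxi.
    by exists n; apply: lenle_sub ln => //; apply: max_sub_square.
  have sK2 : is_submod K2 by apply: is_submod_mem.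
  move: sK2 nBK2 range_square_sub (@subset_refl _ K2) ln.
  move: {1 2 3 5 6}K2; elim: n => [|n IH] C sC nBC CB K2C lC.
    by case: nBC; apply: lenle0 lC sC sB CB.
  case: (pselect (forall D, is_submod D -> C `<` D -> D `<=` B -> B `<=` D)) => [max|].
    by exists C.
  move=> /existsNP[D /not_implyP[sD /not_implyP[CD /not_implyP[DB nBD]]]].
  have [_ [<-] lD] := lenle_lt sC sD CD DB lC.
  by apply: (IH D) => //; apply: subset_trans K2C _; case: CD.
have Hsimple b1 b2 : B b1 -> B b2 -> ~ H b1 -> exists c, H (b2 - c *: b1).
  move=> Bb1 Bb2 nHb1; have sH' := is_submod_add sH (is_submod_line b1).
  have [||q [_ [Hq [c _ <-] ->]]] := maxH _ sH' _ _ b2 Bb2.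
  - split; first exact/addm_subl/is_submod_line.
    by move=> /(_ b1) Hb1; apply/nHb1/Hb1; apply: addm_subr (line_id _).
  - by apply: addm_sub => //; apply: line_sub.
  by exists c; rewrite addrK.
have KH k l : H (f k * f l) by apply: K2H; apply: mem_gen; exists k, l.
have soc := range_simple_socle fI.
(* [m B] lies in [m], hence in [K'], so [B / K'] is contained in a simple socle. *)
have Kcodim b1 b2 : B b1 -> B b2 -> ~ K' b1 -> exists c, K' (b2 - c *: b1).
  move=> Bb1 Bb2 nKb1; have mK b : B b -> forall a, a \in m -> K' (a *: b).
    by move=> Bb a am; apply: max_sub_range; apply: Bb.
  by have [|//] := soc b1 b2 (mK _ Bb1) (mK _ Bb2).
have [k1 [b1 Bb1 nHb1]] : exists k1, exists2 b1, B b1 & ~ H (b1 * f k1).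
  apply: contrapT => no; apply: nBH; apply: endo_span_sub => // b k Bb.
  by apply: contrapT => nH; apply: no; exists k, b.
pose J : set Q := [set j | B j /\ forall b, B b -> H (b * j)].
have sJ : is_submod J.
  split; first by split=> [|b _]; rewrite ?mulr0; [case: sB|case: sH].
  move=> a u v [Bu Hu] [Bv Hv]; split; first exact: (proj2 sB).
  by move=> b Bb; rewrite mulrDr -scalerAr; apply: (proj2 sH); [apply: Hu|apply: Hv].
have JB b j : B b -> J j -> J (b * j).
  move=> Bb [Bj Hj]; split; first exact: endoM.
  by move=> c Bc; rewrite mulrA; apply: Hj; apply: endoM.
(* Since [B = K' + R b'], it is enough to test [w] against [K'] and one [b'] outside it. *)
have KB w : (forall k, H (f k * w)) -> forall b' : Q, B b' -> ~ K' b' -> H (b' * w) ->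
    forall b, B b -> H (b * w).
  move=> Hw b' Bb' nKb' Hbw b Bb; have [c [k _ kE]] := Kcodim b' b Bb' Bb nKb'.
  rewrite -[b](subrK (c *: b')) -kE mulrDl; apply: submodD => //.
  by rewrite -scalerAl; apply: submodZ.
have nKb1 : ~ K' b1 by move=> [k _ kE]; apply: nHb1; rewrite -kE; apply: KH.
(* An element of [J] outside [K'] could serve as [b'] for [w = f k1], against the choice of [b1]. *)
have JK : J `<=` K'.
  move=> j [Bj Hj]; apply: contrapT => nKj; apply: nHb1.
  apply: (KB (f k1) _ j) => //; rewrite mulrC; exact: Hj.
(* [c] is chosen so that [b1] times the difference is in [H]; [KB] applies with [b' = b1]. *)
have KJ k : exists c, J (f k - c *: f k1).
  have [c Hc] := Hsimple _ _ (endoM Bb1 (Bf k1)) (endoM Bb1 (Bf k)) nHb1.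
  exists c; split; first by apply: (submodB sB) => //; apply: (submodZ _ sB).
  apply: (KB _ _ b1) => // [l|]; last by rewrite mulrBr -scalerAr.
  by rewrite mulrBr -scalerAr; apply: submodB => //; apply: submodZ.
(* Avoidance for the single element [f k1], corrected by [J]: a maximal ideal containing both would
   contain [K'], hence [B]. *)
have [|e d d' Be Jd Jd'|u|d u Jd|M maxM|d Jd good] :=
  @endo_avoidance _ _ noethR localR dimR _ _ _ xm nx xxi unit (fun=> f k1) [set d | forall u, J (d u)].
- by move=> u; case: sJ.
- by move=> u; apply: submodD => //; apply: JB.
- exact: Bf.
- by have [] := Jd u.
- case: (pselect (M (f k1))) => [Mk1|]; last by left; exists tt.
  right; apply: contrapT => no; have [[sM MB idM] _ nM1 _] := maxM; apply: nM1.
  have JM j : J j -> M j.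
    by move=> Jj; apply: contrapT => nMj; apply: no; exists (fun=> j) => //; exists tt.
  suff BM : B `<=` M by apply/BM/endo1.
  apply: endo_span_sub => // b k Bb; apply: idM => //.
  have [c Jc] := KJ k; rewrite -[f k](subrK (c *: f k1)); apply: submodD => //; first exact: JM.
  exact: submodZ.
have [k kE] : exists k, f k = f k1 + d tt.
  by have [k _ kE] := JK _ (Jd tt); exists (k + k1); rewrite -[k]scale1r fl scale1r kE addrC.
exists k; have Bk := Bf k.
have sI : is_submod [set b * f k | b in B].
  split; first by exists 0; rewrite ?mul0r //; case: sB.
  move=> a _ _ [b Bb <-] [c Bc <-]; exists (a *: b + c); first exact: (proj2 sB).
  by rewrite mulrDl scalerAl.
have idI : endo_ideal m [set b * f k | b in B].
  split=> //; first by move=> _ [b Bb <-]; apply: endoM.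
  by move=> b _ Bb [c Bc <-]; exists (b * c); [apply: endoM|rewrite mulrA].
have [M maxM|b Bb bE] := endo_unit_ideal noethR localR dimR xm nx xxi idI; last by exists b.
have [[] nM] := good M maxM; exists (f k); last by rewrite kE.
by exists 1; [apply: endo1|rewrite mul1r].
Qed.

End Map.

(** When some [f k] is a unit of [B], dividing by it puts [1] into the image. *)
Lemma normalized_generator (f : K -> Q) : endo_valued m f -> injective f -> 1 \in endo_span m f ->
  exists f', [/\ endo_valued m f', injective f', 1 \in endo_span m f' &
    (exists k, f' k = 1) \/ B `<=` [set q | q \in range_square f']].
Proof.
move=> vf fI f1; have [[k [b Bb bk]]|sq] := unit_or_square vf f1 fI; last first.
  by exists f; split=> //; right.
have [fl Bf] := vf; exists (fun k => b * f k); split; last by left; exists k.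
- split; first by move=> a u v; rewrite fl mulrDr -scalerAr.
  by move=> l; apply: endoM.
- move=> u v buv; apply: fI; rewrite -[f u]mul1r -[f v]mul1r -bk.
  by rewrite mulrAC [RHS]mulrAC buv.
- by apply: mem_gen; exists 1, k; rewrite mul1r bk; split=> //; apply: endo1.
Qed.

End GeneratingMap.

(** * Hilbert function of the canonical ideal *)

Section TypeExists.
Variables (R : comNzRingType) (m : ideal R).
Hypotheses (noethR : noetherian R) (localR : local_ring m) (dimR : krull_dim R^o 1).

Lemma type_exists x : x \in m -> nzd_on R^o x ->
  exists2 r, len (multiples R^o x) (col_max R^o m x) r & type_is m R^o r.
Proof.
move=> xm nx; have sx := is_submod_multiples R^o x.
have [|n ln] := finite_length_nzd noethR localR dimR nx sx.
  by exists 1; rewrite // /GRing.scale /= mulr1.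
have [|r _ lr] := lenleP (is_submod_col_max R^o m x) (@multiples_sub_col_max _ R^o m x) (n := n).
  exact: lenle_sub ln.
exists r => //; have gen1 z : z \in gen [set` [:: @qproj _ R^o m 1]].
  have [a <-] := qproj_surj z.
  have -> : @qproj _ R^o m a = a *: (@qproj _ R^o m 1 : residue_field m).
    by rewrite -linearZ /GRing.scale /= mulr1.
  by apply: rpredZ; apply: mem_gen; rewrite /= mem_head.
have [P0 [P1 [P2 [d2 [d1 [d0 [proj [d0T e1 e2]]]]]]]] := fg_resolution noethR gen1.
exists P0, P1, P2, d2, d1, d0; split=> //; split=> //.
by have [p0 _ _] := proj; apply/(ext1_len r xm nx p0 d0T e1 e2).
Qed.

End TypeExists.

Section PowersOfCanonical.
Variables (R : comNzRingType) (m : ideal R) (K : lmodType R).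
Hypotheses (noethR : noetherian R) (localR : local_ring m) (dimR : krull_dim R^o 1).
Variables (x : R) (Q : comAlgType R) (xi : Q).
Hypotheses (xm : x \in m) (nx : nzd_on R^o x) (xxi : x *: xi = 1)
  (Qinj : forall a : R, a *: (1 : Q) = 0 -> a = 0).
Local Notation RQ := (@base_ring R Q).
Local Notation mQ := (@base_max R m Q).
Local Notation B := (@endo_ring R m Q).
Variable f : K -> Q.
Hypotheses (vf : endo_valued m f) (f1 : 1 \in endo_span m f).
Hypothesis fnorm : (exists k, f k = 1) \/ B `<=` [set q | q \in range_square f].
Let fl : linear f := proj1 vf.
Let Bf : forall k, B (f k) := proj2 vf.
Let sB : is_submod B := is_submod_endo m Q.

Fixpoint cpow (n : nat) : submodClosed Q :=
  if n is n'.+1 then gen [set q | exists k q', q' \in cpow n' /\ q = f k * q'] else gen RQ.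
Local Notation C n := [set q : Q | q \in cpow n].

Lemma cpow_sub_endo n : C n `<=` B.
Proof.
elim: n => [|n IH].
  by apply: (gen_ind (P := B)) => // q Rq; apply: base_sub_endo.
apply: (gen_ind (P := B)) => // _ [k [q [/IH Bq ->]]]; exact: endoM.
Qed.

Lemma max_sub_cpow n : mQ `<=` C n.
Proof.
(* The induction needs the stronger claim that [m] lies in [m C n]. *)
suff H a : a \in m -> a%:A \in gen [set q | exists c q', [/\ c \in m, q' \in cpow n & q = c *: q']].
  move=> _ [a /H am ->]; move: am; apply: (gen_ind (P := C n)); first exact: is_submod_mem.
  by move=> _ [c [q [_ qn ->]]]; apply: rpredZ.
elim: n a => [|n IH] a am.
  apply: mem_gen; exists a, 1; split=> //; apply: mem_gen.
  by exists 1; rewrite scale1r.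
pose G := gen [set q | exists c q', [/\ c \in m, q' \in cpow n.+1 & q = c *: q']].
have := max_range_span f1 am; move: (a%:A); apply: (gen_ind (P := fun q => q \in G)).
  exact: is_submod_mem.
move=> _ [c [k [cm ->]]]; have := IH c cm; rewrite -[f k]mul1r scalerAl.
move: (c%:A); apply: (gen_ind (P := fun q => q * f k \in G)).
  split; first by rewrite mul0r rpred0.
  by move=> b u v bu bv; rewrite mulrDl -scalerAl; apply: rpredD => //; apply: rpredZ.
move=> _ [d [q [dm qn ->]]]; apply: mem_gen; exists d, (f k * q).
split=> //; last by rewrite -scalerAl [q * _]mulrC.
by apply: mem_gen; exists k, q.
Qed.

(** If [1] is in the image, the powers increase and [B] bounds their lengths; in the other case they
    equal [B] from the second on. *)
Lemma cpow_stable : exists d n1, forall n, (n1 <= n)%N -> len mQ (C n) d.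
Proof.
have lenC n : exists d, len mQ (C n) d.
  have sC := is_submod_mem (cpow n).
  apply: (len_endo_exists noethR localR dimR xm nx xxi (is_submod_base_max m Q) sC) => //.
  - exact: max_sub_cpow.
  - exact: cpow_sub_endo.
case: fnorm => [[k0 k0E]|sq].
  have incr n : C n `<=` C n.+1.
    by move=> q qn; apply: mem_gen; exists k0, q; rewrite k0E mul1r.
  have incr' i n : C n `<=` C (n + i)%N.
    elim: i => [|i IH]; first by rewrite addn0.
    by apply: subset_trans IH _; rewrite addnS; apply: incr.
  have [N lN] := endo_finite noethR localR dimR xm nx xxi.
  have hcC n d : hc mQ d (C n) -> (d <= N)%N by move=> h; apply: (lN _ _ h); apply: cpow_sub_endo.
  have [|d [n h]|d [n1 h] dmax] := nat_max (Q := fun d => exists n, hc mQ d (C n)) (N := N).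
  - by exists 0%N; apply: hc0; [apply: is_submod_mem|apply: max_sub_cpow].
  - exact: hcC h.
  exists d, n1 => n n1n; have [d' ld'] := lenC n.
  suff -> : d = d' by [].
  apply/eqP; rewrite eqn_leq (dmax d'); last by exists n; case: ld'.
  rewrite andbT; apply: (proj1 ld' d (C n1) h).
  by rewrite -(subnKC n1n); apply: incr'.
have [d ld] := lenC 2%N; exists d, 2%N => n n2.
have CB i : C i.+2 = B.
  apply/seteqP; split; first exact: cpow_sub_endo.
  elim: i => [|i IH].
    apply: subset_trans sq _.
    apply: (gen_ind (P := C 2%N)); first exact: is_submod_mem.
    move=> _ [k [l ->]]; apply: mem_gen; exists k, (f l); split=> //.
    apply: mem_gen; exists l, 1; rewrite mulr1; split=> //.
    by apply: mem_gen; exists 1; rewrite scale1r.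
  apply: (endo_span_sub f1 (is_submod_mem _)) => b k /IH bC.
  by apply: mem_gen; exists k, b; rewrite mulrC.
by have -> : C n = C 2%N by rewrite -(subnKC n2) !add2n !CB.
Qed.

Variable g : {linear K -> R^o}.
Hypothesis gE : forall k, (g k : R)%:A = x *: f k.
Local Notation I := (gen (range g)).

Lemma mem_range_ideal a : a \in I <-> exists k, g k = a.
Proof.
have sg : is_submod (range g).
  split; first by exists 0; rewrite ?linear0.
  by move=> b _ _ [u _ <-] [v _ <-]; exists (b *: u + v); rewrite ?linearP.
split=> [/(mem_gen_submod _ sg)[k _ <-]|[k <-]]; first by exists k.
by apply: mem_gen; exists k.
Qed.

Lemma scale_range_mul k (b : R) q n : b%:A = x ^+ n *: q ->
  ((g k : R) * b)%:A = x ^+ n.+1 *: (f k * q).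
Proof.
move=> e; have -> : ((g k : R) * b)%:A = (g k : R)%:A * b%:A :> Q.
  by rewrite -scalerAl mul1r scalerA.
by rewrite gE e -scalerAl -scalerAr scalerA exprS.
Qed.

Lemma pow_cpow n : (forall a : R, pow I n a -> exists2 q, C n q & a%:A = x ^+ n *: q) /\
  (forall q, C n q -> exists2 a : R, pow I n a & a%:A = x ^+ n *: q).
Proof.
elim: n => [|n [IH1 IH2]].
  split=> [a _|]; first by exists a%:A; [apply: mem_gen; exists a|rewrite scale1r].
  move=> q /(mem_gen_submod _ (is_submod_base_ring Q))[a ->].
  by exists a; [apply: pow0|rewrite scale1r].
split.
  apply: (gen_ind (P := fun a : R^o => exists2 q, C n.+1 q & (a : R)%:A = x ^+ n.+1 *: q)).
    split; first by exists 0; [apply: rpred0|rewrite scale0r scaler0].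
    move=> c u v [p pC pE] [q qC qE]; exists (c *: p + q).
      by apply: rpredD => //; apply: rpredZ.
    by rewrite scalerDl -[c *: u]/(c * u) -scalerA pE qE scalerDr !scalerA mulrC.
  move=> _ [a [b [/mem_range_ideal[k <-] /IH1[q qC qE] ->]]].
  exists (f k * q); first by apply: mem_gen; exists k, q.
  exact: scale_range_mul.
apply: (gen_ind (P := fun q => exists2 a : R, pow I n.+1 a & a%:A = x ^+ n.+1 *: q)).
  split; first by exists 0; [case: (is_submod_pow I n.+1)|rewrite scale0r scaler0].
  move=> c p q [u uP uE] [v vP vE]; exists (c * u + v).
    exact: (proj2 (is_submod_pow I n.+1)).
  by rewrite scalerDl -scalerA uE vE scalerDr !scalerA mulrC.
move=> _ [k [q [/IH2[b bP bE] ->]]]; exists ((g k : R) * b).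
  by apply: powS => //; apply/mem_range_ideal; exists k.
exact: scale_range_mul.
Qed.

(** The [1] is the length of [R / m]: [x^n m] has colength [n * lam + 1], and [I^n / x^n m] is a
    copy of [C n / m]. *)
Lemma len_pow lam n d : len (line (x : R^o)) setT lam -> len mQ (C n) d ->
  exists2 l, len (pow I n) setT l & (l + d = n * lam + 1)%N.
Proof.
move=> ll ld; have [I1 I2] := pow_cpow n.
have nxn := nzd_on_exp (k := n) nx; have smx := is_submod_mem m.
pose A := mulset (x ^+ n) [set a : R^o | a \in m].
have sA : is_submod A by apply: is_submod_mulset.
have sP := is_submod_pow I n.
have psi (a : R) q : a%:A = x ^+ n *: q -> a *: xi ^+ n = q.
  move=> e; rewrite -[xi ^+ n]mul1r scalerAl e -scalerAl scalerAr.
  suff -> : x ^+ n *: xi ^+ n = 1 by rewrite mulr1.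
  by rewrite -exprZn xxi expr1n.
have AP : A `<=` pow I n.
  move=> _ [a am <-]; have [|b bP bE] := I2 a%:A; first by apply: max_sub_cpow; exists a.
  suff -> : x ^+ n * a = b by [].
  by apply: (base_inj Qinj); rewrite bE scalerA.
have lA : len A (pow I n) d.
  apply: (proj2 (_ : len A (pow I n) d <-> len mQ (C n) d)) ld.
  apply: (@len_corr _ _ _ (fun a : R^o => (a : R) *: xi ^+ n)) => //.
  - exact: is_submod_base_max.
  - exact: is_submod_mem.
  - exact: max_sub_cpow.
  - by move=> a u v _ _; rewrite scalerDl -[a *: u]/(a * u) scalerA.
  - by move=> b /I1[q qC /psi->].
  - move=> b; split=> [Ab|[Pb [a am bE]]].
      split; first exact: AP.
      by have [a am <-] := Ab; exists a => //; apply: psi; rewrite scalerA.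
    exists a => //; have [q _ qE] := I1 b Pb.
    by apply: (base_inj Qinj); rewrite qE -scalerA -bE (psi _ _ qE).
  - move=> q /I2[a aP /psi aE]; exists a => //; rewrite aE subrr.
    by case: (is_submod_base_max m Q).
have lm : len [set a : R^o | a \in m] setT 1.
  split; last first.
    apply: (hcS (hc0 smx (@subset_refl _ _))) => //; split; first exact: subsetT.
    by move=> /(_ 1 Logic.I)/=; rewrite (negPf (max_ideal1 localR)).
  apply: (lenle_socle noethR localR (t := 1 : R^o) smx) => [a am|a _].
    by rewrite /mkset /GRing.scale /= mulr1.
  exists 0, a; rewrite add0r; split=> //; first exact: rpred0.
  by exists a; rewrite // /GRing.scale /= mulr1.
have := len_mulset nxn smx (@is_submodT _ R^o) (@subsetT _ _) lm; rewrite mulsetT => l1.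
have sx := is_submod_line (x ^+ n : R^o).
have lT := len_add sx (@is_submodT _ R^o) _ (@subsetT _ _) l1 (len_line_exp _ nx ll).
have [|p [q [lp lq e]]] := len_split sP (@is_submodT _ R^o) AP (@subsetT _ _) (lT _).
  by move=> _ [a _ <-]; exists a => //; apply: mulrC.
exists q => //; rewrite -(len_uniq lp lA) addnC -e; exact: addnC.
Qed.

Lemma powers_hilbert : exists d lam n1, [/\ forall n, (n1 <= n)%N -> len mQ (C n) d,
  len (line (x : R^o)) setT lam & hilbert_e1_is I (d%:Z - 1)].
Proof.
have [d [n1 dE]] := cpow_stable.
have [N lN] := finite_length_nzd noethR localR dimR nx (is_submod_line _) (line_id (x : R^o)).
have [lam _ ll] := lenleP (@is_submodT _ R^o) (@subsetT _ _) lN.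
exists d, lam, n1; split=> //; exists lam%:Z, n1 => n nn1.
have [|l lP e] := len_pow (n := n.+1) ll (dE n.+1 _); first exact: leqW.
exists l; first exact/length_quot.
lia.
Qed.

End PowersOfCanonical.

(** * From the trace to almost Gorenstein *)

Lemma linear_range_iso (R : comNzRingType) (K : lmodType R) (g : {linear K -> R^o}) :
  injective g -> iso (submod (gen (range g))) K.
Proof.
move=> gI; have mem k : g k \in gen (range g) by apply: mem_gen; exists k.
have sg : is_submod (range g).
  split; first by exists 0; rewrite ?linear0.
  by move=> b _ _ [u _ <-] [v _ <-]; exists (b *: u + v); rewrite ?linearP.
pose h k : submod (gen (range g)) := Sub (g k) (mem k).
have hl : linear h by move=> a u v; apply: val_inj; rewrite [RHS]linearP !SubK linearP.
have hb : bijective (mklin hl).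
  have hI : injective h by move=> u v /(congr1 val); rewrite !SubK => /gI.
  have /choice[k kE] : forall y, exists k, h k = y.
    case=> y ym; have [k _ kE] := (mem_gen_submod y sg).1 ym.
    by exists k; apply: val_inj; rewrite SubK kE.
  by exists k => u; [apply: hI; rewrite kE|rewrite -[RHS]kE].
have [h' hK h'K] := linear_inverse hb.
by exists h'; exists (mklin hl).
Qed.

Theorem trace_almost_gorenstein (R : comNzRingType) (m : ideal R) (K : lmodType R)
    (noethR : noetherian R) (localR : local_ring m)
    (cmR : cohen_macaulay m R^o) (dimR : krull_dim R^o 1) (canK : canonical_module m K) :
  {subset m <= trace (submod (mulI m (full K)))} -> almost_gorenstein m K.
Proof.
move=> trm; have [x xm nx] := regular_element cmR dimR.
have [cmK dimK _ _] := canK; have [[s sE] _] := cmK.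
have sT k : k \in gen [set` s] by rewrite -sE; apply: mem_full.
(* [x] divides a power of an element that is regular on [K]. *)
have nxK : nzd_on K x.
  have [y ym ny] := regular_element cmK dimK.
  have [N [c _ cE]] := radical_nzd noethR localR dimR nx ym.
  move=> k xk; elim: N cE => [|N IH] cE.
    by rewrite -[k]scale1r -[1]/(y ^+ 0) -cE -[c *: _]/(c * x) -scalerA xk scaler0.
  have : y ^+ N.+1 *: k = 0 by rewrite -cE -[c *: _]/(c * x) -scalerA xk scaler0.
  by elim: (N.+1) => [|M IH']; rewrite ?scale1r // exprS -scalerA => /ny.
have [r lr typ] := type_exists noethR localR dimR xm nx.
(* If [a] generates [m], then [K / aK] is its own socle, hence simple, and [K] is free on [t]. The
   ideal is then [R], with [e1 = 0]. *)
case: (pselect (exists2 a : R, a \in m & forall b : R, b \in m -> exists c, b = c * a)).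
  move=> [a am aE]; have [c cE] := aE x xm.
  have na : nzd_on R^o a by apply: (nzd_on_dvd nx (z := c)); rewrite mulrC.
  have naK : nzd_on K a by move=> k ak; apply: nxK; rewrite cE -scalerA ak scaler0.
  have [t _ nt] := nonzero_mod_canonical canK am naK.
  have soc : simple_socle m (multiples K a).
    have al : linear (fun k : K => a *: k) by move=> b u v; rewrite scalerDr !scalerA mulrC.
    apply: (canonical_simple_socle (h := mklin al) canK am naK naK).
    by move=> u v /(nzd_onI naK).
  have maK b (k : K) : b \in m -> multiples K a (b *: k).
    by move=> /aE[d ->]; exists (d *: k); rewrite // scalerA mulrC.
  have sKt : [set: K] `<=` line t.
    apply: (nakayama noethR localR (is_submod_line t) (A := setT) (s := s)) => [k|k _].
      by split=> // _; apply: sT.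
    have [|[b [k' _ e]]] := soc t k (fun b => @maK b t) (fun b => @maK b k); first by [].
    exists (b *: t), (k - b *: t); split; [by exists b| |by rewrite addrC subrK].
    by rewrite /mkset -e; apply: mem_gen; exists a, k'; split=> //; apply: mem_gen.
  have tl : linear (fun b : R^o => (b : R) *: t).
    by move=> b u v; rewrite scalerDl -[b *: u]/(b * u) scalerA.
  have tI : injective (fun b : R^o => (b : R) *: t).
    pose L : set R^o := [set b | (b : R) *: t = 0].
    have sL : is_submod L.
      split; first exact: scale0r.
      move=> b u v; rewrite /L /mkset => ut vt.
      by rewrite scalerDl -[b *: u]/(b * u) -scalerA ut vt scaler0 addr0.
    have [u uE] := noeth_fg noethR sL.
    (* A unit cannot kill [t], and [d * a] kills [t] only if [d] does; hence [L = m L]. *)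
    have L0 : L `<=` [set 0].
      apply: (nakayama noethR localR (@is_submod0 _ R^o) uE) => b Lb.
      have bm : b \in m.
        apply: contrapT => /negP /(unit_not_max noethR localR)[d dE].
        by apply: nt; exists 0; rewrite // -[t]scale1r -dE -scalerA Lb !scaler0.
      have [d dE] := aE b bm; exists 0, b; rewrite add0r; split=> //.
      apply: mem_gen; exists a, d; split=> //; last by rewrite dE mulrC.
      apply/(mem_gen_submod _ sL); apply: naK.
      by rewrite scalerA mulrC -dE.
    move=> u1 u2 e; apply/eqP; rewrite -subr_eq0; apply/eqP/L0.
    by rewrite /L /mkset scalerBl e subrr.
  have tb : bijective (mklin tl).
    have /choice[d dE] : forall k, exists b, b *: t = k.
      by move=> k; have [b _ bE] := sKt k I; exists b.
    by exists d => u; [apply: tI; rewrite dE|rewrite -[RHS]dE].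
  have [h tK hK] := linear_inverse tb.
  have hI : injective h by apply: can_inj hK.
  exists (gen (range h)), 0, r; split=> //; first exact: linear_range_iso.
  exists 0, 0%N => n _; exists 0%N => //; apply/length_quot.
  suff -> : [set a0 | a0 \in ideal_exp (gen (range h)) n.+1] = setT by apply: len_id.
  apply/seteqP; split=> // b _; elim: n.+1 => [|n' IH]; first exact: pow0.
  rewrite -[b]mul1r; apply: powS => //.
  by apply: mem_gen; exists (1 *: t) => //; apply: (tK 1).
move=> nprin.
have [Q [xi [xxi Qinj]]] := localization_exists nx.
have [f0 vf0 f01] := generator_exists noethR localR dimR xm nx xxi Qinj nprin trm.
have f0I := embedding_injective noethR localR dimR canK xm nx nxK xxi Qinj vf0 f01 sT.
have [f [vf fI f1 fnorm]] := normalized_generator noethR localR dimR canK xm nx nxK xxi vf0 f0I f01.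
have [fl Bf] := vf.
have /choice[g gE] : forall k, exists a : R, a%:A = x *: f k.
  by move=> k; have [a _ aE] := Bf k x xm; exists a.
have gl : linear (g : K -> R^o).
  move=> a u v; apply: (base_inj Qinj); rewrite gE fl scalerDr scalerDl -scalerA !gE.
  by rewrite !scalerA mulrC.
have gI : injective g by move=> u v e; apply/fI/(nzd_onI (nzd_on_loc xxi)); rewrite -!gE e.
have [d [lam [n1 [dE ll hil]]]] :=
  powers_hilbert noethR localR dimR xm nx xxi Qinj vf f1 fnorm (g := mklin gl) gE.
exists (gen (range (mklin gl))), (d%:Z - 1), r; split=> //; first exact: linear_range_iso.
have smQ := is_submod_base_max m Q; have sRQ := is_submod_base_ring Q.
(* [R / m] has length one, and multiplication by [x] identifies [B / R] with the socle of [R / R x],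
   of length [r]. *)
have lB : lenle (@base_max R m Q) (@endo_ring R m Q) (1 + r).
  apply: (lenle_add sRQ (is_submod_endo m Q)); [exact: max_sub_base|exact: base_sub_endo| |].
    apply: (lenle_socle noethR localR (t := 1 : Q) smQ) => [a am|_ [a ->]]; first by exists a.
    by exists 0, a%:A; rewrite add0r; split=> //; [case: smQ|exists a].
  apply: (proj1 (_ : len _ _ r)).
  apply: (proj1 (_ : len (multiples R^o x) (col_max R^o m x) r <-> _)) lr.
  have xiE (a b : R) : a = x * b -> a *: xi = b%:A.
    by move=> ->; rewrite mulrC -scalerA xxi.
  apply: (@len_corr _ _ _ (fun a : R^o => (a : R) *: xi)) => //.
  - exact: is_submod_col_max.
  - exact: is_submod_endo.
  - exact: base_sub_endo.
  - by move=> a u v _ _; rewrite scalerDl -[a *: u]/(a * u) scalerA.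
  - move=> a colA; apply: (endo_of_dual noethR localR Qinj nprin) => b bm.
    by have [c _ cE] := colA b bm; exists c; rewrite scalerA; apply: xiE.
  - move=> a; split=> [xa|[_ [c cE]]].
      split; first exact: multiples_sub_col_max.
      by have [c _ cE] := xa; exists c; apply: xiE.
    exists c => //; apply: (base_inj Qinj).
    by rewrite -[x *: _]/(x * c) -scalerA -cE scalerA mulrC -scalerA xxi.
  move=> b Bb; have [a _ aE] := Bb x xm.
  have abE : a *: xi = b by rewrite -[xi]mul1r scalerAl -aE -scalerAl scalerAr xxi mulr1.
  exists a; last by rewrite abE subrr; case: sRQ.
  move=> c cm; have [e _ eE] := Bb c cm; exists e => //.
  apply: (base_inj Qinj); rewrite -[c *: (a : R^o)]/(c * a) -[x *: (e : R^o)]/(x * e).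
  by rewrite -!scalerA -aE -eE !scalerA mulrC.
have : (d <= 1 + r)%N.
  apply: (len_le_lenle (dE n1 (leqnn _))); apply: lenle_sub lB => //.
  exact: cpow_sub_endo.
lia.
Qed.

Theorem theorem1p1 (R : comNzRingType) (m : ideal R) (K : lmodType R)
    (noethR : noetherian R) (localR : local_ring m)
    (cmR : cohen_macaulay m R^o) (dimR : krull_dim R^o 1)
    (canK : canonical_module m K) :
  almost_gorenstein m K <->
  {subset m <= trace (submod (mulI m (full K)))}.
Proof.
split; first exact: almost_gorenstein_trace.
exact: trace_almost_gorenstein.
Qed.
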